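(* Let $Z$ be a well-ordered set, let $\geq_{\rm IM}$ be an invariant monomial order on $\mathfrak{S}(Z)$, let $S$ be a monic subset of $\mathrm{OLie}(Z)$, and let $\Pi^{\rm Lie}_S$ be the term-rewriting system on $\mathrm{OLie}(Z)$ associated with $S$. The following statements are equivalent. (a) $\Pi^{\rm Lie}_S$ is convergent. (b) $\Pi^{\rm Lie}_S$ is confluent. (c) $\mathrm{Id}_{\rm Lie}(S)\oplus\mathbf{k}\,\mathrm{Irr}_{\rm Lie}(S)=\mathrm{OLie}(Z)$. (d) $S$ is a Gröbner-Shirshov basis in $\mathrm{OLie}(Z)$ with respect to $\geq_{\rm IM}$.
   Context: Let $\mathbf{k}$ be a field. Bracketed words. For a set $Y$, $S(Y)$ is the free semigroup on $Y$ (nonempty words) and $\lfloor Y\rfloor$ is a disjoint copy of $Y$. Put $\mathfrak{S}(Z)_0=S(Z)$, $\mathfrak{S}(Z)_{n+1}=S(Z\sqcup\lfloor\mathfrak{S}(Z)_n\rfloor)$, $\mathfrak{S}(Z)=\bigcup_n\mathfrak{S}(Z)_n$. Elements of $Z\sqcup\lfloor\mathfrak{S}(Z)\rfloor$ are prime; every $w\in\mathfrak{S}(Z)$ is uniquely a product $w_1\cdots w_k$ of primes, and $|w|=k$ is its breadth. $\mathbf{k}\mathfrak{S}(Z)$ is the semigroup algebra with linear operator $\lfloor\ \rfloor$. $\mathfrak{S}^\star(Z)$ is the set of words in $\mathfrak{S}(Z\sqcup\{\star\})$ with exactly one $\star$; $q|_u$ is $q$ with $\star$ replaced by $u$, extended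 linearly in $u\in\mathbf{k}\mathfrak{S}(Z)$. Orders. A monomial order is a well order $\geq$ on $\mathfrak{S}(Z)$ with $u>v\Rightarrow q|_u>q|_v$ for all $q\in\mathfrak{S}^\star(Z)$. It is invariant if for all primes $u_1,\dots,u_n$ and permutations $\sigma$: $u_1\cdots u_n\geq u_{\sigma(1)}\cdots u_{\sigma(n)}\iff u_1\cdots u_n\succeq_{\rm lex}u_{\sigma(1)}\cdots u_{\sigma(n)}$, where $\succeq$ is the restriction of $\geq$ to primes; in the lex-order the empty word is larger than all nonempty words, and $xu'>_{\rm lex}yv'$ if $x>y$, or $x=y$ and $u'>_{\rm lex}v'$ ($x,y$ letters). $\overline f$ is the largest word in $f\in\mathbf{k}\mathfrak{S}(Z)\setminus\{0\}$; $f$ is monic if $\overline f$ has coefficient $1$; a set is monic if all its elements are. Lyndon-Shirshov bracketed words. For a well-ordered alphabet $A$, $\mathrm{ALSW}(A)$ is the set of $w\in S(A)$ with $uv>_{\rm lex}vu$ for every decomposition $w=uv$, $u,v\in S(A)$. A binary bracketing $(w)$ of $w\in \mathrm{ALSW}(A)$ is non-associative Lyndon-Shirshov if whenever $(w)=((u)(v))$ both $(u),(v)$ are such, and if moreover $(u)=((u_1)(u_2))$ then $v\geq_{\rm lex}u_2$; each $w\in\mathrm{ALSW}(A)$ has a unique such bracketing $[w]$. Put $\mathrm{ALSBW}(Z)_0=\mathrm{ALSW}(Z)$, $\mathrm{ALSBW}(Z)_{n+1}=\mathrm{ALSW}(Z\sqcup\lfloor\mathrm{ALSBW}(Z)_n\rfloor)$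 (primes ordered by $\succeq$), $\mathrm{ALSBW}(Z)=\bigcup_n\mathrm{ALSBW}(Z)_n$. Recursively $[z]=z$ for $z\in Z$, $[\lfloor w'\rfloor]=\lfloor[w']\rfloor$, and for $w=w_1\cdots w_k$ ($w_i$ prime, $k>1$) $[w]$ is the non-associative Lyndon-Shirshov bracketing of $[w_1]\cdots[w_k]$ on the letters $[w_i]$, ordered as the $w_i$. $\mathrm{NLSBW}(Z)=\{[w]:w\in\mathrm{ALSBW}(Z)\}$. Bracketings are read in $\mathbf{k}\mathfrak{S}(Z)$ as commutators $(a\,b)=ab-ba$. $\mathrm{OLie}(Z)$ is the smallest subspace of $\mathbf{k}\mathfrak{S}(Z)$ containing $Z$ and closed under commutator and $\lfloor\ \rfloor$; $\mathrm{NLSBW}(Z)$ is a linear basis of it. Special normal words. Let $q\in\mathfrak{S}^\star(Z)$ and $u,q|_u\in\mathrm{ALSBW}(Z)$. There are $q'\in\mathfrak{S}^\star(Z)$ and $c\in\mathfrak{S}(Z)\cup\{\mathbf 1\}$ ($\mathbf 1$ the empty word) such that $q|_u=q'|_{uc}$, the given occurrence of $u$ being the initial segment of $uc$, $uc\in\mathrm{ALSBW}(Z)$, and $[uc]$ occurs as a bracketed subword of $[q|_u]$ at the position of $\star$ in $q'$. Write $c=c_1\cdots c_m$ with $c_i\in\mathrm{ALSBW}(Z)$, $c_1\preceq_{\rm lex}\cdots\preceq_{\rm lex}c_m$. Then $[q|_u]_u$ is obtained from $[q|_u]$ by replacing this subword $[uc]$ by $[\cdots[[[u][c_1]][c_2]]\cdots[c_m]]$.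 For $f\in\mathrm{OLie}(Z)$ monic with $q|_{\overline f}\in\mathrm{ALSBW}(Z)$, the special normal $f$-word $[q|_f]_{\overline f}$ is obtained from $[q|_{\overline f}]_{\overline f}$ by replacing that $[\overline f]$ by $f$. Ideal and irreducibles. $\mathrm{Id}_{\rm Lie}(S)$ is the ideal of the operated Lie algebra $\mathrm{OLie}(Z)$ generated by $S$ (smallest Lie ideal containing $S$ and closed under $\lfloor\ \rfloor$); it equals the span of all special normal words $[q|_s]_{\overline s}$, $s\in S$. $\mathrm{Irr}_{\rm Lie}(S)=\{[w]: w\in\mathrm{ALSBW}(Z),\ w\neq q|_{\overline s}\text{ for all } s\in S, q\in\mathfrak{S}^\star(Z)\}$. Rewriting. A term-rewriting system on a vector space $V$ with basis $W$ is a set $\Pi\subseteq W\times V$ of rules $t\to v$. If $t\in W$ has coefficient $\alpha\neq0$ in $f$, then $f\to_\Pi f-\alpha t+\alpha v$ is a one-step rewriting; $\overset{*}{\to}_\Pi$ is the reflexive-transitive closure. $\Pi$ is terminating if there is no infinite chain of one-step rewritings, confluent if $f\overset{*}{\to}_\Pi g_1$, $f\overset{*}{\to}_\Pi g_2$ imply that $g_1,g_2$ both rewrite to some common $h$, and convergent if both. For $s\in S$ and $q|_{\overline s}\in\mathrm{ALSBW}(Z)$ write $[q|_s]_{\overline s}=[q|_{\overline s}]-R([q|_s]_{\overline s})$, where $R([q|_s]_{\overline s})$ does not involve the basis element $[q|_{\overline s}]$. Then $\Pi^{\rm Lie}_S=\{[q|_{\overline s}]\to R([q|_s]_{\overline s})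 : s\in S, q\in\mathfrak{S}^\star(Z), q|_{\overline s}\in\mathrm{ALSBW}(Z)\}$, a term-rewriting system on $\mathrm{OLie}(Z)$ with respect to the basis $\mathrm{NLSBW}(Z)$. Gröbner-Shirshov bases. For monic $f,g\in\mathrm{OLie}(Z)$: if $w=\overline f u=v\overline g$ with $u,v\in\mathfrak{S}(Z)$ and $\max\{|\overline f|,|\overline g|\}<|w|<|\overline f|+|\overline g|$, the intersection composition is $\langle f,g\rangle_w=[fu]_{\overline f}-[vg]_{\overline g}$ (special normal words for $q=\star u$ and $q=v\star$); if $w=\overline f=q|_{\overline g}$ with $q\in\mathfrak{S}^\star(Z)$, the including composition is $\langle f,g\rangle_w=f-[q|_g]_{\overline g}$. An $h\in\mathrm{OLie}(Z)$ is trivial modulo $(S,w)$ if $h=\sum_i\alpha_i[q_i|_{s_i}]_{\overline{s_i}}$ (finite sum of special normal words) with $\alpha_i\in\mathbf{k}$, $s_i\in S$ and $w>_{\rm IM}q_i|_{\overline{s_i}}$. $S$ is a Gröbner-Shirshov basis in $\mathrm{OLie}(Z)$ if all intersection and including compositions $\langle f,g\rangle_w$ of $f,g\in S$ are trivial modulo $(S,w)$. *)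

(* Defs.v *)
From HB Require Import structures.
From Stdlib Require Export Relation_Operators.
From Stdlib Require List.
From mathcomp Require Export all_boot all_order all_algebra.
From mathcomp Require Export finmap.
From mathcomp.multinomials Require Export monalg.

Set Implicit Arguments.
Unset Strict Implicit.
Unset Printing Implicit Defensive.

Import GRing.Theory.

(* [letter Z] is the set of primes Z + |_S(Z)_|.  A word is nonempty, so it is
   a pair (first prime, remaining primes); the least fixpoint is the union of
   the S(Z)_n. *)
Inductive letter (Z : Type) : Type :=
  | Gen of Z
  | Brk of letter Z * seq (letter Z).

Definition word (Z : Type) : Type := (letter Z * seq (letter Z))%type.

Arguments Brk {Z} _.

Lemma letter_nested_ind (Z : Type) (P : letter Z -> Prop) :
  (forall z, P (Gen z)) ->
  (forall x s, P x -> foldr (fun a Q => P a /\ Q) True s -> P (Brk (x, s))) ->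
  forall a, P a.
Proof.
move=> hG hB; fix IH 1 => -[z|[x s]]; first exact: hG.
apply: hB; first exact: IH.
elim: s => [|a s IHs] /=; first exact: I.
by split; [exact: (IH a) | exact: IHs].
Qed.

Section LetterChoice.
Variable Z : Type.

Fixpoint letter_encode (a : letter Z) : GenTree.tree Z :=
  match a with
  | Gen z => GenTree.Leaf z
  | Brk (x, s) => GenTree.Node 0 (letter_encode x :: map letter_encode s)
  end.

Fixpoint letter_decode (t : GenTree.tree Z) : option (letter Z) :=
  match t with
  | GenTree.Leaf z => Some (Gen z)
  | GenTree.Node _ ts =>
      if pmap letter_decode ts is x :: s then Some (Brk (x, s)) else None
  end.

Lemma letter_encodeK : pcancel letter_encode letter_decode.
Proof.
elim/letter_nested_ind => //= x s -> hs /=.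
suff -> : pmap letter_decode (map letter_encode s) = s by [].
by elim: s hs => //= a s IHs [-> /IHs ->].
Qed.

End LetterChoice.

HB.instance Definition _ (Z : choiceType) :=
  Choice.copy (letter Z) (pcan_type (@letter_encodeK Z)).
HB.instance Definition _ (Z : choiceType) :=
  Choice.copy (word Z) (letter Z * seq (letter Z))%type.

Section Words.

Definition letters (Z : Type) (w : word Z) : seq (letter Z) := w.1 :: w.2.

Definition breadth (Z : Type) (w : word Z) : nat := size (letters w).

Definition wprime (Z : Type) (a : letter Z) : word Z := (a, [::]).

Definition wgen (Z : Type) (z : Z) : word Z := wprime (Gen z).

Definition wcat (Z : Type) (u v : word Z) : word Z := (u.1, u.2 ++ letters v).

Fixpoint lbind (Y Z : Type) (h : Y -> word Z) (a : letter Y) : word Z :=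
  match a with
  | Gen y => h y
  | Brk (x, s) => wprime (Brk (foldl (@wcat Z) (lbind h x) (map (lbind h) s)))
  end.

(* The operated semigroup morphism S(Y) -> S(Z) extending h. *)
Definition wbind (Y Z : Type) (h : Y -> word Z) (w : word Y) : word Z :=
  foldl (@wcat Z) (lbind h w.1) (map (lbind h) w.2).

(* Words over Z + {star} are words over [option Z], the star being [None]. *)
Definition star (Z : Type) : word (option Z) := wgen None.

Definition starless (Z : Type) (w : word Z) : word (option Z) :=
  wbind (fun z => wgen (Some z)) w.

Fixpoint lstars (Z : Type) (a : letter (option Z)) : nat :=
  match a with
  | Gen None => 1
  | Gen (Some _) => 0
  | Brk (x, s) => lstars x + sumn (map (@lstars Z) s)
  end.

Definition star_word (Z : Type) (q : word (option Z)) : Prop :=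
  sumn (map (@lstars Z) (letters q)) = 1.

Definition plug (Z : Type) (q : word (option Z)) (u : word Z) : word Z :=
  wbind (oapp (@wgen Z) u) q.

(* q'|_r for a word r that itself involves the star. *)
Definition plug_star (Z : Type) (q' r : word (option Z)) : word (option Z) :=
  wbind (oapp (fun z => wgen (Some z)) r) q'.

End Words.

(* Binary bracketings of operated words: [BGen z] and [BBrk t] are the letters,
   [BNode l r] is the product ((l)(r)). *)
Inductive bword (Z : Type) : Type :=
  | BGen of Z
  | BBrk of bword Z
  | BNode of bword Z & bword Z.

Section Bracketings.

Fixpoint bare (Z : Type) (t : bword Z) : word Z :=
  match t with
  | BGen z => wgen z
  | BBrk t' => wprime (Brk (bare t'))
  | BNode l r => wcat (bare l) (bare r)
  end.

Fixpoint bbind (Y Z : Type) (h : Y -> bword Z) (t : bword Y) : bword Z :=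
  match t with
  | BGen y => h y
  | BBrk t' => BBrk (bbind h t')
  | BNode l r => BNode (bbind h l) (bbind h r)
  end.

Definition bstarless (Z : Type) (t : bword Z) : bword (option Z) :=
  bbind (fun z => BGen (Some z)) t.

Definition bplug (Z : Type) (T : bword (option Z)) (t : bword Z) : bword Z :=
  bbind (oapp (@BGen Z) t) T.

Definition bplug_star (Z : Type) (T P : bword (option Z)) : bword (option Z) :=
  bbind (oapp (fun z => BGen (Some z)) P) T.

(* [...[[t t_1] t_2] ... t_m] *)
Definition left_normed (Z : Type) (t : bword Z) (ts : seq (bword Z)) : bword Z :=
  foldl (@BNode Z) t ts.

End Bracketings.

Section Lex.
Variables (A : eqType) (gt : rel A).

Fixpoint lexgt (s t : seq A) : bool :=
  match s, t with
  | [::], [::] => false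
  | [::], _ :: _ => true
  | _ :: _, [::] => false
  | x :: s', y :: t' => gt x y || (x == y) && lexgt s' t'
  end.

Definition lexge (s t : seq A) : bool := (s == t) || lexgt s t.

Definition ALSW (w : seq A) : Prop :=
  w <> [::] /\
  (forall u v, u <> [::] -> v <> [::] -> w = u ++ v -> lexgt (u ++ v) (v ++ u)).

End Lex.

Section Orders.
Variables (Z : choiceType) (ge : rel (word Z)).

Definition wgt (u v : word Z) : bool := ge u v && (u != v).

Definition pgt (a b : letter Z) : bool := wgt (wprime a) (wprime b).

Definition monomial_order : Prop :=
  [/\ [/\ reflexive ge, antisymmetric ge, transitive ge & total ge],
      well_founded (fun u v => wgt v u) &
      forall q u v, star_word q -> wgt u v -> wgt (plug q u) (plug q v)].

Definition invariant_order : Prop :=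
  forall u v : word Z, perm_eq (letters u) (letters v) ->
    ge u v = lexge pgt (letters u) (letters v).

(* At every level, including ALSBW(Z)_0 = ALSW(Z), the primes are compared
   by the restriction of [ge]. *)
Fixpoint ALSBW_level (n : nat) (w : word Z) : Prop :=
  ALSW pgt (letters w) /\
  (forall a, a \in letters w ->
     match a with
     | Gen _ => True
     | Brk w' => if n is n'.+1 then ALSBW_level n' w' else False
     end).

Definition ALSBW (w : word Z) : Prop := exists n, ALSBW_level n w.

(* Subtrees [BGen z] and [BBrk t'] are the letters [w_i] of a bracketing; they
   are compared through their underlying primes, i.e. through [bare]. *)
Fixpoint nonassoc_LS (t : bword Z) : Prop :=
  match t with
  | BGen _ => True
  | BBrk t' => nonassoc_LS t'
  | BNode l r =>
      [/\ ALSW pgt (letters (bare t)), nonassoc_LS l, nonassoc_LS r &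
          if l is BNode _ l2
          then lexge pgt (letters (bare r)) (letters (bare l2)) : Prop
          else True]
  end.

(* t = [w] *)
Definition is_LS_bracketing (w : word Z) (t : bword Z) : Prop :=
  [/\ ALSBW w, bare t = w & nonassoc_LS t].

(* T is [q|_u]_u with its distinguished subword [u] replaced by the star:
   plugging [u], resp. f, into T gives [q|_u]_u, resp. [q|_f]_u.
   Here c = c_1...c_m is [cs] (c is the empty word if cs = [::]), and q is
   q'|_(star c); T0 is [q|_u] with the subword [uc] replaced by the star. *)
Definition special_bracketing (q : word (option Z)) (u : word Z)
    (T : bword (option Z)) : Prop :=
  [/\ star_word q, ALSBW u, ALSBW (plug q u) &
   exists (q' : word (option Z)) (T0 : bword (option Z)) (tuc : bword Z)
     (cs : seq (word Z)) (ts : seq (bword Z)),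
   [/\ star_word q',
       q = plug_star q' (foldl (@wcat _) (star Z) (map (@starless Z) cs)),
       bare T0 = q',
       is_LS_bracketing (foldl (@wcat Z) u cs) tuc &
       is_LS_bracketing (plug q u) (bplug T0 tuc)] /\
   [/\ sorted (fun a b => lexge pgt (letters b) (letters a)) cs,
       List.Forall2 is_LS_bracketing cs ts &
       T = bplug_star T0 (left_normed (BGen None) (map (@bstarless Z) ts))]].

End Orders.

Local Open Scope ring_scope.

Section Span.
Variables (F : fieldType) (V : lmodType F).

Definition span_of (P : V -> Prop) (f : V) : Prop :=
  exists (n : nat) (c : 'I_n -> F) (g : 'I_n -> V),
    (forall i, P (g i)) /\ f = \sum_(i < n) c i *: g i.

End Span.

(* Term-rewriting systems Pi on a subspace U of V with basis W. *)
Section Rewriting.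
Variables (F : fieldType) (V : lmodType F).
Variables (U W : V -> Prop) (Pi : V -> V -> Prop).

(* a is the coefficient of the basis element t in f, relative to W *)
Definition basis_coef (f t : V) (a : F) : Prop :=
  W t /\ span_of (fun x => W x /\ x <> t) (f - a *: t).

Definition one_step (f g : V) : Prop :=
  exists (t v : V) (a : F),
    [/\ Pi t v, a != 0, basis_coef f t a & g = f - a *: t + a *: v].

Definition rewrites : V -> V -> Prop := clos_refl_trans V one_step.

Definition terminating : Prop :=
  ~ exists h : nat -> V, U (h 0%N) /\ forall i, one_step (h i) (h i.+1).

Definition confluent : Prop :=
  forall f g1 g2, U f -> rewrites f g1 -> rewrites f g2 ->
    exists h, rewrites g1 h /\ rewrites g2 h.

Definition convergent : Prop := terminating /\ confluent.

End Rewriting.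

Section OperatedLie.
Variables (F : fieldType) (Z : choiceType).

Local Notation A := {malg F[word Z]}.

(* k S(Z) has no unit ([word Z] has no empty word), so it is not an instance
   of the monoid algebra structure of [malg]. *)
Definition amul (f g : A) : A :=
  \sum_(u <- msupp f) \sum_(v <- msupp g) << f@_u * g@_v *g wcat u v >>.

Definition abrk (f : A) : A :=
  \sum_(u <- msupp f) << f@_u *g wprime (Brk u) >>.

Definition comm (f g : A) : A := amul f g - amul g f.

Fixpoint bval (Y : Type) (h : Y -> A) (t : bword Y) : A :=
  match t with
  | BGen y => h y
  | BBrk t' => abrk (bval h t')
  | BNode l r => comm (bval h l) (bval h r)
  end.

Definition agen (z : Z) : A := << wgen z >>.

Inductive OLie : A -> Prop :=
  | OLie_gen z : OLie (agen z)
  | OLie_0 : OLie 0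
  | OLie_lin a f g : OLie f -> OLie g -> OLie (a *: f + g)
  | OLie_comm f g : OLie f -> OLie g -> OLie (comm f g)
  | OLie_brk f : OLie f -> OLie (abrk f).

Inductive Id_Lie (S : A -> Prop) : A -> Prop :=
  | Id_mem f : S f -> Id_Lie S f
  | Id_0 : Id_Lie S 0
  | Id_lin a f g : Id_Lie S f -> Id_Lie S g -> Id_Lie S (a *: f + g)
  | Id_comm_l f g : OLie f -> Id_Lie S g -> Id_Lie S (comm f g)
  | Id_comm_r f g : Id_Lie S f -> OLie g -> Id_Lie S (comm f g)
  | Id_brk f : Id_Lie S f -> Id_Lie S (abrk f).

Variables (ge : rel (word Z)) (S : A -> Prop).

Definition is_lead (f : A) (u : word Z) : Prop :=
  u \in msupp f /\ (forall v, v \in msupp f -> ge u v).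

Definition monic (f : A) : Prop := exists u, is_lead f u /\ f@_u = 1.

(* b is the element [w] of k S(Z) *)
Definition is_LS_elt (w : word Z) (b : A) : Prop :=
  exists t, is_LS_bracketing ge w t /\ b = bval agen t.

Definition NLSBW (b : A) : Prop := exists w, is_LS_elt w b.

(* p is the special normal f-word [q|_f]_u, where u is the leading word of f *)
Definition special_normal (q : word (option Z)) (f : A) (u : word Z) (p : A)
    : Prop :=
  is_lead f u /\
  exists T, special_bracketing ge q u T /\ p = bval (oapp agen f) T.

Definition Irr_Lie (b : A) : Prop :=
  exists w, is_LS_elt w b /\
    (forall s u q, S s -> is_lead s u -> star_word q -> w <> plug q u).

Definition Pi_Lie (t v : A) : Prop :=
  exists s u q p,
    [/\ S s, special_normal q s u p, is_LS_elt (plug q u) t & v = t - p].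

Definition trivial_mod (w : word Z) (h : A) : Prop :=
  span_of (fun p => exists s u q,
    [/\ S s, special_normal q s u p & wgt ge w (plug q u)]) h.

Inductive composition (f g : A) (w : word Z) : A -> Prop :=
  | Intersection (fb gb u v : word Z) (p1 p2 : A) of
      is_lead f fb & is_lead g gb &
      w = wcat fb u & w = wcat v gb &
      (maxn (breadth fb) (breadth gb) < breadth w)%N &
      (breadth w < breadth fb + breadth gb)%N &
      special_normal (wcat (star Z) (starless u)) f fb p1 &
      special_normal (wcat (starless v) (star Z)) g gb p2 :
      composition f g w (p1 - p2)
  | Including (gb : word Z) (q : word (option Z)) (p : A) of
      is_lead f w & is_lead g gb & star_word q & w = plug q gb &
      special_normal q g gb p :
      composition f g w (f - p).

Definition GS_basis : Prop :=
  forall f g w h, S f -> S g -> composition f g w h -> trivial_mod w h.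

Definition direct_sum_decomposition : Prop :=
  (forall f, OLie f <-> exists g h, [/\ Id_Lie S g, span_of Irr_Lie h & f = g + h]) /\
  (forall f, Id_Lie S f -> span_of Irr_Lie f -> f = 0).

End OperatedLie.

(* Main.v *)
From Stdlib Require Import ClassicalEpsilon.
Require Import Defs.
Set Implicit Arguments.
Unset Strict Implicit.
Unset Printing Implicit Defensive.
Import GRing.Theory.
Local Open Scope ring_scope.

(* A special normal word [q|_s] differs from the associative context q|_s only
   by associative multiples of s with smaller leading words, so a Lie
   Groebner-Shirshov basis is also an associative one, and the associative
   composition-diamond lemma applies: the leading word of a nonzero element of
   the ideal contains the leading word of some s.  Division by special normal
   words always gives Id + k Irr = OLie; the sum is direct exactly when
   compositions are trivial, and exactly when normal forms are unique.
   Termination is automatic because rules decrease leading words.  That special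
   normal words span Id_Lie(S) reduces to one relator, for which the
   composition-diamond lemma needs no hypothesis since a Lyndon word has no
   self-overlap. *)

(** * Lyndon words *)

(** Invariance of the order is used for one fact: a Lyndon product u v dominates its rotation v u.
    Hence the commutator of monic elements led by u and v is led by u v, and its second half is an
    error with lower leading word. Applying this at every node between the relator and the root
    shows that replacing the bracketed leading word by s yields an associative multiple of s up to
    lower multiples. Deducing directness from confluence meets an obstacle: confluence controls
    combinations of special normal words, whereas the ideal is closed under commutators and
    brackets, and no condition on compositions is available at that stage. Spanning is therefore
    proved for one relator s at a time: dividing an element of its ideal by s leaves a normal
    remainder in the same ideal, which must vanish. Rewriting reads coordinates in the
    Lyndon-Shirshov basis, while the diamond lemma reads coefficients of words. Completing the basis
    to a unitriangular one of the whole algebra makes leading words agree. Since a rule may fire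
    below the leading word, termination needs a nested induction. *)

Section LyndonWords.
Local Open Scope nat_scope.
Variables (A : eqType) (gt : rel A).
Hypothesis gt_irr : irreflexive gt.
Hypothesis gt_trans : transitive gt.
Hypothesis gt_total : forall x y, [|| x == y, gt x y | gt y x].

Implicit Types s t u v w x y : seq A.

(* [s <' t] is the paper's s >_lex t: with the empty word largest this is the
   usual Lyndon convention, prefixes being <' their extensions. *)
Local Notation "s <' t" := (lexgt gt s t) (at level 70).

(* [s >_lex t] witnessed by a differing letter, hence stable under appending. *)
Fixpoint sgt s t : bool :=
  match s, t with
  | x :: s', y :: t' => gt x y || (x == y) && sgt s' t'
  | _, _ => false
  end.

Lemma lexgtE s t : (s <' t) = sgt s t || prefix s t && (s != t).
Proof.
elim: s t => [|x s IH] [|y t] //=.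
rewrite IH eqseq_cons; case: (eqVneq x y) => [->|ne] /=.
  by rewrite gt_irr.
by rewrite !orbF.
Qed.

Lemma sgt_lexgt s t : sgt s t -> s <' t.
Proof. by rewrite lexgtE => ->. Qed.

Lemma sgt_cat s t u v : sgt s t -> sgt (s ++ u) (t ++ v).
Proof.
elim: s t => [|x s IH] [|y t] //=.
by case/orP=> [->|/andP[-> /IH ->]] //; rewrite orbT.
Qed.

Lemma lexgt_cat2l u s t : (u ++ s <' u ++ t) = (s <' t).
Proof. by elim: u => //= x u ->; rewrite gt_irr eqxx. Qed.

Lemma lexgt_sgt s t : size t <= size s -> s <' t -> sgt s t.
Proof.
rewrite lexgtE => le /orP[//|/andP[/prefixP[z ez]]].
move: le; rewrite ez size_cat -{2}[size s]addn0 leq_add2l leqn0 size_eq0.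
by move/eqP->; rewrite cats0 eqxx.
Qed.

Lemma lexgt_cat s t u v : size t <= size s -> s <' t -> s ++ u <' t ++ v.
Proof. by move=> le /(lexgt_sgt le) /sgt_cat h; apply: sgt_lexgt. Qed.

Lemma lexgt_irr s : (s <' s) = false.
Proof. by elim: s => //= x s ->; rewrite gt_irr andbF. Qed.

Lemma lexgt_trans : transitive (lexgt gt).
Proof.
move=> t s u; elim: s t u => [|x s IH] [|y t] [|z u] //=.
case/orP=> [xy|/andP[/eqP<- st]]; case/orP=> [yz|/andP[/eqP ez tu]].
- by rewrite (gt_trans xy yz).
- by rewrite -ez xy.
- by rewrite yz.
- by rewrite ez eqxx (IH _ _ st tu) orbT.
Qed.

Lemma lexgt_total s t : [|| s == t, s <' t | t <' s].
Proof.
elim: s t => [|x s IH] [|y t] //=; rewrite eqseq_cons (eq_sym y x).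
case: (eqVneq x y) => [->|ne] /=.
  by rewrite gt_irr /=; apply: IH.
by rewrite !orbF; have := gt_total x y; rewrite (negbTE ne).
Qed.

Lemma lexgt_asym s t : s <' t -> (t <' s) = false.
Proof.
move=> st; apply/negP => ts; have := lexgt_trans st ts.
by rewrite lexgt_irr.
Qed.

Lemma lexgt_catr s v : v <> [::] -> s <' s ++ v.
Proof. by case: v => // a v _; rewrite -{1}[s]cats0 lexgt_cat2l. Qed.

(** The classical suffix form of the Lyndon condition. Unlike the comparison of rotations in [ALSW],
    it passes directly to factors and concatenations. *)
Definition Lyn w := w <> [::] /\
  forall u v, u <> [::] -> v <> [::] -> w = u ++ v -> w <' v.

Lemma Lyn_sgt w u v : Lyn w -> u <> [::] -> v <> [::] -> w = u ++ v -> sgt w v.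
Proof.
move=> [_ h] u0 v0 e; apply: lexgt_sgt (h _ _ u0 v0 e).
by rewrite e size_cat leq_addl.
Qed.

(** The hard case is a suffix v that is also a prefix, w = u v = v z with z as long as u. Cancelling
    v in the rotation inequality for u v gives z <' u, hence z v <' u v, against the rotation
    inequality for v z. *)
Lemma ALSW_Lyn w : ALSW gt w <-> Lyn w.
Proof.
split=> -[w0 h]; split=> // u v u0 v0 e; last first.
  rewrite -e; apply: (@lexgt_trans (v ++ [::])).
    by rewrite cats0; apply: h e.
  by rewrite lexgt_cat2l; case: (u) u0.
case/or3P: (lexgt_total w v) => // [/eqP ev|].
  by move: (congr1 size e); rewrite -ev size_cat => /eqP;
    rewrite -{1}[size w]add0n eqn_add2r eq_sym size_eq0 => /eqP.
rewrite lexgtE => /orP[sd|/andP[/prefixP[z ez] _]].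
  have := h _ _ u0 v0 e; rewrite -e => hh.
  have := sgt_lexgt (sgt_cat u [::] sd); rewrite cats0.
  by rewrite (lexgt_asym hh).
have sz : size z = size u.
  by have /eqP := congr1 size e; rewrite {1}ez !size_cat addnC eqn_add2r => /eqP.
have z0 : z <> [::] by move=> z0; move: sz; rewrite z0 => /esym/eqP; rewrite size_eq0 => /eqP.
have h1 : z <' u.
  by have := h _ _ u0 v0 e; rewrite -e {1}ez lexgt_cat2l.
have h2 : z ++ v <' u ++ v by apply: lexgt_cat h1; rewrite sz.
have := h _ _ v0 z0 ez; rewrite -ez e => h3.
by rewrite (lexgt_asym h2) in h3.
Qed.

Lemma Lyn1 a : Lyn [:: a].
Proof.
split=> // u v u0 v0 /(congr1 size)/=; rewrite size_cat.
by case: u u0 => // ? u _; case: v v0 => // ? v _; rewrite /= addnS.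
Qed.

Lemma cat_nil_l u v : u <> [::] -> u ++ v <> [::].
Proof. by case: u. Qed.
Lemma cat_nil_r u v : v <> [::] -> u ++ v <> [::].
Proof. by case: u. Qed.

(** Levi's lemma. Only the first alternative allows an empty z, so equal cuts always land there. *)
Lemma cat_eq_cat u v x y : u ++ v = x ++ y ->
  (exists z, u = x ++ z /\ y = z ++ v) \/ (exists z, z <> [::] /\ x = u ++ z /\ v = z ++ y).
Proof.
elim: u x => [|a u IH] [|b x] //=.
- by move=> ->; left; exists [::].
- by move=> ->; right; exists (b :: x).
- by move=> <-; left; exists (a :: u).
case=> -> /IH [[z [-> ->]]|[z [z0 [-> ->]]]]; [left|right]; exists z => //.
Qed.

Lemma Lyn_cat u v : Lyn u -> Lyn v -> u <' v -> Lyn (u ++ v).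
Proof.
move=> Lu Lv uv.
have uvv : u ++ v <' v.
  move: uv; rewrite lexgtE => /orP[sd|/andP[/prefixP[z ez] ne]].
    by have := sgt_lexgt (sgt_cat v [::] sd); rewrite cats0.
  (* Here v = u z: cancelling u leaves v <' z, which holds because v is Lyndon. *)
  rewrite {2}ez lexgt_cat2l; apply: (Lv.2 _ _ Lu.1 _ ez) => z0.
  by rewrite ez z0 cats0 eqxx in ne.
split=> [|x y x0 y0 e]; first by apply: cat_nil_l; case: Lu.
case: (cat_eq_cat e) => [[z [eu ey]]|[z [z0 [ex ev]]]].
  case: (z =P [::]) => z0; first by rewrite ey z0.
  rewrite ey; apply: lexgt_cat; last exact: (Lu.2 _ _ x0 z0 eu).
  by rewrite eu size_cat leq_addl.
exact: lexgt_trans uvv (Lv.2 _ _ z0 y0 ev).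
Qed.

(** A suffix starting inside x y already differs from x y at a letter, so appending z changes
    nothing; a suffix of y z is compared through y z. This puts the word of an intersection
    composition back among Lyndon words. *)
Lemma Lyn_overlap x y z : y <> [::] -> Lyn (x ++ y) -> Lyn (y ++ z) ->
  Lyn (x ++ y ++ z).
Proof.
move=> y0; case: (x =P [::]) => [->//|x0] L1 L2.
case: (z =P [::]) => [->|z0]; first by rewrite !cats0.
have h : x ++ y ++ z <' y ++ z.
  by rewrite catA; apply/sgt_lexgt/sgt_cat/(Lyn_sgt L1 x0 y0).
split=> [|u v u0 v0 e]; first exact: cat_nil_l.
case: (cat_eq_cat e) => [[t [ex ev]]|[t [t0 [eu ev]]]].
  case: (t =P [::]) => t0; first by rewrite ev t0.
  rewrite ev catA catA; apply/sgt_lexgt/sgt_cat.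
  by apply: (Lyn_sgt L1 u0); [exact: cat_nil_l | rewrite ex catA].
exact: lexgt_trans h (L2.2 _ _ t0 v0 ev).
Qed.

(** The right part of the standard factorisation, characterised as the [<']-least proper suffix.
    That v is itself a suffix is supplied at each use. *)
Definition minsuf w v :=
  forall x y, x <> [::] -> y <> [::] -> w = x ++ y -> v = y \/ v <' y.

Lemma minsuf_cat u v : Lyn v ->
  (forall x y, x <> [::] -> y <> [::] -> u = x ++ y -> v = y \/ v <' y) ->
  minsuf (u ++ v) v.
Proof.
move=> Lv h x y x0 y0 e.
case: (cat_eq_cat e) => [[z [eu ey]]|[z [z0 [ex ev]]]].
  case: (z =P [::]) => [z0|z0]; first by left; rewrite ey z0.
  right; rewrite ey; have zv : z <' z ++ v by apply: lexgt_catr; case: Lv.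
  by case: (h _ _ x0 z0 eu) => [ez|hz]; [rewrite {1}ez | apply: lexgt_trans hz zv].
by right; apply: (Lv.2 _ _ z0 y0 ev).
Qed.

Lemma minsuf_exists w : 1 < size w ->
  exists u v, [/\ u <> [::], v <> [::], w = u ++ v & minsuf w v].
Proof.
case: w => // a w; elim: w a => // b w IH a _.
case: (w =P [::]) => w0.
  rewrite w0; exists [:: a], [:: b]; split=> // -[|? [|? x]] // y _ y0.
    by case=> _ <-; left.
  by case=> _ _; case: x y0 => [|? x]; case: y.
have [|u [v [u0 v0 e m]]] := IH b; first by rewrite ltnS lt0n size_eq0; apply/eqP.
case: (boolP (v <' b :: w)) => [lt|nlt].
  exists (a :: u), v; split => //; first by rewrite e.
  case=> [|c x] // y _ y0 [_ e'].
  case: x e' => [|d x] e'; first by right; rewrite -[y]e'.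
  by apply: (m (d :: x) y _ y0 e').
exists [:: a], (b :: w); split=> //.
case=> [|c x] // y _ y0 [_ e'].
case: x e' => [|d x] e'; first by left.
have h : v = y \/ v <' y by apply: (m (d :: x) y _ y0 e').
have hv : (b :: w) <' v.
  case/or3P: (lexgt_total v (b :: w)) => // [/eqP ev|]; last by move=> h'; rewrite h' in nlt.
  have /eqP := congr1 size e; rewrite -ev size_cat -{1}[size v]add0n eqn_add2r eq_sym size_eq0.
  by move/eqP.
by right; case: h => // [<-//|]; apply: lexgt_trans.
Qed.

(** If a suffix y of u were a prefix too, u = y z, cancelling y in u v <' y v would give z v <' v,
    against minimality of v. A difference at a letter contradicts that w is Lyndon. *)
Lemma minsuf_Lyn w u v : Lyn w -> u <> [::] -> v <> [::] -> w = u ++ v ->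
  minsuf w v -> Lyn u /\ Lyn v.
Proof.
move=> Lw u0 v0 e m; split; split=> // x y x0 y0 e'.
  have h1 : u ++ v <' y ++ v.
    rewrite -e; apply: (Lw.2 x) => //; first exact: cat_nil_r.
    by rewrite catA -e'.
  case/or3P: (lexgt_total u y) => // [/eqP ev|].
    by move: (congr1 size e'); rewrite -ev size_cat => /eqP;
      rewrite -{1}[size u]add0n eqn_add2r eq_sym size_eq0 => /eqP.
  rewrite lexgtE => /orP[sd|/andP[/prefixP[z ez] _]].
    by rewrite (lexgt_asym (sgt_lexgt (sgt_cat v v sd))) in h1.
  have z0 : z <> [::].
    move=> z0; move: ez; rewrite z0 cats0 e' => /(congr1 size)/eqP.
    by rewrite size_cat -{2}[size y]add0n eqn_add2r size_eq0 => /eqP.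
  move: h1; rewrite ez -catA lexgt_cat2l => h1.
  have := m y (z ++ v) y0 (cat_nil_l (v := v) z0); rewrite e ez catA => /(_ erefl) [ev|h2].
    by move: h1; rewrite -ev lexgt_irr.
  by rewrite (lexgt_asym h1) in h2.
have := m (u ++ x) y (cat_nil_l (v := x) u0) y0; rewrite e e' catA => /(_ erefl) [ev|//].
move/(congr1 size)/eqP: ev; rewrite size_cat -{2}[size y]add0n eqn_add2r size_eq0.
by move/eqP.
Qed.

(** This yields the condition comparing the right factor with the right part of the left factor in a
    Lyndon-Shirshov node. Minimality gives v <' u2 v; if v = u2 z, cancelling u2 leaves z <' v,
    contradicting that v is Lyndon. *)
Lemma minsuf_sub w u v u1 u2 : Lyn v -> u1 <> [::] -> u2 <> [::] -> w = u ++ v ->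
  minsuf w v -> u = u1 ++ u2 -> v = u2 \/ v <' u2.
Proof.
move=> Lv u10 u20 e m eu.
have v0 : v <> [::] by case: Lv.
have := m u1 (u2 ++ v) u10 (cat_nil_l (v := v) u20); rewrite e eu -catA => /(_ erefl) [ev|h].
  move/(congr1 size)/eqP: ev; rewrite size_cat -{1}[size v]add0n eqn_add2r eq_sym size_eq0.
  by move/eqP.
case/or3P: (lexgt_total v u2) => [/eqP ->|->|]; [by left|by right|].
rewrite lexgtE => /orP[sd|/andP[/prefixP[z ez] ne]].
  have := sgt_lexgt (sgt_cat v [::] sd); rewrite cats0.
  by rewrite (lexgt_asym h).
have z0 : z <> [::] by move=> z0; rewrite ez z0 cats0 eqxx in ne.
move: h; rewrite {1}ez lexgt_cat2l => h.
by rewrite (lexgt_asym (Lv.2 _ _ u20 z0 ez)) in h.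
Qed.

Lemma minsuf_uniq u v u' v' : u <> [::] -> v <> [::] -> u' <> [::] -> v' <> [::] ->
  u ++ v = u' ++ v' -> minsuf (u ++ v) v -> minsuf (u' ++ v') v' ->
  u = u' /\ v = v'.
Proof.
move=> u0 v0 u0' v0' e m m'.
have ev : v = v'.
  case: (m _ _ u0' v0' e) => // h.
  case: (m' _ _ u0 v0 (esym e)) => [->//|h'].
  by rewrite (lexgt_asym h) in h'.
split=> //; move: (e); rewrite ev => /eqP; rewrite eqseq_cat.
  by case/andP=> /eqP.
have := congr1 size e; rewrite !size_cat ev => /eqP.
by rewrite eqn_add2r => /eqP.
Qed.

(** Existence in the Chen-Fox-Lyndon theorem, prepending one letter at a time: a Lyndon word in
    front of a sorted list either fits or merges with the first factor by [Lyn_cat], and the merged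
    word is inserted again. *)
Lemma Lyn_factor w :
  exists cs, [/\ w = flatten cs, {in cs, forall c, Lyn c} &
                sorted (fun a b => (a == b) || (b <' a)) cs].
Proof.
have ins x cs : Lyn x -> {in cs, forall c, Lyn c} ->
    sorted (fun a b => (a == b) || (b <' a)) cs ->
    exists cs', [/\ x ++ flatten cs = flatten cs', {in cs', forall c, Lyn c} &
                sorted (fun a b => (a == b) || (b <' a)) cs'].
  elim: cs x => [|c cs IH] x Lx hcs so.
    exists [:: x]; split=> //.
    by move=> y; rewrite inE => /eqP->.
  have Lc : Lyn c by apply: hcs; rewrite mem_head.
  case: (boolP (x <' c)) => xc.
    case: (IH (x ++ c)); first exact: Lyn_cat.
    - by move=> y hy; apply: hcs; rewrite inE hy orbT.
    - exact: path_sorted so.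
    by move=> cs' [e h1 h2]; exists cs'; split=> //=; rewrite catA.
  exists (x :: c :: cs); split=> //.
    by move=> y; rewrite inE => /orP[/eqP->|/hcs].
  rewrite /= in so *; rewrite so andbT.
  by have := lexgt_total x c; rewrite (negbTE xc) /=.
elim: w => [|a w [cs [e h1 h2]]]; first by exists [::]; split.
have [cs' [e' h1' h2']] := ins [:: a] cs (Lyn1 a) h1 h2.
by exists cs'; split=> //; rewrite -e' e.
Qed.

(* Each partial product u c_1 ... c_k stays Lyndon because u c_1 ... c_k is a
   prefix of u c, hence <' the last factor, hence <' c_{k+1}. *)
Lemma Lyn_prefixes u cs : Lyn u -> {in cs, forall c, Lyn c} ->
  sorted (fun a b => (a == b) || (b <' a)) cs ->
  Lyn (u ++ flatten cs) ->
  forall cs1 c cs2, cs = cs1 ++ c :: cs2 ->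
    Lyn (u ++ flatten cs1) /\ u ++ flatten cs1 <' c.
Proof.
move=> Lu hcs so L.
have key cs1 c cs2 : cs = cs1 ++ c :: cs2 -> u ++ flatten cs1 <' c.
  move=> e.
  have lc : exists2 l, Lyn l /\ ((c == l) || (l <' c)) &
       exists cs0, c :: cs2 = rcons cs0 l.
    have so2 : path (fun a b => (a == b) || (b <' a)) c cs2.
      have tr : transitive (fun a b => (a == b) || (b <' a)).
        by move=> a1 a2 a3 /orP[/eqP->//|h1] /orP[/eqP<-|h2];
          rewrite ?h1 ?orbT // (lexgt_trans h2 h1) orbT.
      apply: (subseq_sorted tr (s1 := c :: cs2) _ so).
      by rewrite e; exact: suffix_subseq.
    have hc2 : {in c :: cs2, forall c, Lyn c}.
      by move=> y hy; apply: hcs; rewrite e mem_cat hy orbT.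
    clear e; elim: cs2 c so2 hc2 => [|b cs2 IH] c /=.
      move=> _ h; exists c; last by exists [::].
      by rewrite eqxx; split=> //; apply: h; rewrite mem_head.
    case/andP=> cb so2 hc2.
    case: (IH b so2) => [y hy|l [Ll bl] [cs0 e0]]; first by apply: hc2; rewrite inE hy orbT.
    exists l; last by exists (c :: cs0); rewrite e0.
    split=> //; case/orP: cb => [/eqP->//|cb]; case/orP: bl => [/eqP<-|bl]; first by rewrite cb orbT.
    by rewrite (lexgt_trans bl cb) orbT.
  case: lc => l [Ll cl] [cs0 e0].
  have h : u ++ flatten cs <' l.
    have eq : u ++ flatten cs = (u ++ flatten (cs1 ++ cs0)) ++ l.
      by rewrite e e0 -cats1 !flatten_cat /= cats0 !catA.
    apply: (L.2 _ _ _ _ eq); last by case: Ll.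
    by apply: cat_nil_l; case: Lu.
  have h2 : u ++ flatten cs1 <' l.
    apply: lexgt_trans _ h; rewrite e flatten_cat /= catA; apply: lexgt_catr.
    apply: cat_nil_l; suff: Lyn c by case.
    by apply: hcs; rewrite e mem_cat mem_head orbT.
  by case/orP: cl => [/eqP->//|cl]; apply: lexgt_trans h2 cl.
move=> cs1 c cs2 e; split; last exact: key e.
elim/last_ind: cs1 c cs2 e => [|cs1 b IH] c cs2 e; first by rewrite /= cats0.
rewrite cat_rcons in e.
rewrite -cats1 flatten_cat /= cats0 catA; apply: Lyn_cat; first exact: IH e.
  by apply: hcs; rewrite e mem_cat mem_head orbT.
exact: key e.
Qed.

(** As a proper suffix, y differs from the whole word at a letter in the right direction; as a
    proper prefix it precedes the whole word. Both are impossible together. *)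
Lemma Lyn_unbordered x y z : x <> [::] -> y <> [::] -> z <> [::] ->
  Lyn (x ++ y) -> x ++ y = y ++ z -> False.
Proof.
move=> x0 y0 z0 L e.
have := Lyn_sgt L x0 y0 erefl; rewrite e => /sgt_lexgt.
by rewrite (lexgt_asym (lexgt_catr y z0)).
Qed.

End LyndonWords.

(** * Operated words and one-star contexts *)

Arguments letters : simpl never.
Arguments wcat : simpl never.
Arguments wprime : simpl never.

Section WordLaws.
Local Open Scope nat_scope.

Lemma letters_inj (Z : Type) : injective (@letters Z).
Proof. by move=> [a s] [b t] [-> ->]. Qed.

Lemma letters_wcat (Z : Type) (u v : word Z) :
  letters (wcat u v) = letters u ++ letters v.
Proof. by []. Qed.

Lemma wcatA (Z : Type) (u v w : word Z) : wcat u (wcat v w) = wcat (wcat u v) w.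
Proof. by apply: letters_inj; rewrite !letters_wcat catA. Qed.

Lemma letters_foldl (Z : Type) (u : word Z) ws :
  letters (foldl (@wcat Z) u ws) = letters u ++ flatten (map (@letters Z) ws).
Proof.
elim: ws u => [|w ws IH] u; first by rewrite cats0.
by rewrite [foldl _ _ _]/= IH letters_wcat -catA.
Qed.

Lemma letters_wbind (Y Z : Type) (h : Y -> word Z) w :
  letters (wbind h w) = flatten (map (fun a => letters (lbind h a)) (letters w)).
Proof. by rewrite /wbind letters_foldl -map_comp. Qed.

Lemma lbind_brk (Y Z : Type) (h : Y -> word Z) w :
  lbind h (Brk w) = wprime (Brk (wbind h w)).
Proof. by case: w. Qed.

Lemma letters_prime (Z : Type) (a : letter Z) : letters (wprime a) = [:: a].
Proof. by []. Qed.

Lemma wbind_wcat (Y Z : Type) (h : Y -> word Z) u v :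
  wbind h (wcat u v) = wcat (wbind h u) (wbind h v).
Proof.
by apply: letters_inj; rewrite letters_wcat !letters_wbind letters_wcat map_cat flatten_cat.
Qed.

Lemma wbind_prime (Y Z : Type) (h : Y -> word Z) a :
  wbind h (wprime a) = lbind h a.
Proof. by []. Qed.

Lemma wbind_foldl (Y Z : Type) (h : Y -> word Z) u ws :
  wbind h (foldl (@wcat Y) u ws) = foldl (@wcat Z) (wbind h u) (map (wbind h) ws).
Proof. by elim: ws u => //= w ws IH u; rewrite IH wbind_wcat. Qed.

Lemma letter_mem_ind (Z : choiceType) (P : letter Z -> Prop) :
  (forall z, P (Gen z)) ->
  (forall w : word Z, (forall a, a \in letters w -> P a) -> P (Brk w)) ->
  forall a, P a.
Proof.
move=> hG hB; elim/letter_nested_ind => // x s px ps; apply: hB => a.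
rewrite inE => /orP[/eqP->//|].
by elim: s ps => //= b s IH [pb ps]; rewrite inE => /orP[/eqP->|/IH]; auto.
Qed.

Lemma eq_flatten_map (T : eqType) (U : Type) (f g : T -> seq U) s :
  (forall a, a \in s -> f a = g a) -> flatten (map f s) = flatten (map g s).
Proof. by move=> h; congr flatten; apply/eq_in_map. Qed.

Lemma flatten_flatten (T : Type) (ss : seq (seq (seq T))) :
  flatten (flatten ss) = flatten (map flatten ss).
Proof. by elim: ss => //= s ss IH; rewrite flatten_cat IH. Qed.

Lemma wbind_wbind (X : choiceType) (Y Z : Type) (h : Y -> word Z) (g : X -> word Y) w :
  wbind h (wbind g w) = wbind (fun x => wbind h (g x)) w.
Proof.
have L : forall a, wbind h (lbind g a) = lbind (fun x => wbind h (g x)) a.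
  elim/letter_mem_ind => // v IH.
  rewrite !lbind_brk wbind_prime lbind_brk; congr (wprime (Brk _)).
  apply: letters_inj; rewrite !letters_wbind map_flatten flatten_flatten -!map_comp.
  apply: eq_flatten_map => a /IH /=.
  by move=> <-; rewrite letters_wbind.
apply: letters_inj; rewrite !letters_wbind map_flatten flatten_flatten -!map_comp.
by apply: eq_flatten_map => a _ /=; rewrite -L letters_wbind.
Qed.

Lemma wbind_id (Z : choiceType) (h : Z -> word Z) w : h =1 @wgen Z -> wbind h w = w.
Proof.
move=> eh; have F (s : seq (letter Z)) : (forall a, a \in s -> lbind h a = wprime a) ->
    flatten [seq letters (lbind h a) | a <- s] = s.
  elim: s => //= a s IH hs; rewrite hs ?mem_head //= IH // => b hb.
  by apply: hs; rewrite inE hb orbT.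
have L : forall a, lbind h a = wprime a.
  elim/letter_mem_ind => [z|v IH]; first exact: eh.
  rewrite lbind_brk; congr (wprime (Brk _)).
  by apply: letters_inj; rewrite letters_wbind F.
by apply: letters_inj; rewrite letters_wbind F.
Qed.

Lemma plug_wcat (Z : Type) (p q : word (option Z)) u :
  plug (wcat p q) u = wcat (plug p u) (plug q u).
Proof. exact: wbind_wcat. Qed.

Lemma plug_starless (Z : choiceType) (w u : word Z) : plug (starless w) u = w.
Proof. by rewrite /plug /starless wbind_wbind; apply: wbind_id. Qed.

Lemma eq_wbind (Y : choiceType) (Z : Type) (h h' : Y -> word Z) w : h =1 h' -> wbind h w = wbind h' w.
Proof.
move=> e; have L : forall a, lbind h a = lbind h' a.
  elim/letter_mem_ind => [z|v IH]; first exact: e.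
  rewrite !lbind_brk; congr (wprime (Brk _)); apply: letters_inj; rewrite !letters_wbind.
  by apply: eq_flatten_map => a /IH->.
by apply: letters_inj; rewrite !letters_wbind; apply: eq_flatten_map => a _; rewrite L.
Qed.

Lemma plug_star_plug (Z : choiceType) (q r : word (option Z)) (u : word Z) :
  plug (plug_star q r) u = plug q (plug r u).
Proof.
by rewrite /plug /plug_star wbind_wbind; apply: eq_wbind => -[z|].
Qed.

(** [lbind] returns a word even when a letter goes to a single letter; [lbind_linj] shows that the
    projection discards nothing. *)
Definition linj (Z : Type) (a : letter Z) : letter (option Z) :=
  (lbind (fun z => wgen (Some z)) a).1.

Lemma lbind_linj (Z : Type) (a : letter Z) :
  lbind (fun z => wgen (Some z)) a = wprime (linj a).
Proof. by case: a => [z|[x s]]. Qed.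

Lemma letters_starless (Z : Type) (w : word Z) : letters (starless w) = map (@linj Z) (letters w).
Proof.
rewrite letters_wbind; elim: (letters w) => //= a s ->.
by rewrite lbind_linj.
Qed.

Lemma linj_brk (Z : Type) (w : word Z) : linj (Brk w) = Brk (starless w).
Proof. by rewrite /linj lbind_brk. Qed.

Definition wstars (Z : Type) (q : word (option Z)) := sumn (map (@lstars Z) (letters q)).

Lemma lstars_brk (Z : Type) (q : word (option Z)) : lstars (Brk q) = wstars q.
Proof. by case: q. Qed.

Lemma wstars_brk (Z : Type) (q : word (option Z)) : wstars (wprime (Brk q)) = wstars q.
Proof. by case: q => x s; exact: addn0. Qed.

Lemma wstars_wcat (Z : Type) (p q : word (option Z)) :
  wstars (wcat p q) = wstars p + wstars q.
Proof. by rewrite /wstars letters_wcat map_cat sumn_cat. Qed.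

Lemma sumn_linj (Z : choiceType) (s : seq (letter Z)) :
  sumn (map (@lstars Z) (map (@linj Z) s)) = 0.
Proof.
have L : forall a : letter Z, lstars (linj a) = 0.
  elim/letter_mem_ind => // w IH; rewrite linj_brk lstars_brk /wstars letters_starless.
  elim: (letters w) IH => //= a t IHt h.
  by rewrite h ?mem_head // IHt // => b hb; apply: h; rewrite inE hb orbT.
by elim: s => //= a s ->; rewrite L.
Qed.

Lemma wstars_starless (Z : choiceType) (w : word Z) : wstars (starless w) = 0.
Proof. by rewrite /wstars letters_starless sumn_linj. Qed.

(** The flanks may be empty but a word may not, so the first letter has to be found by cases on
    [l]. *)
Definition wput (Z : Type) (l : seq (letter Z)) (u : word Z) (r : seq (letter Z)) : word Z :=
  if l is a :: l' then (a, l' ++ letters u ++ r) else (u.1, u.2 ++ r).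

Lemma letters_wput (Z : Type) l (u : word Z) r : letters (wput l u r) = l ++ letters u ++ r.
Proof. by case: l. Qed.

End WordLaws.

(* [Leaf l r] is the star-word l * r, and [Deep l c r] is l |_c_| r: a canonical
   form of one-star words exposing the path to the star. *)
Inductive ctx (Z : Type) : Type :=
  | Leaf of seq (letter Z) & seq (letter Z)
  | Deep of seq (letter Z) & ctx Z & seq (letter Z).

Section Contexts.
Local Open Scope nat_scope.

Fixpoint fill (Z : Type) (c : ctx Z) (u : word Z) : word Z :=
  match c with
  | Leaf l r => wput l u r
  | Deep l c r => wput l (wprime (Brk (fill c u))) r
  end.

Fixpoint qof (Z : Type) (c : ctx Z) : word (option Z) :=
  match c with
  | Leaf l r => wput (map (@linj Z) l) (star Z) (map (@linj Z) r)
  | Deep l c r => wput (map (@linj Z) l) (wprime (Brk (qof c))) (map (@linj Z) r)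
  end.

Lemma star_word_qof (Z : choiceType) (c : ctx Z) : star_word (qof c).
Proof.
rewrite /star_word; rewrite -/(wstars _).
have W l q r : wstars (wput (map (@linj Z) l) q (map (@linj Z) r)) = wstars q.
  by rewrite /wstars letters_wput !map_cat !sumn_cat !sumn_linj addn0.
elim: c => [l r|l c IH r]; rewrite [qof _]/= W //.
by rewrite wstars_brk.
Qed.

Lemma lbind_plug_linj (Z : choiceType) (h : option Z -> word Z) (s : seq (letter Z)) :
  (forall z, h (Some z) = wgen z) ->
  flatten (map (fun a => letters (lbind h a)) (map (@linj Z) s)) = s.
Proof.
move=> e; elim: s => //= a s ->.
have -> : lbind h (linj a) = wprime a => //.
by rewrite -wbind_prime -lbind_linj -wbind_prime wbind_wbind; apply: wbind_id.
Qed.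

Lemma letters_plug_put (Z : choiceType) l (q : word (option Z)) r (u : word Z) :
  letters (plug (wput (map (@linj Z) l) q (map (@linj Z) r)) u) =
  l ++ letters (plug q u) ++ r.
Proof.
rewrite !letters_wbind letters_wput !map_cat !flatten_cat !lbind_plug_linj //.
Qed.

Lemma plug_qof (Z : choiceType) (c : ctx Z) u : plug (qof c) u = fill c u.
Proof.
elim: c => [l r|l c IH r]; apply: letters_inj; rewrite [qof _]/= [fill _ _]/= letters_plug_put letters_wput //.
by rewrite -IH /plug wbind_prime lbind_brk.
Qed.

Lemma sumn1_split (T : eqType) (f : T -> nat) (s : seq T) : sumn (map f s) = 1 ->
  exists l a r, [/\ s = l ++ a :: r, f a = 1, sumn (map f l) = 0 & sumn (map f r) = 0].
Proof.
elim: s => //= a s IH; case E: (f a) => [|[|k]] //.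
  rewrite add0n => /IH[l [b [r [-> fb fl fr]]]]; exists (a :: l), b, r; split=> //=.
  by rewrite E fl.
by case=> h; exists [::], a, s; split.
Qed.

Lemma qof_surj (Z : choiceType) (q : word (option Z)) : star_word q -> exists c, q = qof c.
Proof.
(* Letters with no star and with one star are treated together: all the neighbours of the letter
   that carries the star carry none. *)
pose P (a : letter (option Z)) := (lstars a = 0 -> exists b, a = linj b) /\
  (lstars a = 1 -> a = Gen None \/ exists c, a = Brk (qof c)).
have S0 (s : seq (letter (option Z))) : (forall a, a \in s -> P a) -> sumn (map (@lstars Z) s) = 0 ->
    exists t, s = map (@linj Z) t.
  elim: s => [|a s IH] hs /=; first by exists [::].
  move/eqP; rewrite addn_eq0 => /andP[/eqP a0 /eqP s0].
  case: (IH _ s0) => [b hb|t ->]; first by apply: hs; rewrite inE hb orbT.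
  by case: (hs a (mem_head _ _)) => /(_ a0)[b ->] _; exists (b :: t).
have S1 (w : word (option Z)) : (forall a, a \in letters w -> P a) -> wstars w = 1 ->
    exists c, w = qof c.
  move=> hs /sumn1_split[l [a [r [e a1 l0 r0]]]]; rewrite e in hs.
  case: (S0 l _ l0) => [b hb|l' el]; first by apply: hs; rewrite mem_cat hb.
  case: (S0 r _ r0) => [b hb|r' er]; first by apply: hs; rewrite mem_cat inE hb !orbT.
  case: (hs a) => [|_ /(_ a1)[ea|[c ec]]]; first by rewrite mem_cat mem_head orbT.
    by exists (Leaf l' r'); apply: letters_inj; rewrite e letters_wput el er ea.
  by exists (Deep l' c r'); apply: letters_inj; rewrite e letters_wput el er ec.
have L : forall a, P a.
  elim/letter_mem_ind => [[z|]|w IH].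
  - by split=> // _; exists (Gen z).
  - by split=> //; left.
  split; rewrite lstars_brk; last by move=> /(S1 _ IH)[c ->]; right; exists c.
  move=> /(S0 _ IH); case: w IH => x s IH [[|b t] //= [eb et]].
  by exists (Brk (b, t)); rewrite linj_brk; congr Brk; apply: letters_inj;
    rewrite letters_starless /letters /= eb et.
exact: S1.
Qed.

(** Contexts as functions up to pointwise equality: nesting contexts becomes composition, with no
    representative to compute. *)
Definition isctx (Z : Type) (g : word Z -> word Z) := exists c, g =1 fill c.

Lemma isctx_fill (Z : Type) (c : ctx Z) : isctx (fill c).
Proof. by exists c. Qed.

Lemma isctx_plug (Z : choiceType) (q : word (option Z)) : star_word q -> isctx (plug q).
Proof. by move=> /qof_surj[c ->]; exists c => u; rewrite plug_qof. Qed.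

Lemma isctx_ext (Z : Type) (g g' : word Z -> word Z) : g =1 g' -> isctx g -> isctx g'.
Proof. by move=> e [c h]; exists c => u; rewrite -e h. Qed.

Lemma isctx_id (Z : Type) : isctx (@id (word Z)).
Proof. by exists (Leaf [::] [::]) => u; apply: letters_inj; rewrite letters_wput cats0. Qed.

Lemma isctx_put (Z : Type) l (g : word Z -> word Z) r : isctx g -> isctx (fun u => wput l (g u) r).
Proof.
case=> -[l' r'|l' c r'] e.
  exists (Leaf (l ++ l') (r' ++ r)) => u; rewrite e; apply: letters_inj.
  by rewrite !letters_wput !catA.
exists (Deep (l ++ l') c (r' ++ r)) => u; rewrite e; apply: letters_inj.
by rewrite !letters_wput -!catA.
Qed.

Lemma isctx_catl (Z : Type) v (g : word Z -> word Z) : isctx g -> isctx (fun u => wcat v (g u)).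
Proof.
move=> /(isctx_put (letters v) [::]); apply: isctx_ext => u; apply: letters_inj.
by rewrite letters_wput cats0.
Qed.

Lemma isctx_catr (Z : Type) v (g : word Z -> word Z) : isctx g -> isctx (fun u => wcat (g u) v).
Proof.
move=> /(isctx_put [::] (letters v)); apply: isctx_ext => u; apply: letters_inj.
by rewrite letters_wput.
Qed.

Lemma isctx_brk (Z : Type) (g : word Z -> word Z) : isctx g -> isctx (fun u => wprime (Brk (g u))).
Proof.
case=> c e; exists (Deep [::] c [::]) => u; apply: letters_inj.
by rewrite letters_wput e.
Qed.

Lemma isctx_comp (Z : Type) (g h : word Z -> word Z) : isctx g -> isctx h -> isctx (fun u => g (h u)).
Proof.
case=> c e ch; suff : isctx (fun u => fill c (h u)) by apply: isctx_ext => u; rewrite e.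
elim: c {e} => [l r|l c IH r]; first exact: isctx_put.
exact/isctx_put/isctx_brk.
Qed.

End Contexts.

(** * Bracketings with one hole *)

Section TreeLaws.
Local Open Scope nat_scope.

Lemma bare_bbind (Y Z : Type) (h : Y -> bword Z) t :
  bare (bbind h t) = wbind (fun y => bare (h y)) (bare t).
Proof.
elim: t => //= [t IH|l IHl r IHr]; last by rewrite wbind_wcat IHl IHr.
by rewrite wbind_prime lbind_brk IH.
Qed.

Lemma bare_starless (Z : Type) (t : bword Z) : bare (bstarless t) = starless (bare t).
Proof. exact: bare_bbind. Qed.

Lemma bare_plug (Z : choiceType) (T : bword (option Z)) t :
  bare (bplug T t) = plug (bare T) (bare t).
Proof. by rewrite /bplug bare_bbind; apply: eq_wbind => -[]. Qed.

Lemma bplug_starless (Z : Type) (t s : bword Z) : bplug (bstarless t) s = t.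
Proof.
by elim: t => // [t IH|l IHl r IHr]; [exact: (congr1 _ IH) | exact: (congr2 _ IHl IHr)].
Qed.

(** Siblings along the path to the star are images of [bstarless], so they evaluate to ordinary
    bracketings whatever is put in the hole. *)
Inductive hole1 (Z : Type) : bword (option Z) -> Prop :=
  | Hole : hole1 (BGen None)
  | HoleBrk T : hole1 T -> hole1 (BBrk T)
  | HoleL T t : hole1 T -> hole1 (BNode T (bstarless t))
  | HoleR T t : hole1 T -> hole1 (BNode (bstarless t) T).

Lemma starless_tree (Z : Type) (T : bword (option Z)) :
  wstars (bare T) = 0 -> exists t, T = bstarless t.
Proof.
elim: T => [[z|]|T IH|T1 IH1 T2 IH2] //=.
- by exists (BGen z).
- by rewrite wstars_brk => /IH[t ->]; exists (BBrk t).
rewrite wstars_wcat => /eqP; rewrite addn_eq0 => /andP[/eqP/IH1[t1 ->] /eqP/IH2[t2 ->]].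
by exists (BNode t1 t2).
Qed.

Lemma star_tree (Z : Type) (T : bword (option Z)) : star_word (bare T) -> hole1 T.
Proof.
rewrite /star_word -/(wstars _); elim: T => [[z|]|T IH|T1 IH1 T2 IH2] //=.
- by move=> _; apply: Hole.
- rewrite wstars_brk => /IH; exact: HoleBrk.
rewrite wstars_wcat; case E: (wstars (bare T1)) => [|[|k]] //.
  by case: (starless_tree E) => t -> /IH2; apply: HoleR.
rewrite add1n => -[] /starless_tree[t ->]; exact/HoleL/IH1.
Qed.

End TreeLaws.

(** * Lyndon-Shirshov bracketings *)

Section OrderedWords.
Local Open Scope nat_scope.
Variables (Z : choiceType) (ge : rel (word Z)).
Hypotheses (ge_mon : monomial_order ge) (ge_inv : invariant_order ge).

Local Notation gt := (wgt ge).
Local Notation pgt := (pgt ge).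
Local Notation "s <' t" := (lexgt pgt s t) (at level 70).
Local Notation LynZ := (Lyn pgt).
Local Notation LS := (nonassoc_LS ge).

Implicit Types (u v w : word Z) (t : bword Z).

Lemma wgt_irr : irreflexive gt.
Proof. by move=> u; rewrite /wgt eqxx andbF. Qed.

Lemma wgt_trans : transitive gt.
Proof.
have [[_ asym tr _] _ _] := ge_mon.
move=> v u w /andP[uv nuv] /andP[vw nvw]; rewrite /wgt (tr _ _ _ uv vw) /=.
apply/eqP => e; rewrite -e in vw; move/eqP: nuv; apply; apply: asym.
by rewrite uv vw.
Qed.

Lemma wgt_total u v : [|| u == v, gt u v | gt v u].
Proof.
have [[_ asym tr tot] _ _] := ge_mon.
rewrite /wgt (eq_sym v u); case: eqVneq => //= _.
by rewrite !andbT; apply: tot.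
Qed.

Lemma wge_refl u : ge u u.
Proof. by have [[r _ _ _] _ _] := ge_mon. Qed.

Lemma wgeE u v : ge u v = (u == v) || gt u v.
Proof. by rewrite /wgt; case: eqVneq => [->|_]; rewrite ?wge_refl ?andbT. Qed.

Lemma wgt_wge u v : gt u v -> ge u v.
Proof. by case/andP. Qed.

Lemma wgt_wge_trans u v w : gt u v -> ge v w -> gt u w.
Proof. by rewrite wgeE => h /orP[/eqP<-//|]; apply: wgt_trans. Qed.

Lemma wgt_wf : well_founded (fun u v => gt v u).
Proof. by have [_ wf _] := ge_mon. Qed.

Lemma wgt_ctx g u v : isctx g -> gt u v -> gt (g u) (g v).
Proof.
have [_ _ mon] := ge_mon.
case=> c e uv; rewrite !e -!plug_qof; apply: mon uv; exact: star_word_qof.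
Qed.

Lemma pgt_irr : irreflexive pgt.
Proof. by move=> a; exact: wgt_irr. Qed.

Lemma pgt_trans : transitive pgt.
Proof. by move=> b a c; apply: wgt_trans. Qed.

Lemma pgt_total a b : [|| a == b, pgt a b | pgt b a].
Proof. by have := wgt_total (wprime a) (wprime b); rewrite xpair_eqE eqxx andbT. Qed.

Lemma wgt_lexgt u v : perm_eq (letters u) (letters v) ->
  letters u <' letters v -> gt u v.
Proof.
move=> p h; rewrite /wgt (ge_inv p) /lexge h orbT /=.
by apply/eqP => e; rewrite e (lexgt_irr pgt_irr) in h.
Qed.

(** The two products are rearrangements of the same primes, so invariance reduces the comparison to
    the lexicographic one, which is the Lyndon condition. This fixes the leading word of every
    commutator below. *)
Lemma wgt_swap u v : LynZ (letters (wcat u v)) -> gt (wcat u v) (wcat v u).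
Proof.
move=> L; apply: wgt_lexgt; rewrite !letters_wcat; first by rewrite perm_catC.
have /ALSW_Lyn : LynZ (letters (wcat u v)) by [].
by case/(_ pgt_irr pgt_trans pgt_total) => _; apply.
Qed.

Lemma ALSW_word u : ALSW pgt (letters u) <-> LynZ (letters u).
Proof. apply: ALSW_Lyn; [exact: pgt_irr | exact: pgt_trans | exact: pgt_total]. Qed.

Definition letter_ALSBW (a : letter Z) : Prop :=
  if a is Brk w then ALSBW ge w else True.

Lemma ALSBW_level_le m n w : m <= n -> ALSBW_level ge m w -> ALSBW_level ge n w.
Proof.
elim: m n w => [|m IH] [|n] w //= le [A B]; split=> // a /B; case: a => // w' //.
exact: IH.
Qed.

(** Removes the nesting level: levels are cumulative and a word has finitely many letters, so one
    level serves all of them. *)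
Lemma ALSBW_iff w : ALSBW ge w <-> LynZ (letters w) /\ (forall a, a \in letters w -> letter_ALSBW a).
Proof.
rewrite -ALSW_word; split.
  case=> n h; split; first by case: n h => [|n] [].
  move=> [z|w'] // hw /=; case: n h => [|n] [_ /(_ _ hw)] //= h.
  by exists n.
case=> A B.
have [n hn] : exists n, forall a, a \in letters w ->
     if a is Brk w' then ALSBW_level ge n w' else True.
  elim: (letters w) B => [|a s IH] B; first by exists 0.
  case: IH => [b hb|n hn]; first by apply: B; rewrite inE hb orbT.
  have := B a (mem_head _ _); case: a {B} => [z _|w' [m hm]].
    by exists n => a; rewrite inE => /orP[/eqP->//|/hn].
  exists (maxn m n) => a; rewrite inE => /orP[/eqP->|/hn].
    by apply: ALSBW_level_le hm; apply: leq_maxl.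
  by case: a => // v; apply: ALSBW_level_le; apply: leq_maxr.
by exists n.+1; split=> // -[z|w'] //; apply: hn.
Qed.

Lemma LS_ALSBW t : LS t -> ALSBW ge (bare t).
Proof.
elim: t => [z _|t IH /IH h|l IHl r IHr /= [A Ll Lr _]]; apply/ALSBW_iff.
- by split; [exact: Lyn1 | move=> a; rewrite inE => /eqP->].
- by split; [exact: Lyn1 | move=> a; rewrite inE => /eqP->].
split; first by apply/ALSW_word.
move=> a; rewrite letters_wcat mem_cat => /orP[]; move: a.
  by case: (proj1 (ALSBW_iff _) (IHl Ll)).
by case: (proj1 (ALSBW_iff _) (IHr Lr)).
Qed.

Lemma LS_Lyn t : LS t -> LynZ (letters (bare t)).
Proof. by move=> /LS_ALSBW/ALSBW_iff[]. Qed.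

(** Induction on the left subtree (l1 l2): a suffix starting inside it is l2 or [<']-above l2, and
    the node condition puts r at or below l2. *)
Lemma LS_minsuf l r : LS (BNode l r) ->
  minsuf pgt (letters (bare (BNode l r))) (letters (bare r)).
Proof.
elim: l r => [z|t IH|l1 IH1 l2 IH2] r [A Ll Lr le];
  rewrite letters_wcat; apply: minsuf_cat (LS_Lyn Lr) _;
  try exact: pgt_irr; try exact: pgt_trans.
- by move=> [|? [|? ?]] // [|? ?].
- by move=> [|? [|? ?]] // [|? ?].
move=> x y x0 y0 e; have := IH1 _ Ll x y x0 y0 e.
case/orP: le => [/eqP->//|lt]; right.
by case: H => [<-//|]; apply: (lexgt_trans pgt_trans) lt.
Qed.

Lemma letters_neq0 u : letters u <> [::].
Proof. by []. Qed.

Lemma size_letters_gt0 u : 0 < size (letters u).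
Proof. by []. Qed.

Lemma LS_uniq t t' : LS t -> LS t' -> bare t = bare t' -> t = t'.
Proof.
elim: t t' => [z|t IH|l IHl r IHr] [z'|t'|l' r'] L L' //=.
- by case=> ->.
- by move/(congr1 (size \o @letters Z)) => /= []; rewrite size_cat /= addnS.
- by case=> e; rewrite (IH t').
- by move/(congr1 (size \o @letters Z)) => /= []; rewrite size_cat /= addnS.
- by move/(congr1 (size \o @letters Z)) => /= []; rewrite size_cat /= addnS.
- by move/(congr1 (size \o @letters Z)) => /= []; rewrite size_cat /= addnS.
move=> e; have := congr1 (@letters Z) e; rewrite !letters_wcat => e'.
have [e1 e2] := minsuf_uniq pgt_irr pgt_trans (@letters_neq0 _) (@letters_neq0 _)
  (@letters_neq0 _) (@letters_neq0 _) e' (LS_minsuf L) (LS_minsuf L').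
case: L L' => [_ Ll Lr _] [_ Ll' Lr' _].
by rewrite (IHl l' Ll Ll' (letters_inj e1)) (IHr r' Lr Lr' (letters_inj e2)).
Qed.

Lemma LS_node l r : LS l -> LS r -> letters (bare l) <' letters (bare r) ->
  (forall l1 l2, l = BNode l1 l2 -> lexge pgt (letters (bare r)) (letters (bare l2))) ->
  LS (BNode l r).
Proof.
move=> Ll Lr lt h; split=> //.
  by apply/ALSW_word; apply: Lyn_cat lt; [exact: pgt_irr | exact: pgt_trans | exact: LS_Lyn..].
by case: l h {Ll lt} => // l1 l2 h; apply: h.
Qed.

Lemma wordP (s : seq (letter Z)) : s <> [::] -> exists u, s = letters u.
Proof. by case: s => // a s _; exists (a, s). Qed.

(** Assuming trees for the letters separates the splitting of a word at its least suffix from the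
    descent into brackets, which [LS_exists] does level by level. *)
Lemma LS_word_exists w : LynZ (letters w) ->
  (forall a, a \in letters w -> exists2 t, LS t & bare t = wprime a) ->
  exists2 t, LS t & bare t = w.
Proof.
have [n] := ubnP (size (letters w)); elim: n w => // n IH w; rewrite ltnS => sw L hl.
case: (ltnP 1 (size (letters w))) => [s1|]; last first.
  case: w hl {sw L} => a [|//] hl _; case: (hl a (mem_head _ _)) => t; by exists t.
have [u0 [v0 [u00 v00 e m]]] := minsuf_exists pgt_irr pgt_trans pgt_total s1.
have [Lu Lv] := minsuf_Lyn pgt_irr pgt_trans pgt_total L u00 v00 e m.
have [u eu] := wordP u00; have [v ev] := wordP v00; subst u0 v0.
have ew : w = wcat u v by apply: letters_inj; rewrite letters_wcat.
have [tl LSl el] : exists2 t, LS t & bare t = u.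
  apply: IH => // [|a ha]; last by apply: hl; rewrite e mem_cat ha.
  apply: leq_trans sw; rewrite e size_cat -{1}[size (letters u)]addn0 ltn_add2l.
  exact: size_letters_gt0.
have [tr LSr er] : exists2 t, LS t & bare t = v.
  apply: IH => // [|a ha]; last by apply: hl; rewrite e mem_cat ha orbT.
  apply: leq_trans sw; rewrite e size_cat -{1}[size (letters v)]add0n ltn_add2r.
  exact: size_letters_gt0.
exists (BNode tl tr); last by rewrite /= el er.
have uw : letters u <' letters v.
  apply: (lexgt_trans pgt_trans) (L.2 _ _ u00 v00 e).
  by rewrite e; apply: lexgt_catr => //; exact: pgt_irr.
apply: LS_node => //; rewrite ?el ?er // => l1 l2 etl.
have eul : letters u = letters (bare l1) ++ letters (bare l2).
  by rewrite -letters_wcat -el etl.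
have := minsuf_sub pgt_irr pgt_trans pgt_total Lv (@letters_neq0 _) (@letters_neq0 _) e m eul.
by case=> [->|h]; rewrite /lexge ?eqxx ?h ?orbT.
Qed.

Lemma LS_exists w : ALSBW ge w -> exists2 t, LS t & bare t = w.
Proof.
case=> n; elim: n w => [|n IH] w h; apply: LS_word_exists.
- by apply/ALSW_word; case: h.
- by case: h => _ h [z|w'] /h // _; exists (BGen z).
- by apply/ALSW_word; case: h.
case: h => _ h [z|w'] /h; first by exists (BGen z).
by move=> /IH[t Lt et]; exists (BBrk t) => //=; rewrite et.
Qed.

Lemma is_LS_exists w : ALSBW ge w -> exists t, is_LS_bracketing ge w t.
Proof. by move=> h; case: (LS_exists h) => t Lt et; exists t; split. Qed.

Lemma is_LS_tree t : LS t -> is_LS_bracketing ge (bare t) t.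
Proof. by move=> L; split=> //; apply: LS_ALSBW. Qed.

(* q|_u = q'|_{uc} in the paper, with q = qof c, q' = qof c' and x for c. *)
Fixpoint extends (c c' : ctx Z) (x : seq (letter Z)) : Prop :=
  match c, c' with
  | Leaf l r, Leaf l' r' => l = l' /\ r = x ++ r'
  | Deep l c r, Deep l' c' r' => [/\ l = l', r = r' & extends c c' x]
  | _, _ => False
  end.

(* A Lyndon word u straddling the cut of a node (t1)(t2) must contain all of
   t1: otherwise u c would be a proper suffix of the node strictly below its
   minimal suffix t2. *)
Lemma shirshov_bracket t c u : LS t -> bare t = fill c u -> LynZ (letters u) ->
  exists c' x T0 tuc, [/\ extends c c' x, bare T0 = qof c', LS tuc,
    bplug T0 tuc = t & letters (bare tuc) = letters u ++ x].
Proof.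
have base t0 u0 : LS t0 -> letters (bare t0) = letters u0 ->
    exists c' x T0 tuc, [/\ extends (Leaf [::] [::]) c' x, bare T0 = qof c', LS tuc,
    bplug T0 tuc = t0 & letters (bare tuc) = letters u0 ++ x].
  by move=> L0 e0; exists (Leaf [::] [::]), [::], (BGen None), t0; split; rewrite ?cats0.
move=> Lt et Lu; have {et} : letters (bare t) = letters (fill c u) by rewrite et.
elim: t c Lt => [z|t IH|t1 IH1 t2 IH2] c Lt; case: c => [l r|l c r];
  rewrite [fill _ _]/= letters_wput.
- case: l => [|a l] e; last by case: e; case: l.
  have er : r = [::] by case: r e => //; case: (u) => ? [].
  by rewrite er /= in e *; apply: base; rewrite // e cats0.
- by case: l => [|a l] //= [] //; case: l.
- case: l => [|a l] e; last by case: e; case: l.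
  have er : r = [::] by case: r e => //; case: (u) => ? [].
  by rewrite er /= in e *; apply: base; rewrite // e cats0.
- case: l => [|a l]; last by case=> _; case: l.
  case: r => // -[] e; case: (IH c Lt) => [|c' [x [T0 [tuc [h1 h2 h3 h4 h5]]]]]; first by rewrite e.
  exists (Deep [::] c' [::]), x, (BBrk T0), tuc; split=> //; last by rewrite -h4.
  by apply: letters_inj; rewrite [bare _]/= h2 letters_wput.
- rewrite [bare _]/= letters_wcat => e; have [_ L1 L2 _] := Lt.
  case: (cat_eq_cat e) => [[z [e1 e2]]|[z [z0 [el e2]]]]; last first.
    case: (IH2 (Leaf z r) L2) => [|c' [x [T0 [tuc [h1 h2 h3 h4 h5]]]]].
      by rewrite letters_wput.
    case: c' h1 h2 => // l' r' [ez er] h2; subst l'.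
    exists (Leaf l r'), x, (BNode (bstarless t1) T0), tuc; split=> //; last first.
      by rewrite -h4 -[in RHS](bplug_starless t1 tuc).
    apply: letters_inj; rewrite [bare _]/= letters_wcat bare_starless letters_starless h2.
    by rewrite !letters_wput el map_cat catA.
  case: (cat_eq_cat (esym e2)) => [[y [ez er]]|[y [yn0 [eu er]]]].
    case: (IH1 (Leaf l y) L1) => [|c' [x [T0 [tuc [h1 h2 h3 h4 h5]]]]].
      by rewrite letters_wput e1 ez.
    case: c' h1 h2 => // l' r' [el ey] h2; subst l'.
    exists (Leaf l (r' ++ letters (bare t2))), x, (BNode T0 (bstarless t2)), tuc; split=> //; last first.
    - by rewrite -h4 -[in RHS](bplug_starless t2 tuc).
    - apply: letters_inj; rewrite [bare _]/= letters_wcat bare_starless letters_starless h2.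
      by rewrite !letters_wput map_cat !catA.
    by split=> //; rewrite er ey catA.
  (* With z empty, u starts exactly at the cut and lies in t2; with z nonempty it straddles the
     cut. *)
  case: (z =P [::]) => [z0|z0].
    rewrite z0 cats0 in e1; rewrite z0 /= in eu e2.
    case: (IH2 (Leaf [::] r) L2) => [|c' [x [T0 [tuc [h1 h2 h3 h4 h5]]]]].
      by rewrite letters_wput /= -e2.
    case: c' h1 h2 => // l' r' [ez ey] h2; subst l'.
    exists (Leaf l r'), x, (BNode (bstarless t1) T0), tuc; split=> //; last first.
      by rewrite -h4 -[in RHS](bplug_starless t1 tuc).
    apply: letters_inj; rewrite [bare _]/= letters_wcat bare_starless letters_starless h2.
    by rewrite !letters_wput e1.
  suff l0 : l = [::].
    exists (Leaf [::] [::]), r, (BGen None), (BNode t1 t2); split=> //; last by rewrite [bare _]/= letters_wcat e l0.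
    by rewrite /extends cats0.
  case: (l =P [::]) => // l0; exfalso.
  have sg : sgt pgt (letters u) y.
    exact: (Lyn_sgt pgt_irr Lu z0 yn0 eu).
  have lt := sgt_lexgt pgt_irr (sgt_cat r r sg).
  have e3 : letters (bare (BNode t1 t2)) = l ++ (z ++ letters (bare t2)).
    by rewrite [bare _]/= letters_wcat e1 catA.
  have := LS_minsuf Lt l0 (cat_nil_l (v := letters (bare t2)) z0) e3.
  rewrite er catA -eu => -[ey|h].
    by move: lt; rewrite ey (lexgt_irr pgt_irr).
  by rewrite (lexgt_asym pgt_irr pgt_trans h) in lt.
rewrite [bare _]/= letters_wcat letters_prime => e; have [_ L1 L2 _] := Lt.
case: (cat_eq_cat e) => [[z [e1 e2]]|[z [z0 [el e2]]]]; last first.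
  case: (IH2 (Deep z c r) L2) => [|c' [x [T0 [tuc [h1 h2 h3 h4 h5]]]]].
    by rewrite letters_wput.
  case: c' h1 h2 => // l' c' r' [ez er h1] h2; subst l'.
  exists (Deep l c' r'), x, (BNode (bstarless t1) T0), tuc; split=> //; last first.
    by rewrite -h4 -[in RHS](bplug_starless t1 tuc).
  apply: letters_inj; rewrite [bare _]/= letters_wcat bare_starless letters_starless h2.
  by rewrite !letters_wput el map_cat catA.
case: z e1 e2 => [|a z] e1 e2.
  rewrite cats0 in e1; case: (IH2 (Deep [::] c r) L2) => [|c' [x [T0 [tuc [h1 h2 h3 h4 h5]]]]].
    by rewrite letters_wput letters_prime.
  case: c' h1 h2 => // l' c' r' [ez er h1] h2; subst l'.
  exists (Deep l c' r'), x, (BNode (bstarless t1) T0), tuc; split=> //; last first.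
    by rewrite -h4 -[in RHS](bplug_starless t1 tuc).
  apply: letters_inj; rewrite [bare _]/= letters_wcat bare_starless letters_starless h2.
  by rewrite !letters_wput e1.
case: e2 => ea er.
case: (IH1 (Deep l c z) L1) => [|c' [x [T0 [tuc [h1 h2 h3 h4 h5]]]]].
  by rewrite letters_wput e1 ea.
case: c' h1 h2 => // l' c' r' [el ey h1] h2; subst l'.
exists (Deep l c' r), x, (BNode T0 (bstarless t2)), tuc; split=> //; last first.
  by rewrite -h4 -[in RHS](bplug_starless t2 tuc).
apply: letters_inj; rewrite [bare _]/= letters_wcat bare_starless letters_starless h2.
by rewrite !letters_wput er -ey map_cat -!catA.
Qed.

Lemma extends_qof c c' cs : extends c c' (flatten (map (@letters Z) cs)) ->
  qof c = plug_star (qof c') (foldl (@wcat _) (star Z) (map (@starless Z) cs)).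
Proof.
have P l (q : word (option Z)) r r0 : letters (plug_star
    (wput (map (@linj Z) l) q (map (@linj Z) r)) r0) =
    map (@linj Z) l ++ letters (plug_star q r0) ++ map (@linj Z) r.
  have I (s : seq (letter Z)) : flatten (map (fun a => letters
     (lbind (oapp (fun z => wgen (Some z)) r0) a)) (map (@linj Z) s)) = map (@linj Z) s.
    elim: s => //= a s ->.
    have -> // : lbind (oapp (fun z => wgen (Some z)) r0) (linj a) = wprime (linj a).
    by rewrite -wbind_prime -!lbind_linj -!wbind_prime wbind_wbind; apply: eq_wbind.
  by rewrite !letters_wbind letters_wput !map_cat !flatten_cat !I.
elim: c c' => [l r|l c IH r] [l' r'|l' c' r'] //=.
  case=> <- er; apply: letters_inj; rewrite P letters_wput er map_cat.
  have -> r0 : plug_star (star Z) r0 = r0 by [].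
  rewrite letters_foldl -!catA; congr (_ ++ (_ ++ (_ ++ _))).
  by rewrite map_flatten -!map_comp; congr flatten; apply: eq_map => w /=; rewrite letters_starless.
case=> <- <- h; apply: letters_inj; rewrite P letters_wput (IH _ h).
by rewrite /plug_star wbind_prime lbind_brk.
Qed.

(** The tail x after u is factored by [Lyn_factor]; each factor lies in ALSBW because its letters
    are letters of the bracketed word u x. *)
Lemma special_exists q u : star_word q -> ALSBW ge u -> ALSBW ge (plug q u) ->
  exists T, special_bracketing ge q u T.
Proof.
move=> sq Au Aqu; have [c ec] := qof_surj sq.
have [t Lt et] := LS_exists Aqu.
have Lu : LynZ (letters u) by case/ALSBW_iff: Au.
have e : bare t = fill c u by rewrite et ec plug_qof.
have [c' [x [T0 [tuc [h1 h2 h3 h4 h5]]]]] := shirshov_bracket Lt e Lu.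
have [fs [ex hf so]] := Lyn_factor pgt_irr pgt_trans pgt_total x.
have [cs ecs] : exists cs, fs = map (@letters Z) cs.
  elim: fs hf {ex so} => [|f fs IH] hf; first by exists [::].
  case: IH => [y hy|cs ->]; first by apply: hf; rewrite inE hy orbT.
  have /wordP[w ->] : f <> [::] by case: (hf f (mem_head _ _)).
  by exists (w :: cs).
rewrite ecs in ex hf so.
have euc : bare tuc = foldl (@wcat Z) u cs.
  by apply: letters_inj; rewrite h5 letters_foldl ex.
have [ts hts] : exists ts, List.Forall2 (is_LS_bracketing ge) cs ts.
  have hok a : a \in flatten (map (@letters Z) cs) -> letter_ALSBW a.
    move=> ha; case/LS_ALSBW/ALSBW_iff: h3 => _; apply.
    by rewrite h5 ex mem_cat ha orbT.
  elim: cs hf hok {ex so ecs euc} => [|w cs IH] hf hok; first by exists [::].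
  have ef : flatten (map (@letters Z) (w :: cs)) = letters w ++ flatten (map (@letters Z) cs) by [].
  rewrite ef in hok; case: IH => [y hy|a ha|ts hts].
  - by apply: hf; rewrite inE hy orbT.
  - by apply: hok; rewrite mem_cat ha orbT.
  have /is_LS_exists[tw htw] : ALSBW ge w.
    apply/ALSBW_iff; split; first by apply: hf; rewrite mem_head.
    by move=> a ha; apply: hok; rewrite mem_cat ha.
  by exists (tw :: ts); constructor.
exists (bplug_star T0 (left_normed (BGen None) (map (@bstarless Z) ts))).
split=> //; exists (qof c'), T0, tuc, cs, ts; split; split=> //.
- exact: star_word_qof.
- by rewrite ec; apply: extends_qof; rewrite -ex.
- by rewrite -euc; apply: is_LS_tree.
- by rewrite h4.
by move: so; rewrite sorted_map; apply: sub_sorted => a b; rewrite /lexge /relpre /= eq_sym.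
Qed.

End OrderedWords.

(** * The operated algebra and leading words *)

Section Subspaces.
Variables (F : fieldType) (V : lmodType F).
Implicit Types (P Q : V -> Prop) (f g : V).

Definition subsp P := P 0 /\ forall a f g, P f -> P g -> P (a *: f + g).

Lemma subspD P f g : subsp P -> P f -> P g -> P (f + g).
Proof. by move=> [_ h] pf pg; rewrite -[f]scale1r; apply: h. Qed.

Lemma subspZ P a f : subsp P -> P f -> P (a *: f).
Proof. by move=> [h0 h] pf; rewrite -[_ *: _]addr0; apply: h. Qed.

Lemma subspN P f : subsp P -> P f -> P (- f).
Proof. by move=> h pf; rewrite -scaleN1r; apply: subspZ. Qed.

Lemma subspB P f g : subsp P -> P f -> P g -> P (f - g).
Proof. by move=> h pf pg; apply: subspD => //; apply: subspN. Qed.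

Lemma subsp_sum P (I : Type) (r : seq I) (h : I -> V) :
  subsp P -> (forall i, P (h i)) -> P (\sum_(i <- r) h i).
Proof.
move=> s ph; elim/big_ind: _ => //; first by case: s.
by move=> x y px py; apply: subspD.
Qed.

Lemma span_ind P Q : subsp Q -> (forall x, P x -> Q x) ->
  forall f, span_of P f -> Q f.
Proof.
move=> sQ PQ f [n [c [g [Pg ->]]]]; apply: subsp_sum => // i.
by apply: subspZ => //; apply: PQ.
Qed.

Lemma span_mem P f : P f -> span_of P f.
Proof.
move=> pf; exists 1%N, (fun=> 1), (fun=> f); split=> //.
by rewrite big_ord1 scale1r.
Qed.

Lemma span_subsp P : subsp (span_of P).
Proof.
split; first by exists 0%N, (fun=> 0), (fun=> 0); split; [case | rewrite big_ord0].
move=> a f g [n [c [x [Px ->]]]] [m [d [y [Py ->]]]].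
exists (n + m)%N, (fun i => match split i with inl j => a * c j | inr k => d k end),
  (fun i => match split i with inl j => x j | inr k => y k end).
split; first by move=> i; case: (split i).
rewrite big_split_ord scaler_sumr; congr (_ + _); apply: eq_bigr => i _.
  by rewrite scalerA; case: split_ordP => j /eqP; rewrite ?eq_lrshift ?eq_lshift // => /eqP->.
by case: split_ordP => j /eqP; rewrite ?eq_rlshift ?eq_rshift // => /eqP->.
Qed.

Lemma span_sub P Q f : (forall x, P x -> Q x) -> span_of P f -> span_of Q f.
Proof. by move=> h; apply: span_ind; [exact: span_subsp | move=> x /h; exact: span_mem]. Qed.

End Subspaces.

Definition islin (F : fieldType) (V W : lmodType F) (L : V -> W) :=
  forall a f g, L (a *: f + g) = a *: L f + L g.

Section Islin.
Variables (F : fieldType) (V W : lmodType F) (L : V -> W).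
Hypothesis hL : islin L.

Lemma islin0 : L 0 = 0.
Proof. by have := hL 1 0 0; rewrite !scale1r add0r => /eqP; rewrite addrC -subr_eq subrr => /eqP. Qed.

Lemma islinD f g : L (f + g) = L f + L g.
Proof. by rewrite -[f in LHS]scale1r hL scale1r. Qed.

Lemma islinZ a f : L (a *: f) = a *: L f.
Proof. by rewrite -[_ *: _ in LHS]addr0 hL islin0 addr0. Qed.

Lemma islinN f : L (- f) = - L f.
Proof. by rewrite -scaleN1r islinZ scaleN1r. Qed.

Lemma islinB f g : L (f - g) = L f - L g.
Proof. by rewrite islinD islinN. Qed.

Lemma subsp_preim (P : W -> Prop) : subsp P -> subsp (fun f => P (L f)).
Proof. by move=> [h0 h]; split=> [|a f g pf pg]; rewrite ?islin0 // hL; apply: h. Qed.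

End Islin.

Section LinearExtension.
Variables (F : fieldType) (K : choiceType).
Local Notation A := {malg F[K]}.

Lemma malgUZ (c : F) (k : K) : << c *g k >> = c *: << k >> :> A.
Proof. by apply/malgP => x; rewrite mcoeffZ !mcoeffU mulrnAr mulr1. Qed.

Lemma malg_sum (f : A) : f = \sum_(u <- msupp f) f@_u *: << u >>.
Proof. by rewrite {1}[f]monalgE; apply: eq_bigr => u _; rewrite malgUZ. Qed.

Lemma malg_ind (P : A -> Prop) : subsp P ->
  forall f, (forall u, u \in msupp f -> P << u >>) -> P f.
Proof.
move=> sP f h; rewrite [f]malg_sum big_seq.
elim/big_ind: _ => [|x y|u hu]; first by case: sP.
  exact: subspD.
by apply: subspZ => //; apply: h.
Qed.

Definition mlin (V : lmodType F) (h : K -> V) (f : A) : V :=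
  \sum_(u <- msupp f) f@_u *: h u.

(** Supports change under addition, so linearity is checked by summing over one finite set
    containing all supports involved. *)
Lemma mlinEw (V : lmodType F) (h : K -> V) (f : A) (d : {fset K}) :
  (msupp f `<=` d)%fset -> mlin h f = \sum_(u <- d) f@_u *: h u.
Proof.
move=> le; apply: big_fset_incl => // u _ /mcoeff_outdom ->.
by rewrite scale0r.
Qed.

Lemma mlin_lin (V : lmodType F) (h : K -> V) : islin (mlin h).
Proof.
move=> a f g; pose d := (msupp (a *: f + g) `|` (msupp f `|` msupp g))%fset.
rewrite !(@mlinEw _ h _ d); try by apply/fsubsetP => x; rewrite !inE => ->; rewrite ?orbT.
rewrite scaler_sumr -big_split /=; apply: eq_bigr => u _.
by rewrite mcoeffD mcoeffZ scalerDl scalerA.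
Qed.

Lemma mlinU (V : lmodType F) (h : K -> V) k : mlin h << k >> = h k.
Proof.
by rewrite (@mlinEw _ h _ [fset k]%fset) ?msuppU_le // big_seq_fset1 mcoeffUU scale1r.
Qed.

Lemma eq_mlin (V : lmodType F) (h h' : K -> V) : h =1 h' -> mlin h =1 mlin h'.
Proof. by move=> e f; apply: eq_bigr => u _; rewrite e. Qed.

Lemma mlin_fun_lin (V : lmodType F) (h k : K -> V) a f :
  mlin (fun u => a *: h u + k u) f = a *: mlin h f + mlin k f.
Proof.
rewrite /mlin scaler_sumr -big_split /=; apply: eq_bigr => u _.
by rewrite scalerDr !scalerA (mulrC a).
Qed.

Lemma lin_ext (V : lmodType F) (L L' : A -> V) : islin L -> islin L' ->
  (forall u, L << u >> = L' << u >>) -> L =1 L'.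
Proof.
move=> hL hL' e f; apply: (malg_ind (P := fun f => L f = L' f)) => [|u _]; last exact: e.
split; first by rewrite !islin0.
by move=> a x y ex ey; rewrite hL hL' ex ey.
Qed.

End LinearExtension.

(** Stated for an abstract product so that the six monomials in x, y, z stay opaque and only the
    additive identity [T] remains; the two monomials absent on the left cancel. *)
Lemma assoc_jacobi (V : zmodType) (m : V -> V -> V) (c := fun x y => m x y - m y x) :
  (forall x y z, m (x - y) z = m x z - m y z) ->
  (forall x y z, m x (y - z) = m x y - m x z) ->
  (forall x y z, m x (m y z) = m (m x y) z) ->
  forall x y z, c (c x y) z = c (c x z) y + c x (c y z).
Proof.
have T (a b k d e l : V) : a - b + (d - k) = e - k + (l - b) + (a - e + (d - l)).
  rewrite [RHS]addrACA [e - k + _]addrC subrKA [l - b + _]addrC subrKA.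
  by rewrite addrACA [RHS]addrACA [- b - k]addrC.
by move=> Bl Br A x y z; rewrite /c !(Bl, Br) !A !opprB; apply: T.
Qed.

Section WordAlgebra.
Variables (F : fieldType) (Z : choiceType).
Local Notation A := {malg F[word Z]}.

(** For a context g this is q|_f. Allowing any map g also covers multiplication by a word and the
    operator. *)
Definition mapw (g : word Z -> word Z) : A -> A := mlin (fun u => << g u >>).

Lemma mapwE g f : mapw g f = mlin (fun u => << g u >>) f. Proof. by []. Qed.

Lemma mapw_lin g : islin (mapw g). Proof. exact: mlin_lin. Qed.

Lemma mapwU g u : mapw g << u >> = << g u >>. Proof. exact: mlinU. Qed.

Lemma eq_mapw g g' : g =1 g' -> mapw g =1 mapw g'.
Proof. by move=> e; apply: eq_mlin => u; rewrite e. Qed.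

Lemma mapw_comp g g' f : mapw g (mapw g' f) = mapw (fun u => g (g' u)) f.
Proof.
move: f; apply: lin_ext; last by move=> u; rewrite !mapwU.
  by move=> a x y; rewrite !mapw_lin.
exact: mapw_lin.
Qed.

Lemma mapw_id f : mapw id f = f.
Proof. by move: f; apply: lin_ext => // [|u]; [exact: mapw_lin | rewrite mapwU]. Qed.

Lemma amulE (f g : A) : amul f g = mlin (fun u => mapw (wcat u) g) f.
Proof.
apply: eq_bigr => u _; rewrite /mapw /mlin scaler_sumr; apply: eq_bigr => v _.
by rewrite malgUZ scalerA.
Qed.

Lemma amul_linl (g : A) : islin (fun f => amul f g).
Proof. by move=> a x y; rewrite !amulE mlin_lin. Qed.

Lemma amul_linr (f : A) : islin (amul f).
Proof.
move=> a x y; rewrite (amulE f x) (amulE f y) (amulE f (a *: x + y)).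
transitivity (mlin (fun u => a *: mapw (wcat u) x + mapw (wcat u) y) f).
  by apply: eq_mlin => u; apply: mapw_lin.
exact: mlin_fun_lin.
Qed.

Lemma amulUl u (f : A) : amul << u >> f = mapw (wcat u) f.
Proof. by rewrite amulE mlinU. Qed.

Lemma amulUr u (f : A) : amul f << u >> = mapw (fun v => wcat v u) f.
Proof.
move: f; apply: lin_ext => [||v]; [exact: amul_linl | exact: mapw_lin|].
by rewrite amulUl !mapwU.
Qed.

Lemma amulA (f g h : A) : amul f (amul g h) = amul (amul f g) h.
Proof.
move: f; apply: lin_ext => [||u]; first exact: amul_linl.
  by move=> a x y; rewrite !amul_linl.
move: g; apply: lin_ext => [||v].
- by move=> a x y; rewrite amul_linl amul_linr.
- by move=> a x y; rewrite amul_linr amul_linl.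
rewrite !amulUl mapwU amulUl mapw_comp; apply: eq_mapw => w.
exact: wcatA.
Qed.

Lemma amulBl (f g h : A) : amul (f - g) h = amul f h - amul g h.
Proof. exact: (islinB (@amul_linl h)). Qed.
Lemma amulBr (f g h : A) : amul f (g - h) = amul f g - amul f h.
Proof. exact: (islinB (@amul_linr f)). Qed.
Lemma amulDl (f g h : A) : amul (f + g) h = amul f h + amul g h.
Proof. exact: (islinD (@amul_linl h)). Qed.
Lemma abrkE (f : A) : abrk f = mapw (fun u => wprime (Brk u)) f.
Proof. by apply: eq_bigr => u _; rewrite malgUZ. Qed.

Lemma abrk_lin : islin (@abrk F Z).
Proof. by move=> a x y; rewrite !abrkE mapw_lin. Qed.

Lemma commE (f g : A) : comm f g = amul f g - amul g f. Proof. by []. Qed.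

Lemma comm_linl (g : A) : islin (fun f => comm f g).
Proof.
move=> a x y; rewrite /comm amul_linl amul_linr scalerBr opprD.
by rewrite addrACA.
Qed.

Lemma comm_linr (f : A) : islin (comm f).
Proof.
move=> a x y; rewrite /comm amul_linl amul_linr scalerBr opprD.
by rewrite addrACA.
Qed.

Lemma commC (f g : A) : comm f g = - comm g f.
Proof. by rewrite /comm opprB. Qed.

Lemma comm_self (f : A) : comm f f = 0.
Proof. by rewrite /comm subrr. Qed.

Lemma jacobi (f g h : A) :
  comm (comm f g) h = comm (comm f h) g + comm f (comm g h).
Proof.
exact: (assoc_jacobi (@amulBl) (@amulBr) (@amulA)).
Qed.

End WordAlgebra.

(** * Leading words of products and commutators *)

Section Leads.
Variables (F : fieldType) (Z : choiceType) (ge : rel (word Z)).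
Hypotheses (ge_mon : monomial_order ge) (ge_inv : invariant_order ge).
Local Notation A := {malg F[word Z]}.
Local Notation gt := (wgt ge).
Local Notation LS := (nonassoc_LS ge).
Implicit Types (u v w : word Z) (f g : A).

Definition Low w f := forall v, v \in msupp f -> gt w v.

Lemma Low_subsp w : subsp (Low w).
Proof.
split=> [v|a f g lf lg v]; first by rewrite msupp0.
move/(fsubsetP (msuppD_le _ _)); rewrite in_fsetU => /orP[|/lg//].
by move/(fsubsetP (msuppZ_le _ _))/lf.
Qed.

Lemma LowU w v : gt w v -> Low w << v >>.
Proof. by move=> h x; rewrite msuppU oner_eq0 inE => /eqP->. Qed.

Lemma Low_trans w v f : gt w v -> Low v f -> Low w f.
Proof. by move=> h l x /l; apply: wgt_trans. Qed.

Lemma Low_ind (P : A -> Prop) w f : subsp P -> Low w f ->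
  (forall v, gt w v -> P << v >>) -> P f.
Proof. by move=> sP l h; apply: malg_ind => // u /l /h. Qed.

(** Membership of f - w in the subspace [Low w] lets sums of error terms replace computations with
    supports. *)
Definition monic_lead f w := Low w (f - << w >>).

Local Notation mlead := monic_lead.

Lemma mleadP f w : mlead f w <-> is_lead ge f w /\ f@_w = 1.
Proof.
split.
  move=> h; have c1 : f@_w = 1.
    apply/eqP; rewrite -subr_eq0; apply/eqP.
    have -> : f@_w - 1 = (f - << w >>)@_w by rewrite mcoeffB mcoeffUU.
    by apply: mcoeff_outdom; apply/negP => /h; rewrite wgt_irr.
  split=> //; split; first by rewrite -mcoeff_neq0 c1 oner_eq0.
  move=> v hv; rewrite wgeE //; case: eqVneq => //= ne; apply: h.
  by rewrite -mcoeff_neq0 mcoeffB mcoeffU (negbTE ne) subr0 mcoeff_neq0.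
case=> -[_ h] c1 v hv; have ne : w != v.
  by apply: contraTneq hv => <-; rewrite -mcoeff_eq0 mcoeffB mcoeffUU c1 subrr.
rewrite /wgt ne andbT; apply: h; move: hv.
by rewrite -!mcoeff_neq0 mcoeffB mcoeffU (negbTE ne) subr0.
Qed.

Lemma is_lead_uniq f u v : is_lead ge f u -> is_lead ge f v -> u = v.
Proof.
have [[_ asym _ _] _ _] := ge_mon.
by move=> [su hu] [sv hv]; apply: asym; rewrite hu ?hv.
Qed.

Lemma mlead_uniq f u v : mlead f u -> is_lead ge f v -> u = v.
Proof. by case/mleadP => h _ /(is_lead_uniq h). Qed.

Lemma monic_mlead f u : monic ge f -> is_lead ge f u -> mlead f u.
Proof. by case=> v [lv c] lu; rewrite (is_lead_uniq lu lv); apply/mleadP. Qed.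

Lemma lead_exists f : f != 0 -> exists u, is_lead ge f u.
Proof.
have [[_ _ tr tot] _ _] := ge_mon.
move=> f0; have : exists u, u \in msupp f.
  case: (fset_0Vmem (msupp f)) => [e|[u hu]]; last by exists u.
  by move/eqP: f0; case; rewrite [f]malg_sum e big_seq_fset0.
have mx (s : seq (word Z)) : (exists u, u \in s) -> exists u, u \in s /\ forall v, v \in s -> ge u v.
  elim: s => [[]//|a s IH] _; case: (s =P [::]) => [->|s0].
    by exists a; rewrite mem_head; split=> // v; rewrite inE => /eqP->; apply: wge_refl.
  case: IH => [|u [us hu]]; first by case: (s) s0 => // b t _; exists b; rewrite mem_head.
  case/orP: (tot a u) => h.
    exists a; rewrite mem_head; split=> // v; rewrite inE => /orP[/eqP->|/hu]; first exact: wge_refl.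
    exact: tr.
  exists u; rewrite inE us orbT; split=> // v; rewrite inE => /orP[/eqP->//|]; exact: hu.
move=> h; case: (mx (msupp f)); first by case: h => u; exists u.
by move=> u [h1 h2]; exists u; split.
Qed.

Lemma mapw_Low (g : word Z -> word Z) u f : isctx g -> Low u f -> Low (g u) (mapw g f).
Proof.
move=> cg l; apply: (Low_ind (P := fun f => Low (g u) (mapw g f)) _ l) => [|v uv]; last first.
  by rewrite mapwU; apply: LowU; apply: wgt_ctx.
apply: subsp_preim; [exact: mapw_lin | exact: Low_subsp].
Qed.

Lemma mlead_ctx (g : word Z -> word Z) u f : isctx g -> mlead f u -> mlead (mapw g f) (g u).
Proof.
by move=> cg l; rewrite /monic_lead -mapwU -(islinB (mapw_lin g)); apply: mapw_Low.
Qed.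

Lemma wgt_catl u v w : gt v w -> gt (wcat u v) (wcat u w).
Proof. exact: (wgt_ctx ge_mon (isctx_catl u (isctx_id Z))). Qed.

Lemma wgt_catr u v w : gt v w -> gt (wcat v u) (wcat w u).
Proof. exact: (wgt_ctx ge_mon (isctx_catr u (isctx_id Z))). Qed.

Lemma amul_Low_l u v f g : Low u f -> mlead g v -> Low (wcat u v) (amul f g).
Proof.
move=> lf lg; apply: (Low_ind (P := fun f => Low (wcat u v) (amul f g)) _ lf) => [|x ux].
  by apply: (subsp_preim (amul_linl g)); exact: Low_subsp.
rewrite amulUl -[g](subrK << v >>) islinD; last exact: mapw_lin.
apply: (subspD (Low_subsp _)).
  apply: (@Low_trans _ (wcat x v)); first exact: wgt_catr.
  exact: (mapw_Low (isctx_catl x (isctx_id Z)) lg).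
by rewrite mapwU; apply/LowU/wgt_catr.
Qed.

Lemma mlead_amul u v f g : mlead f u -> mlead g v -> mlead (amul f g) (wcat u v).
Proof.
move=> lf lg.
have -> : amul f g = amul (f - << u >>) g + mapw (wcat u) g.
  by rewrite -amulUl -amulDl subrK.
have h1 : Low (wcat u v) (amul (f - << u >>) g) := amul_Low_l lf lg.
have h2 : mlead (mapw (wcat u) g) (wcat u v) := mlead_ctx (isctx_catl u (isctx_id Z)) lg.
rewrite /monic_lead -addrA.
exact: (subspD (Low_subsp _) h1 h2).
Qed.

Lemma mlead_Low w u f : gt w u -> mlead f u -> Low w f.
Proof.
move=> wu lf; rewrite -[f](subrK << u >>); apply: (subspD (Low_subsp _)).
  exact: Low_trans lf.
exact: LowU.
Qed.

Lemma mlead_comm u v f g : mlead f u -> mlead g v -> gt (wcat u v) (wcat v u) ->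
  mlead (comm f g) (wcat u v).
Proof.
move=> lf lg h; rewrite /monic_lead /comm addrAC; apply: (subspB (Low_subsp _)).
  exact: mlead_amul.
by apply: mlead_Low (mlead_amul lg lf).
Qed.

(** Triangularity of the Lyndon-Shirshov elements: at each node the word is Lyndon, so the first
    half of the commutator dominates by [wgt_swap]. *)
Lemma LS_mlead t : LS t -> mlead (bval (@agen F Z) t) (bare t).
Proof.
elim: t => [z _|t IH /= /IH h|l IHl r IHr L].
- by rewrite /monic_lead subrr => v; rewrite msupp0.
- by rewrite abrkE; exact: (mlead_ctx (isctx_brk (isctx_id Z)) h).
have [_ Ll Lr _] := L; rewrite [bval _ _]/= [bare _]/=.
apply: mlead_comm; [exact: IHl | exact: IHr | ].
by apply: wgt_swap => //; apply: (LS_Lyn ge_mon L).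
Qed.

End Leads.

(* Otherwise unification unfolds these sums and does not terminate in practice. *)
Opaque mapw amul comm abrk mlin.

(** * Lyndon-Shirshov trees span the Lie algebra *)

Section LieBasis.
Variables (F : fieldType) (Z : choiceType) (ge : rel (word Z)).
Hypotheses (ge_mon : monomial_order ge) (ge_inv : invariant_order ge).
Local Notation A := {malg F[word Z]}.
Local Notation pgt := (pgt ge).
Local Notation LS := (nonassoc_LS ge).
Local Notation "s <' t" := (lexgt pgt s t) (at level 70).
Local Notation val := (bval (@agen F Z)).
Local Notation lt t := (letters (bare t)).
Implicit Types (u v w : word Z) (f g : A) (s t r : bword Z).

Let pirr := @pgt_irr Z ge.
Let ptr := pgt_trans ge_mon.
Let ptot := pgt_total ge_mon.

Definition LS_span (Q : bword Z -> Prop) : A -> Prop :=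
  span_of (fun x => exists t, [/\ LS t, Q t & x = val t]).

Lemma LS_span_subsp Q : subsp (LS_span Q).
Proof. exact: span_subsp. Qed.

Lemma LS_span_sub (Q Q' : bword Z -> Prop) f : (forall t, Q t -> Q' t) -> LS_span Q f -> LS_span Q' f.
Proof.
by move=> h; apply: span_sub => x [t [L q e]]; exists t; split=> //; apply: h.
Qed.

Lemma LS_span_lin (L : A -> A) P Q f : islin L -> subsp P -> LS_span Q f ->
  (forall t, LS t -> Q t -> P (L (val t))) -> P (L f).
Proof.
move=> hL hP hf h; move: f hf; apply: (span_ind (Q := fun f => P (L f))).
  exact: subsp_preim.
by move=> x [t [Lt q ->]]; apply: h.
Qed.

(** All prefixes of rearrangements of M. This finite list contains the words of both factors of any
    commutator with content M, so counting its members below m gives a measure for induction on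
    m. *)
Definition below_words (M : seq (letter Z)) : seq (seq (letter Z)) :=
  flatten [seq [seq take i p | i <- iota 0 (size M).+1] | p <- permutations M].

Definition rank (M m : seq (letter Z)) := count (fun x => x <' m) (below_words M).

Lemma mem_below_words M x y : perm_eq (x ++ y) M -> x \in below_words M.
Proof.
move=> p; apply/flatten_mapP; exists (x ++ y); first by rewrite mem_permutations.
apply/mapP; exists (size x); last by rewrite take_size_cat.
by rewrite mem_iota add0n /= ltnS -(perm_size p) size_cat leq_addr.
Qed.

Lemma rank_lt M x y m : perm_eq (x ++ y) M -> x <' m -> (rank M x < rank M m)%N.
Proof.
move=> /mem_below_words; rewrite /rank; elim: (below_words M) => // a s IH.
rewrite inE => /orP[/eqP<-|hx] lt /=.
  rewrite lt (lexgt_irr pirr) add0n add1n ltnS; apply: sub_count => z /= h.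
  exact: lexgt_trans h lt.
have := IH hx lt; case ax: (a <' x); first by rewrite (lexgt_trans ptr ax lt) !add1n ltnS.
by rewrite add0n => h; apply: leq_trans h _; apply: leq_addl.
Qed.

Lemma lexge_lexgt_trans x y z : x <' y -> lexge pgt y z -> x <' z.
Proof. by move=> h /orP[/eqP<-//|]; apply: lexgt_trans h. Qed.

(* Induction on the degree, then on the maximum m of the two arguments: if
   s = (s1 s2) and s2 <' t, both brackets of Jacobi's identity only involve
   pairs strictly below t. *)
Lemma comm_LS M m s t : LS s -> LS t -> perm_eq (lt s ++ lt t) M ->
  lexge pgt (lt s) m -> lexge pgt (lt t) m ->
  LS_span (fun r => perm_eq (lt r) M /\ lt r <' m) (comm (val s) (val t)).
Proof.
have [n] := ubnP (size M); elim: n M m s t => // n IHn M m s t.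
rewrite ltnS => sM; have [k] := ubnP (rank M m); elim: k m s t => // k IHk m s t.
rewrite ltnS => rk Ls Lt p sm tm.
have core a b : LS a -> LS b -> perm_eq (lt a ++ lt b) M -> lt a <' lt b ->
    lexge pgt (lt b) m ->
    LS_span (fun r => perm_eq (lt r) M /\ lt r <' m) (comm (val a) (val b)).
  move=> {s t Ls Lt p sm tm} La Lb p ab bm.
  (* Here (a b) is itself a Lyndon-Shirshov tree, and its Lyndon word is [<'] its suffix b, hence
     [<'] m. *)
  have node : (forall l1 l2, a = BNode l1 l2 -> lexge pgt (lt b) (lt l2)) ->
      LS_span (fun r => perm_eq (lt r) M /\ lt r <' m) (comm (val a) (val b)).
    move=> h; have Lab := LS_node ge_mon La Lb ab h.
    apply: span_mem; exists (BNode a b); split=> //; split=> //.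
    apply: lexge_lexgt_trans bm; exact: ((LS_Lyn ge_mon Lab).2 _ _ (@letters_neq0 _ (bare a)) (@letters_neq0 _ (bare b)) erefl).
  case: a La p ab node => [z|a'|a1 a2] La p ab node; [by apply: node|by apply: node|].
  case: (boolP (lexge pgt (lt b) (lt a2))) => [ba2|nba2].
    by apply: node => l1 l2 [_ <-].
  have a2b : lt a2 <' lt b.
    case/norP: nba2 => ne nlt; case/or3P: (lexgt_total pirr ptot (lt a2) (lt b)) => [/eqP e|//|h].
      by rewrite e eqxx in ne.
    by rewrite h in nlt.
  have [_ La1 La2 _] := La; have {}p : perm_eq (lt a1 ++ lt a2 ++ lt b) M.
    by move: p; rewrite [bare _]/= letters_wcat catA.
  have a1b : lt a1 <' lt b.
    apply: lexgt_trans ab => //; rewrite [bare (BNode _ _)]/= letters_wcat.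
    by apply: lexgt_catr.
  have bb : lexge pgt (lt b) (lt b) by rewrite /lexge eqxx.
  have sz := perm_size p; rewrite !size_cat in sz.
  have gt0 (u : word Z) : (0 < size (letters u))%N by [].
  have IH1 : LS_span (fun r => perm_eq (lt r) (lt a1 ++ lt b) /\ lt r <' lt b)
      (comm (val a1) (val b)).
    apply: IHn => //; last by rewrite /lexge a1b orbT.
    by apply: leq_trans sM; rewrite size_cat -sz ltn_add2l -[X in (X < _)%N]add0n ltn_add2r.
  have IH2 : LS_span (fun r => perm_eq (lt r) (lt a2 ++ lt b) /\ lt r <' lt b)
      (comm (val a2) (val b)).
    apply: IHn => //; last by rewrite /lexge a2b orbT.
    by apply: leq_trans sM; rewrite size_cat -sz -[X in (X < _)%N]add0n ltn_add2r.
  have small x y : LS x -> LS y -> perm_eq (lt x ++ lt y) M -> lt x <' lt b -> lt y <' lt b ->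
      LS_span (fun r => perm_eq (lt r) M /\ lt r <' m) (comm (val x) (val y)).
    move=> Lx Ly pxy xb yb.
    (* The new bound is the [<']-greater of the two words. It is a prefix of a rearrangement of M
       and strictly below m, so the rank drops. *)
    have [m' [h1 h2 h3 h4]] : exists m', [/\ lexge pgt (lt x) m', lexge pgt (lt y) m',
        m' <' m & (rank M m' < rank M m)%N].
      have xm := lexge_lexgt_trans xb bm; have ym := lexge_lexgt_trans yb bm.
      have pyx : perm_eq (lt y ++ lt x) M by rewrite perm_catC.
      case/or3P: (lexgt_total pirr ptot (lt x) (lt y)) => [/eqP e|h|h].
      - by exists (lt y); rewrite /lexge e eqxx; split=> //; apply: rank_lt pyx ym.
      - by exists (lt y); rewrite /lexge h eqxx orbT; split=> //; apply: rank_lt pyx ym.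
      - by exists (lt x); rewrite /lexge h eqxx orbT; split=> //; apply: rank_lt pxy xm.
    have := IHk m' x y (leq_trans h4 rk) Lx Ly pxy h1 h2.
    apply: LS_span_sub => r [pr rm]; split=> //; exact: lexgt_trans rm h3.
  have -> : val (BNode a1 a2) = comm (val a1) (val a2) by [].
  rewrite jacobi; apply: (subspD (LS_span_subsp _)).
    apply: (LS_span_lin (comm_linl (val a2)) (LS_span_subsp _) IH1) => r Lr [pr rb].
    apply: small => //; apply: perm_trans p.
    apply: (@perm_trans _ ((lt a1 ++ lt b) ++ lt a2)); first by rewrite perm_cat2r.
    by rewrite -catA perm_cat2l perm_catC.
  apply: (LS_span_lin (comm_linr (val a1)) (LS_span_subsp _) IH2) => r Lr [pr rb].
  by apply: small => //; apply: perm_trans p; rewrite perm_cat2l.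
case/or3P: (lexgt_total pirr ptot (lt s) (lt t)) => [/eqP/letters_inj e|h|h].
- rewrite (LS_uniq ge_mon Ls Lt e) comm_self; exact: (LS_span_subsp _).1.
- exact: core.
rewrite commC; apply: (subspN (LS_span_subsp _)); apply: core => //.
by rewrite perm_catC.
Qed.

Lemma OLie_LS_span f : OLie f -> LS_span (fun=> True) f.
Proof.
elim=> {f} [z||a f g _ IHf _ IHg|f g _ IHf _ IHg|f _ IHf].
- by apply: span_mem; exists (BGen z).
- exact: (LS_span_subsp _).1.
- exact: (LS_span_subsp _).2.
- apply: (LS_span_lin (comm_linl g) (LS_span_subsp _) IHf) => s Ls _.
  apply: (LS_span_lin (comm_linr (val s)) (LS_span_subsp _) IHg) => t Lt _.
  have [m [h1 h2]] : exists m, lexge pgt (lt s) m /\ lexge pgt (lt t) m.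
    case/or3P: (lexgt_total pirr ptot (lt s) (lt t)) => [/eqP e|h|h].
    - by exists (lt t); rewrite /lexge e eqxx.
    - by exists (lt t); rewrite /lexge h eqxx orbT.
    - by exists (lt s); rewrite /lexge h eqxx orbT.
  by apply: LS_span_sub (comm_LS Ls Lt (perm_refl _) h1 h2).
apply: (LS_span_lin (@abrk_lin F Z) (LS_span_subsp _) IHf) => s Ls _.
by apply: span_mem; exists (BBrk s).
Qed.

Lemma LS_OLie t : OLie (val t).
Proof.
elim: t => [z|t IH|l IHl r IHr]; [exact: OLie_gen | exact: OLie_brk | exact: OLie_comm].
Qed.

Lemma OLie_subsp : subsp (@OLie F Z).
Proof. by split; [exact: OLie_0 | exact: OLie_lin]. Qed.

Lemma OLie_bval (Y : Type) (h : Y -> A) (t : bword Y) : (forall y, OLie (h y)) -> OLie (bval h t).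
Proof.
move=> hh; elim: t => [z|t IH|l IHl r IHr]; [exact: hh | exact: OLie_brk | exact: OLie_comm].
Qed.

End LieBasis.

(** * Associative multiples of relators *)

Section AssociativeIdeal.
Variables (F : fieldType) (Z : choiceType) (ge : rel (word Z)).
Hypotheses (ge_mon : monomial_order ge) (ge_inv : invariant_order ge).
Local Notation A := {malg F[word Z]}.
Local Notation gt := (wgt ge).
Local Notation mlead := (@monic_lead F Z ge).
Implicit Types (u v w : word Z) (f s p x y : A) (S : A -> Prop) (Q : word Z -> Prop).

Lemma wgt_wge_cat (a b c d : word Z) : gt a b -> ge c d -> gt (wcat a c) (wcat b d).
Proof.
move=> ab; rewrite wgeE // => /orP[/eqP->|cd]; first exact: (wgt_catr ge_mon d ab).
exact: (wgt_trans ge_mon (wgt_catr ge_mon c ab) (wgt_catl ge_mon b cd)).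
Qed.

Lemma wge_wgt_cat (a b c d : word Z) : ge a b -> gt c d -> gt (wcat a c) (wcat b d).
Proof.
rewrite wgeE // => /orP[/eqP->|ab] cd; first exact: (wgt_catl ge_mon b cd).
exact: (wgt_trans ge_mon (wgt_catr ge_mon c ab) (wgt_catl ge_mon b cd)).
Qed.

Lemma wge_cat (a b c d : word Z) : ge a b -> ge c d -> ge (wcat a c) (wcat b d).
Proof.
move=> ab; rewrite (wgeE ge_mon c) => /orP[/eqP->|cd]; last first.
  exact/wgt_wge/wge_wgt_cat.
move: ab; rewrite (wgeE ge_mon a) => /orP[/eqP->|ab]; first exact: wge_refl.
exact/wgt_wge/(wgt_catr ge_mon d ab).
Qed.

(** The associative operated ideal filtered by leading words: [Q] bounds the context words g(u),
    strictly, weakly or not at all. *)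
Definition ctx_span S Q : A -> Prop := span_of (fun p => exists s u (g : word Z -> word Z),
  [/\ S s, mlead s u, isctx g, Q (g u) & p = mapw g s]).

Lemma ctx_span_subsp S Q : subsp (ctx_span S Q).
Proof. exact: span_subsp. Qed.

Lemma ctx_span_mem S Q s u (g : word Z -> word Z) :
  S s -> mlead s u -> isctx g -> Q (g u) -> ctx_span S Q (mapw g s).
Proof. by move=> *; apply: span_mem; exists s, u, g; split. Qed.

Lemma ctx_span_sub S S' Q Q' x : (forall s, S s -> S' s) -> (forall w, Q w -> Q' w) ->
  ctx_span S Q x -> ctx_span S' Q' x.
Proof.
move=> hS hQ; apply: span_sub => y [s [u [g [h1 h2 h3 h4 h5]]]].
by exists s, u, g; split; auto.
Qed.

Lemma ctx_span_lin S Q (P : A -> Prop) (L : A -> A) x : islin L -> subsp P -> ctx_span S Q x ->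
  (forall s u (g : word Z -> word Z), S s -> mlead s u -> isctx g -> Q (g u) -> P (L (mapw g s))) ->
  P (L x).
Proof.
move=> hL hP hx h; move: x hx; apply: (span_ind (Q := fun x => P (L x))).
  exact: subsp_preim.
by move=> x [s [u [g [h1 h2 h3 h4 ->]]]]; apply: (h s u).
Qed.

Lemma ctx_span_mapw S (g : word Z -> word Z) w x : isctx g -> ctx_span S (gt w) x ->
  ctx_span S (gt (g w)) (mapw g x).
Proof.
move=> cg hx; apply: (ctx_span_lin (mapw_lin g) (ctx_span_subsp _ _) hx) => s u h h1 h2 h3 h4.
rewrite mapw_comp; apply: (ctx_span_mem h1 h2); first exact: isctx_comp.
exact: (wgt_ctx ge_mon cg h4).
Qed.

Lemma ctx_span_amul_l S (Q1 Q2 Q3 : word Z -> Prop) a x :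
  (forall v, v \in msupp a -> Q1 v) -> ctx_span S Q2 x ->
  (forall v w, Q1 v -> Q2 w -> Q3 (wcat v w)) -> ctx_span S Q3 (amul a x).
Proof.
move=> ha hx h; apply: (malg_ind (P := fun a => ctx_span S Q3 (amul a x))).
  exact: (subsp_preim (amul_linl x) (ctx_span_subsp _ _)).
move=> v /ha hv; rewrite amulUl.
apply: (ctx_span_lin (mapw_lin (wcat v)) (ctx_span_subsp _ _) hx) => s u g h1 h2 h3 h4.
rewrite mapw_comp; apply: (ctx_span_mem h1 h2); first exact: isctx_catl.
exact: h.
Qed.

Lemma ctx_span_amul_r S (Q1 Q2 Q3 : word Z -> Prop) a x :
  (forall v, v \in msupp a -> Q1 v) -> ctx_span S Q2 x ->
  (forall v w, Q1 v -> Q2 w -> Q3 (wcat w v)) -> ctx_span S Q3 (amul x a).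
Proof.
move=> ha hx h; apply: (malg_ind (P := fun a => ctx_span S Q3 (amul x a))).
  exact: (subsp_preim (amul_linr x) (ctx_span_subsp _ _)).
move=> v /ha hv; rewrite amulUr.
apply: (ctx_span_lin (mapw_lin (fun w => wcat w v)) (ctx_span_subsp _ _) hx) => s u g h1 h2 h3 h4.
rewrite mapw_comp; apply: (ctx_span_mem h1 h2); first exact: isctx_catr.
exact: h.
Qed.

Lemma mlead_supp f u : mlead f u -> forall v, v \in msupp f -> ge u v.
Proof. by case/(mleadP ge_mon) => -[]. Qed.

Lemma ctx_span_Low S w x : ctx_span S (gt w) x -> Low ge w x.
Proof.
move: x; apply: (span_ind (Low_subsp F ge w)) => _ [s [u [g [_ h2 h3 h4 ->]]]].
exact: (mlead_Low ge_mon h4 (mlead_ctx ge_mon h3 h2)).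
Qed.

Section Near.
Variables (f : A) (u : word Z).
Hypothesis fu : mlead f u.

(* p is g|_f up to multiples of f with leading word smaller than that of g|_f. *)
Definition near (g : word Z -> word Z) p :=
  isctx g /\ ctx_span (eq f) (gt (g u)) (p - mapw g f).

Lemma near_id : near id f.
Proof. by split; [exact: isctx_id | rewrite mapw_id subrr; case: (ctx_span_subsp (eq f) (gt (id u)))]. Qed.

Lemma near_ext g g' p : g =1 g' -> near g p -> near g' p.
Proof. by move=> e [cg h]; split; [exact: isctx_ext cg | rewrite -(eq_mapw e) -e]. Qed.

Lemma near_Wsp g p : near g p -> ctx_span (eq f) (ge (g u)) p.
Proof.
case=> cg h; rewrite -[p](subrK (mapw g f)); apply: (subspD (ctx_span_subsp _ _)).
  by apply: ctx_span_sub h => // w; apply: wgt_wge.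
by apply: (ctx_span_mem _ fu) => //; apply: wge_refl.
Qed.

Lemma near_brk g p : near g p -> near (fun x : word Z => wprime (Brk (g x))) (abrk p).
Proof.
move=> [cg h]; split; first exact: isctx_brk.
have := ctx_span_mapw (isctx_brk (isctx_id Z)) h.
by rewrite (islinB (mapw_lin _)) -abrkE mapw_comp.
Qed.

(** With gf for g|_f, the error is (p - gf) a + gf (a - v) - a p. The first two terms are lower
    because one factor is, the third because the rotated product is lower. *)
Lemma near_comm_r g p a v : near g p -> mlead a v ->
  gt (wcat (g u) v) (wcat v (g u)) -> near (fun x : word Z => wcat (g x) v) (comm p a).
Proof.
move=> ng av hw; have [cg h] := ng; split; first exact: isctx_catr.
have e : comm p a - mapw (fun x : word Z => wcat (g x) v) f =
    amul (p - mapw g f) a + amul (mapw g f) (a - << v >>) - amul a p.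
  rewrite amulBl amulBr amulUr mapw_comp commE.
  move: (amul p a) (amul a p) (amul (mapw g f) a) (mapw _ f) => b c d e.
  by rewrite addrA subrK addrAC.
rewrite e; apply: (subspB (ctx_span_subsp _ _)); first apply: (subspD (ctx_span_subsp _ _)).
- apply: (ctx_span_amul_r (mlead_supp av) h) => x y hx hy.
  exact: wgt_wge_cat.
- apply: (ctx_span_amul_r av (Q2 := eq (g u))) => [|x y hx <-]; last exact: (wgt_catl ge_mon).
  exact: (ctx_span_mem _ fu).
apply: (ctx_span_amul_l (mlead_supp av) (near_Wsp ng)) => x y hx hy.
exact: (wgt_wge_trans ge_mon hw (wge_cat hx hy)).
Qed.

Lemma near_comm_l g p a v : near g p -> mlead a v ->
  gt (wcat v (g u)) (wcat (g u) v) -> near (fun x : word Z => wcat v (g x)) (comm a p).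
Proof.
move=> ng av hw; have [cg h] := ng; split; first exact: isctx_catl.
have e : comm a p - mapw (fun x : word Z => wcat v (g x)) f =
    amul a (p - mapw g f) + amul (a - << v >>) (mapw g f) - amul p a.
  rewrite amulBl amulBr amulUl mapw_comp commE.
  move: (amul p a) (amul a p) (amul a (mapw g f)) (mapw _ f) => b c d e.
  by rewrite addrA subrK addrAC.
rewrite e; apply: (subspB (ctx_span_subsp _ _)); first apply: (subspD (ctx_span_subsp _ _)).
- apply: (ctx_span_amul_l (mlead_supp av) h) => x y hx hy.
  exact: wge_wgt_cat.
- apply: (ctx_span_amul_l av (Q2 := eq (g u))) => [|x y hx <-]; last exact: (wgt_catr ge_mon).
  exact: (ctx_span_mem _ fu).
apply: (ctx_span_amul_r (mlead_supp av) (near_Wsp ng)) => x y hx hy.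
exact: (wgt_wge_trans ge_mon hw (wge_cat hy hx)).
Qed.

End Near.
End AssociativeIdeal.

(** * Special normal words *)

Section SpecialNormal.
Variables (F : fieldType) (Z : choiceType) (ge : rel (word Z)).
Hypotheses (ge_mon : monomial_order ge) (ge_inv : invariant_order ge).
Local Notation A := {malg F[word Z]}.
Local Notation gt := (wgt ge).
Local Notation mlead := (@monic_lead F Z ge).
Local Notation LS := (nonassoc_LS ge).
Local Notation near := (near ge).
Implicit Types (u v w : word Z) (f s p : A).

Lemma bval_starless (h : option Z -> A) (t : bword Z) :
  (forall z, h (Some z) = agen F z) -> bval h (bstarless t) = bval (@agen F Z) t.
Proof.
move=> e; elim: t => [z|t IH|l IHl r IHr]; first exact: e.
  exact: (congr1 (@abrk F Z) IH).
exact: (congr2 (@comm F Z) IHl IHr).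
Qed.

Lemma bvalN (Y : Type) (h : Y -> A) (l r : bword Y) :
  bval h (BNode l r) = comm (bval h l) (bval h r).
Proof. by []. Qed.

Lemma bareN (Y : Type) (l r : bword Y) : bare (BNode l r) = wcat (bare l) (bare r).
Proof. by []. Qed.

Lemma bval_plug_star f (T P : bword (option Z)) :
  bval (oapp (@agen F Z) f) (bplug_star T P) =
  bval (oapp (@agen F Z) (bval (oapp (@agen F Z) f) P)) T.
Proof.
elim: T => [[z|]|t IH|l IHl r IHr]; [by [] | by [] | exact: (congr1 (@abrk F Z) IH) |].
exact: (congr2 (@comm F Z) IHl IHr).
Qed.

Lemma bval_left_normed f (ts : seq (bword Z)) :
  bval (oapp (@agen F Z) f) (left_normed (BGen None) (map (@bstarless Z) ts)) =
  foldl (fun p t => comm p (bval (@agen F Z) t)) f ts.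
Proof.
elim/last_ind: ts => //= ts t IH.
rewrite map_rcons /left_normed foldl_rcons [bval _ _]/= foldl_rcons -IH.
by rewrite bval_starless.
Qed.

Lemma near_left_normed f u (ts : seq (bword Z)) : mlead f u ->
  (forall t, List.In t ts -> LS t) ->
  (forall ts1 t ts2, ts = ts1 ++ t :: ts2 ->
     gt (wcat (foldl (@wcat Z) u (map (@bare Z) ts1)) (bare t))
        (wcat (bare t) (foldl (@wcat Z) u (map (@bare Z) ts1)))) ->
  near f u (fun x => foldl (@wcat Z) x (map (@bare Z) ts))
    (foldl (fun p t => comm p (bval (@agen F Z) t)) f ts).
Proof.
move=> fu; elim/last_ind: ts => [|ts t IH] hL h; first exact: near_id.
rewrite foldl_rcons.
apply: (@near_ext _ _ _ _ _ (fun x => wcat (foldl (@wcat Z) x (map (@bare Z) ts)) (bare t))).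
  by move=> x; rewrite map_rcons foldl_rcons.
apply: (near_comm_r ge_mon fu).
- apply: IH => [s hs|ts1 s ts2 e]; first by apply: hL; rewrite -cats1; apply/List.in_or_app; left.
  by apply: (h ts1 s (rcons ts2 t)); rewrite e rcons_cat.
- apply: LS_mlead => //; apply: hL; rewrite -cats1; apply/List.in_or_app; right; by left.
by apply: (h ts t [::]); rewrite cats1.
Qed.

(** Climbs from the hole to the root. The value p need not come from a tree: only its leading word
    matters, and it is that of [tuc], whose plugged tree supplies the Lyndon inequality at each
    node. *)
Lemma near_hole f u (T : bword (option Z)) (tuc : bword Z) p (g : word Z -> word Z) :
  mlead f u -> hole1 T -> LS (bplug T tuc) -> bare tuc = g u -> near f u g p ->
  near f u (fun x => plug (bare T) (g x)) (bval (oapp (@agen F Z) p) T).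
Proof.
move=> fu; elim=> {T} [|T _ IH|T t hT IH|T t hT IH] L etuc ng.
- exact: near_ext ng.
- have h := near_brk ge_mon (IH L etuc ng).
  by apply: near_ext h => x; rewrite [bare _]/= /plug wbind_prime lbind_brk.
- have E : bplug (BNode T (bstarless t)) tuc = BNode (bplug T tuc) t.
    by rewrite -[in RHS](bplug_starless t tuc).
  rewrite E in L; have [_ L1 L2 _] := L.
  rewrite bvalN bval_starless; last by [].
  apply: (@near_ext _ _ _ _ _ (fun x => wcat (plug (bare T) (g x)) (bare t))).
    by move=> x; rewrite bareN plug_wcat bare_starless plug_starless.
  apply: (near_comm_r ge_mon fu (IH L1 etuc ng)); first exact: LS_mlead.
  rewrite -etuc -bare_plug; apply: (wgt_swap ge_mon ge_inv).
  exact: (LS_Lyn ge_mon L).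
have E : bplug (BNode (bstarless t) T) tuc = BNode t (bplug T tuc).
  by rewrite -[in RHS](bplug_starless t tuc).
rewrite E in L; have [_ L1 L2 _] := L.
rewrite bvalN bval_starless; last by [].
apply: (@near_ext _ _ _ _ _ (fun x => wcat (bare t) (plug (bare T) (g x)))).
  by move=> x; rewrite bareN plug_wcat bare_starless plug_starless.
apply: (near_comm_l ge_mon fu (IH L2 etuc ng)); first exact: LS_mlead.
rewrite -etuc -bare_plug; apply: (wgt_swap ge_mon ge_inv).
exact: (LS_Lyn ge_mon L).
Qed.

Lemma near_special f u q T : mlead f u -> special_bracketing ge q u T ->
  near f u (plug q) (bval (oapp (@agen F Z) f) T).
Proof.
move=> fu [sq Au Aqu [q' [T0 [tuc [cs [ts [[sq' eq eT0 Luc Lqu] [so hts eT]]]]]]]].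
have ecs : cs = map (@bare Z) ts.
  by elim: hts => //= c t cs0 ts0 [_ <- _] _ ->.
have hLS t : List.In t ts -> LS t.
  move=> {Lqu Luc so eT eq ecs}; elim: hts => //= c t0 cs0 ts0 [_ _ h] _ IH [<-//|]; exact: IH.
have [Auc euc Luc'] := Luc; have [_ equ Lqu'] := Lqu.
rewrite eT bval_plug_star bval_left_normed.
have pirr := @pgt_irr Z ge; have ptr := pgt_trans ge_mon.
have LynL w : ALSBW ge w -> Lyn (pgt ge) (letters w) by case/(ALSBW_iff ge_mon).
have Lu := LynL _ Au.
(* The left-normed bracket is not a Lyndon-Shirshov tree in general; [Lyn_prefixes] makes each
   partial product Lyndon and below the next factor, so [Lyn_cat] and [wgt_swap] apply. *)
have hswap ts1 t ts2 : ts = ts1 ++ t :: ts2 ->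
     gt (wcat (foldl (@wcat Z) u (map (@bare Z) ts1)) (bare t))
        (wcat (bare t) (foldl (@wcat Z) u (map (@bare Z) ts1))).
  move=> ets.
  have hcs : {in map (@letters Z) cs, forall c, Lyn (pgt ge) c}.
    move=> c /mapP[c0 hc0 ->]; move: hc0; rewrite ecs => hc0.
    have : exists2 t0, List.In t0 ts & c0 = bare t0.
      elim: (ts) hc0 => //= t0 ts0 IH; rewrite inE => /orP[/eqP->|/IH[t1 h1 ->]].
        by exists t0; [left|].
      by exists t1; [right|].
    by case=> t0 /hLS h0 ->; apply: LS_Lyn.
  have so' : sorted (fun a b => (a == b) || lexgt (pgt ge) b a) (map (@letters Z) cs).
    by rewrite sorted_map; apply: sub_sorted so => a b; rewrite /lexge /relpre /= eq_sym.
  have Luc2 : Lyn (pgt ge) (letters u ++ flatten (map (@letters Z) cs)).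
    by rewrite -letters_foldl; apply: LynL.
  have e : map (@letters Z) cs = map (@letters Z) (map (@bare Z) ts1) ++
      letters (bare t) :: map (@letters Z) (map (@bare Z) ts2).
    by rewrite ecs ets !map_cat.
  have [L1 lt] := Lyn_prefixes pirr ptr Lu hcs so' Luc2 e.
  rewrite -letters_foldl in L1 lt.
  apply: (wgt_swap ge_mon ge_inv); rewrite letters_wcat; apply: Lyn_cat => //.
  by apply: LS_Lyn => //; apply: hLS; rewrite ets; apply/List.in_or_app; right; left.
have n1 := near_left_normed fu hLS hswap.
have hT0 : hole1 T0 by apply: star_tree; rewrite eT0.
have n2 := near_hole fu hT0 Lqu' _ n1.
apply: near_ext (n2 _) => [x|]; last by rewrite euc -ecs.
rewrite eT0 eq plug_star_plug -ecs; congr (plug q' _).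
rewrite /plug wbind_foldl -map_comp; congr (foldl _ _ _).
by rewrite -[LHS]map_id; apply: eq_map => c /=; rewrite -[LHS](plug_starless c x).
Qed.

Lemma special_mlead f u v q p : mlead f v -> special_normal ge q f u p ->
  [/\ v = u, mlead p (plug q u), star_word q, ALSBW ge (plug q u) &
      ctx_span ge (eq f) (gt (plug q u)) (p - mapw (plug q) f)].
Proof.
move=> fv [lf [T [sT ->]]]; have e := mlead_uniq ge_mon fv lf; subst v.
have [cg h] := near_special fv sT; have [sq _ Aqu _] := sT.
have h1 : mlead (bval (oapp (@agen F Z) f) T) (plug q u).
  rewrite /monic_lead; move: (bval _ T) h => x h.
  rewrite -[x](subrK (mapw (plug q) f)) -addrA.
  apply: (subspD (Low_subsp F ge (plug q u))); first exact: (ctx_span_Low ge_mon h).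
  exact: (mlead_ctx ge_mon cg fv).
by split; [by [] | exact: h1 | exact: sq | exact: Aqu | exact: h].
Qed.

End SpecialNormal.

(** * The associative composition-diamond lemma *)

Section CompositionDiamond.
Variables (F : fieldType) (Z : choiceType) (ge : rel (word Z)).
Hypotheses (ge_mon : monomial_order ge).
Local Notation A := {malg F[word Z]}.
Local Notation gt := (wgt ge).
Local Notation mlead := (@monic_lead F Z ge).
Local Notation ctx_span := (ctx_span ge).
Implicit Types (u v w : word Z) (f s p h : A).

Lemma mapwB_comp (g g1 g2 h1 h2 : word Z -> word Z) s1 s2 :
  (fun v => g (g1 v)) =1 h1 -> (fun v => g (g2 v)) =1 h2 ->
  mapw h1 s1 - mapw h2 s2 = mapw g (mapw g1 s1 - mapw g2 s2).
Proof.
move=> e1 e2; apply: etrans (esym (islinB (mapw_lin g) (mapw g1 s1) (mapw g2 s2))).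
have c1 := etrans (mapw_comp g g1 s1) (eq_mapw e1 s1).
have c2 := etrans (mapw_comp g g2 s2) (eq_mapw e2 s2).
exact: (esym (congr2 (fun a b : A => a - b) c1 c2)).
Qed.

Variable S : A -> Prop.

(** Words are nonempty by construction, so [x], [y], [z] already encode the breadth bounds of an
    intersection. *)
Definition assoc_GS : Prop :=
  (forall s1 s2 (x y z : word Z), S s1 -> S s2 ->
     mlead s1 (wcat x y) -> mlead s2 (wcat y z) ->
     ctx_span S (gt (wcat x (wcat y z))) (mapw (fun w => wcat w z) s1 - mapw (wcat x) s2)) /\
  (forall s1 s2 u1 u2 (g : word Z -> word Z), S s1 -> S s2 ->
     mlead s1 u1 -> mlead s2 u2 -> isctx g -> u1 = g u2 ->
     ctx_span S (gt u1) (s1 - mapw g s2)).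

Hypothesis GS : assoc_GS.

(** For the bilinear extension D of d, D(s1, u2) - D(u1, s2) = D(s1 - u1, s2) - D(s1, s2 - u2), and
    both terms on the right are lower. No composition is involved. *)
Lemma ctx_span_disjoint s1 s2 u1 u2 (d : word Z -> word Z -> word Z) :
  S s1 -> S s2 -> mlead s1 u1 -> mlead s2 u2 ->
  (forall v, isctx (fun x => d x v)) -> (forall v, isctx (d v)) ->
  ctx_span S (gt (d u1 u2)) (mapw (fun x => d x u2) s1 - mapw (d u1) s2).
Proof.
move=> S1 S2 l1 l2 c1 c2.
pose D f1 f2 := mlin (fun v1 => mapw (d v1) f2) f1.
have Dl f2 : islin (fun f1 => D f1 f2) by exact: mlin_lin.
have Dr f1 : islin (D f1).
  move=> a x y; rewrite /D.
  transitivity (mlin (fun v1 => a *: mapw (d v1) x + mapw (d v1) y) f1).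
    by apply: eq_mlin => v; apply: mapw_lin.
  exact: mlin_fun_lin.
have DUl v f2 : D << v >> f2 = mapw (d v) f2 by exact: mlinU.
have DUr f1 v : D f1 << v >> = mapw (fun x => d x v) f1.
  by rewrite mapwE; apply: eq_mlin => x; apply: mapwU.
have h1 : ctx_span S (gt (d u1 u2)) (D s1 (s2 - << u2 >>)).
  apply: (Low_ind (P := fun f => ctx_span S (gt (d u1 u2)) (D s1 f)) _ l2) => [|v uv].
    exact: (subsp_preim (Dr s1) (ctx_span_subsp ge _ _)).
  by rewrite DUr; apply: (ctx_span_mem S1 l1) => //; apply: (wgt_ctx ge_mon (c2 u1)).
have h2 : ctx_span S (gt (d u1 u2)) (D (s1 - << u1 >>) s2).
  apply: (Low_ind (P := fun f => ctx_span S (gt (d u1 u2)) (D f s2)) _ l1) => [|v uv].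
    exact: (subsp_preim (Dl s2) (ctx_span_subsp ge _ _)).
  by rewrite DUl; apply: (ctx_span_mem S2 l2) => //; apply: (wgt_ctx ge_mon (c1 u2)).
have e : mapw (fun x => d x u2) s1 - mapw (d u1) s2 =
    D (s1 - << u1 >>) s2 - D s1 (s2 - << u2 >>).
  rewrite (islinB (Dl s2)) (islinB (Dr s1)) DUl DUr.
  move: (D s1 s2) (mapw _ s1) (mapw _ s2) => a b c.
  by rewrite opprB [RHS]addrC addrA subrK.
rewrite e; exact: (subspB (ctx_span_subsp ge _ _) h2 h1).
Qed.

Lemma ctx_span_disjoint_put s1 s2 u1 u2 l t r (a b g1 g2 : word Z -> word Z) :
  S s1 -> S s2 -> mlead s1 u1 -> mlead s2 u2 -> isctx a -> isctx b ->
  (forall v, letters (g1 v) = l ++ letters (a v) ++ t ++ letters (b u2) ++ r) ->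
  (forall v, letters (g2 v) = l ++ letters (a u1) ++ t ++ letters (b v) ++ r) ->
  ctx_span S (gt (g1 u1)) (mapw g1 s1 - mapw g2 s2).
Proof.
move=> S1 S2 l1 l2 ca cb e1 e2.
pose d v1 v2 := wput l (a v1) (t ++ letters (b v2) ++ r).
have d1 : (fun x => d x u2) =1 g1 by move=> v; apply: letters_inj; rewrite letters_wput e1.
have d2 : d u1 =1 g2 by move=> v; apply: letters_inj; rewrite letters_wput e2.
rewrite -(eq_mapw d1) -(eq_mapw d2) -d1; apply: ctx_span_disjoint => // v.
  exact: isctx_put.
apply: (isctx_ext _ (isctx_put (l ++ letters (a v) ++ t) r cb)) => x.
by apply: letters_inj; rewrite !letters_wput -!catA.
Qed.

Lemma ctx_span_including s1 s2 u1 u2 (g h g1 g2 : word Z -> word Z) :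
  S s1 -> S s2 -> mlead s1 u1 -> mlead s2 u2 -> isctx g -> isctx h -> u1 = g u2 ->
  g1 =1 h -> (forall v, g2 v = h (g v)) ->
  ctx_span S (gt (g1 u1)) (mapw g1 s1 - mapw g2 s2).
Proof.
move=> S1 S2 l1 l2 cg ch e e1 e2.
have E := @mapwB_comp h id g g1 g2 s1 s2 (fun v => esym (e1 v)) (fun v => esym (e2 v)).
rewrite mapw_id in E; rewrite E e1; apply: (ctx_span_mapw ge_mon ch); exact: GS.2 e.
Qed.

Lemma ctx_span_flip s1 s2 w (g1 g2 : word Z -> word Z) :
  ctx_span S (gt w) (mapw g2 s2 - mapw g1 s1) -> ctx_span S (gt w) (mapw g1 s1 - mapw g2 s2).
Proof. by move/(subspN (ctx_span_subsp ge _ _)); rewrite opprB. Qed.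

(** Two occurrences at the same bracket level, the second starting z letters after the first. Empty
    pieces are sorted out first (adjacent, same start, same end), so that a genuine overlap with
    three nonempty parts remains. *)
Lemma ctx_span_leaf s1 s2 u1 u2 l z r1 r2 :
  S s1 -> S s2 -> mlead s1 u1 -> mlead s2 u2 ->
  letters u1 ++ r1 = z ++ letters u2 ++ r2 ->
  ctx_span S (gt (fill (Leaf l r1) u1))
    (mapw (fill (Leaf l r1)) s1 - mapw (fill (Leaf (l ++ z) r2)) s2).
Proof.
move=> S1 S2 l1 l2 e.
have ew : fill (Leaf l r1) u1 = fill (Leaf (l ++ z) r2) u2.
  by apply: letters_inj; rewrite !letters_wput e catA.
case: (cat_eq_cat e) => [[t [e1 e2]]|[t [t0 [ez er]]]]; last first.
  apply: (ctx_span_disjoint_put (l := l) (t := t) (r := r2) S1 S2 l1 l2 (isctx_id Z) (isctx_id Z)) => v.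
    by rewrite letters_wput er.
  by rewrite letters_wput ez -!catA.
case: (cat_eq_cat e2) => [[t' [e3 e4]]|[t' [t0 [et er]]]]; last first.
  apply: (ctx_span_including S1 S2 l1 l2 (isctx_put z t' (isctx_id Z))
    (isctx_fill (Leaf l r1))) => [|//|v].
  - by apply: letters_inj; rewrite e1 et letters_wput.
  by apply: letters_inj; rewrite !letters_wput er -!catA.
case: (t =P [::]) => [t0|t0].
  rewrite t0 cats0 in e1; rewrite t0 in e3.
  apply: (ctx_span_disjoint_put (l := l) (t := [::]) (r := r2) S1 S2 l1 l2 (isctx_id Z) (isctx_id Z)) => v.
    by rewrite letters_wput e4 e3.
  by rewrite letters_wput -e1 -!catA.
case: (z =P [::]) => [z0|z0].
  rewrite z0 in e1 ew *; rewrite ew cats0; apply: ctx_span_flip.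
  apply: (ctx_span_including S2 S1 l2 l1 (isctx_put [::] t' (isctx_id Z))
    (isctx_fill (Leaf l r2))) => [|//|v].
  - by apply: letters_inj; rewrite e3 letters_wput e1.
  by apply: letters_inj; rewrite !letters_wput e4 -!catA.
case: (t' =P [::]) => [t0'|t0'].
  rewrite t0' cats0 in e3; rewrite t0' in e4.
  apply: (ctx_span_including S1 S2 l1 l2 (isctx_put z [::] (isctx_id Z))
    (isctx_fill (Leaf l r1))) => [|//|v].
  - by apply: letters_inj; rewrite letters_wput e1 e3 cats0.
  by apply: letters_inj; rewrite !letters_wput e4 cats0 -!catA.
have [x ex] := wordP z0; have [y ey] := wordP t0; have [y' ey'] := wordP t0'.
have eu1 : u1 = wcat x y by apply: letters_inj; rewrite e1 ex ey.
have eu2 : u2 = wcat y y' by apply: letters_inj; rewrite e3 ey ey'.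
rewrite eu1 in l1; rewrite eu2 in l2.
have h := ctx_span_mapw ge_mon (isctx_fill (Leaf l r2)) (GS.1 _ _ _ _ _ S1 S2 l1 l2).
have ef1 : (fun v => fill (Leaf l r2) (wcat v y')) =1 fill (Leaf l r1).
  by move=> v; apply: letters_inj; rewrite !letters_wput letters_wcat e4 ey' -!catA.
have ef2 : (fun v => fill (Leaf l r2) (wcat x v)) =1 fill (Leaf (l ++ z) r2).
  by move=> v; apply: letters_inj; rewrite !letters_wput letters_wcat ex -!catA.
rewrite (mapwB_comp s1 s2 ef1 ef2).
by rewrite -(ef1 u1) eu1 -wcatA.
Qed.

(** The second occurrence sits inside a bracket, which is a single letter: that letter is inside the
    first occurrence or outside it, never cut by it. *)
Lemma ctx_span_leaf_deep s1 s2 u1 u2 l1 r1 l2 c2 r2 :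
  S s1 -> S s2 -> mlead s1 u1 -> mlead s2 u2 ->
  letters (fill (Leaf l1 r1) u1) = letters (fill (Deep l2 c2 r2) u2) ->
  ctx_span S (gt (fill (Leaf l1 r1) u1))
    (mapw (fill (Leaf l1 r1)) s1 - mapw (fill (Deep l2 c2 r2)) s2).
Proof.
move=> S1 S2 m1 m2 e; have ew := letters_inj e.
pose b v := wprime (Brk (fill c2 v)).
have cb : isctx b by apply/isctx_brk/isctx_fill.
have eb v : letters (fill (Deep l2 c2 r2) v) = l2 ++ letters (b v) ++ r2 by rewrite letters_wput.
have el v : letters (fill (Leaf l1 r1) v) = l1 ++ letters v ++ r1 by rewrite letters_wput.
have incl t t' : letters u1 = t ++ letters (b u2) ++ t' -> l2 = l1 ++ t -> r2 = t' ++ r1 ->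
    ctx_span S (gt (fill (Leaf l1 r1) u1))
    (mapw (fill (Leaf l1 r1)) s1 - mapw (fill (Deep l2 c2 r2)) s2).
  move=> h1 h2 h3.
  apply: (ctx_span_including S1 S2 m1 m2 (isctx_put t t' cb) (isctx_fill (Leaf l1 r1))) => [|//|v].
  - by apply: letters_inj; rewrite letters_wput.
  by apply: letters_inj; rewrite eb el letters_wput h2 h3 -!catA.
rewrite eb el in e; case: (cat_eq_cat e) => [[z [e1 e2]]|[z [z0 [e1 e2]]]].
  case: z e1 e2 => [|a z] e1 e2; last first.
    case: e2 => ea er; rewrite ew; apply: ctx_span_flip.
    apply: (ctx_span_disjoint_put (l := l2) (t := z) (r := r1) S2 S1 m2 m1 (cb) (isctx_id Z)) => v.
      by rewrite eb er.
    by rewrite el e1 -ea -!catA.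
  case E: (letters u1) e2 => [|a x] //= [ea er].
  apply: (incl [::] x) => //; first by rewrite E -ea.
  by rewrite e1 !cats0.
case: (cat_eq_cat e2) => [[t [h1 h2]]|[t [t0 [h1 h2]]]]; last first.
  apply: (ctx_span_disjoint_put (l := l1) (t := t) (r := r2) S1 S2 m1 m2 (isctx_id Z) (cb)) => v.
    by rewrite el h2.
  by rewrite eb e1 h1 -!catA.
case: t h1 h2 => [|a t] h1 h2.
  rewrite cats0 in h1.
  apply: (ctx_span_disjoint_put (l := l1) (t := [::]) (r := r2) S1 S2 m1 m2 (isctx_id Z) (cb)) => v.
    by rewrite el -[r1]h2.
  by rewrite eb e1 h1 -!catA.
by case: h2 => ea er; apply: (incl z t) => //; rewrite h1 -ea.
Qed.

(** The two paths are followed while they enter the same bracket letter. Once they part, the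
    occurrences are disjoint or one of the leaf cases applies. *)
Lemma ctx_span_confluence s1 s2 u1 u2 c1 c2 :
  S s1 -> S s2 -> mlead s1 u1 -> mlead s2 u2 -> fill c1 u1 = fill c2 u2 ->
  ctx_span S (gt (fill c1 u1)) (mapw (fill c1) s1 - mapw (fill c2) s2).
Proof.
move=> S1 S2 m1 m2; elim: c1 c2 => [l1 r1|l1 c1 IH r1] [l2 r2|l2 c2 r2] ew;
  have e := congr1 (@letters Z) ew.
- rewrite !letters_wput in e.
  case: (cat_eq_cat e) => [[z [e1 e2]]|[z [z0 [e1 e2]]]].
    rewrite ew e1; apply: ctx_span_flip; exact: (ctx_span_leaf _ S2 S1 m2 m1).
  by rewrite e1; apply: (ctx_span_leaf _ S1 S2 m1 m2).
- exact: (ctx_span_leaf_deep S1 S2 m1 m2 e).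
- rewrite ew; apply: ctx_span_flip; exact: (ctx_span_leaf_deep S2 S1 m2 m1 (esym e)).
pose b1 v := wprime (Brk (fill c1 v)); pose b2 v := wprime (Brk (fill c2 v)).
have cb1 : isctx b1 by apply/isctx_brk/isctx_fill.
have cb2 : isctx b2 by apply/isctx_brk/isctx_fill.
have eb1 v : letters (fill (Deep l1 c1 r1) v) = l1 ++ letters (b1 v) ++ r1 by rewrite letters_wput.
have eb2 v : letters (fill (Deep l2 c2 r2) v) = l2 ++ letters (b2 v) ++ r2 by rewrite letters_wput.
rewrite eb1 eb2 in e; case: (cat_eq_cat e) => [[[|a z] [e1 e2]]|[[|a z] [z0 [e1 e2]]]] //.
- rewrite cats0 in e1; case: e2 => efill er.
  have h := ctx_span_mapw ge_mon (isctx_put l1 r1 (isctx_brk (isctx_id Z))) (IH c2 (esym efill)).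
  have ef2 : (fun v => wput l1 (wprime (Brk (fill c2 v))) r1) =1 fill (Deep l2 c2 r2).
    by move=> v; rewrite e1 -er.
  have ef1 : (fun v => wput l1 (wprime (Brk (fill c1 v))) r1) =1 fill (Deep l1 c1 r1) by [].
  rewrite (mapwB_comp (g := fun v => wput l1 (wprime (Brk v)) r1) s1 s2 ef1 ef2).
  exact: h.
- case: e2 => ea er; rewrite ew; apply: ctx_span_flip.
  apply: (ctx_span_disjoint_put (l := l2) (t := z) (r := r1) S2 S1 m2 m1 (cb2) (cb1)) => v.
    by rewrite eb2 er.
  by rewrite eb1 e1 -ea -!catA.
case: e2 => ea er.
apply: (ctx_span_disjoint_put (l := l1) (t := z) (r := r2) S1 S2 m1 m2 (cb1) (cb2)) => v.
  by rewrite eb1 er.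
by rewrite eb2 e1 -ea -!catA.
Qed.

(** A finite combination has a greatest context word, which starts the well-founded induction and
    bounds each remainder. *)
Lemma ctx_span_bound (Q : word Z -> Prop) h :
  ctx_span S Q h -> h = 0 \/ exists2 w, Q w & ctx_span S (ge w) h.
Proof.
apply: (span_ind (Q := fun h => h = 0 \/ exists2 w, Q w & ctx_span S (ge w) h)); last first.
  move=> _ [s [u [g [h1 h2 h3 h4 ->]]]]; right; exists (g u) => //.
  by apply: (ctx_span_mem h1 h2) => //; apply: wge_refl.
split; first by left.
have [[_ _ tr tot] _ _] := ge_mon.
move=> a f g [->|[w qw hf]].
  by case=> [->|[w qw hg]]; [left; rewrite scaler0 addr0 | right; exists w; rewrite // scaler0 add0r].
case=> [->|[w' qw' hg]].
  by right; exists w => //; rewrite addr0; apply: (subspZ _ (ctx_span_subsp ge _ _) hf).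
right; case/orP: (tot w w') => le.
  exists w => //; apply: (ctx_span_subsp ge _ _).2 => //.
  by apply: ctx_span_sub hg => // v; apply: tr.
exists w' => //; apply: (ctx_span_subsp ge _ _).2 => //.
by apply: ctx_span_sub hf => // v; apply: tr.
Qed.

Lemma is_lead_top x w (a : F) y : mlead x w -> Low ge w y -> a != 0 ->
  is_lead ge (a *: x + y) w.
Proof.
move=> /(mleadP ge_mon)[[_ hx] cx] hy a0; split.
  rewrite -mcoeff_neq0 mcoeffD mcoeffZ cx mulr1 (mcoeff_outdom (g := y)) ?addr0 //.
  by apply/negP => /hy; rewrite wgt_irr.
move=> v /(fsubsetP (msuppD_le _ _)); rewrite in_fsetU => /orP[|/hy]; last exact: wgt_wge.
by move/(fsubsetP (msuppZ_le _ _))/hx.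
Qed.

Theorem composition_diamond h : ctx_span S (fun=> True) h -> h <> 0 ->
  exists s u (g : word Z -> word Z), [/\ S s, mlead s u, isctx g & is_lead ge h (g u)].
Proof.
move=> /ctx_span_bound[//|[w _]]; elim/(well_founded_ind (wgt_wf ge_mon)): w h => w IH h hw h0.
pose gen x := exists s u (g : word Z -> word Z),
  [/\ S s, mlead s u, isctx g, g u = w & x = mapw g s].
have conc x : ctx_span S (gt w) x -> x <> 0 ->
    exists s u (g : word Z -> word Z), [/\ S s, mlead s u, isctx g & is_lead ge x (g u)].
  by move=> /ctx_span_bound[//|[w' ww' hx]] x0; apply: (IH w').
(* The second alternative does not mention h, so the disjunction survives linear combinations. *)
have : ctx_span S (gt w) h \/ exists x0, gen x0.
  move: h hw {h0}; apply: (span_ind (Q := fun h => ctx_span S (gt w) h \/ exists x0, gen x0)).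
    split; first by left; case: (ctx_span_subsp ge S (gt w)).
    move=> a f g [hf|]; last by right.
    case=> [hg|]; last by right.
    by left; apply: (ctx_span_subsp ge _ _).2.
  move=> _ [s [u [g [h1 h2 h3 h4 ->]]]].
  move: h4; rewrite wgeE // => /orP[/eqP e|lt].
    by right; exists (mapw g s), s, u, g.
  by left; apply: (ctx_span_mem h1 h2).
case=> [hh|[x0 [s0 [u0 [g0 [S0 m0 cg0 e0 ex0]]]]]]; first exact: conc.
(* Two generators with context word w agree modulo lower ones, so those in h collapse to a multiple
   of x0. If b vanishes the induction continues below w; otherwise w leads h. *)
have [b hb] : exists b : F, ctx_span S (gt w) (h - b *: x0).
  move: h hw {h0}; apply: (span_ind (Q := fun h => exists b : F, ctx_span S (gt w) (h - b *: x0))).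
    split; first by exists 0; rewrite scale0r subr0; case: (ctx_span_subsp ge S (gt w)).
    move=> a f g [b hf] [c hg]; exists (a * b + c).
    have -> : a *: f + g - (a * b + c) *: x0 = a *: (f - b *: x0) + (g - c *: x0).
      by rewrite scalerDl scalerBr scalerA opprD addrACA.
    exact: ((ctx_span_subsp ge S (gt w)).2 a _ _ hf hg).
  move=> _ [s [u [g [h1 h2 h3 h4 ->]]]].
  move: h4; rewrite wgeE // => /orP[/eqP e|lt].
    exists 1; rewrite scale1r ex0; case: (h3) (cg0) => c ec [c0 ec0].
    have hc : fill c u = fill c0 u0 by rewrite -ec -ec0 -e e0.
    rewrite (eq_mapw ec s) (eq_mapw ec0 s0) e ec.
    exact: (ctx_span_confluence h1 S0 h2 m0 hc).
  by exists 0; rewrite scale0r subr0; apply: (ctx_span_mem h1 h2).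
case: (b =P 0) => [b0|/eqP b0].
  by apply: conc => //; rewrite b0 scale0r subr0 in hb.
exists s0, u0, g0; split=> //; rewrite e0 -[h](subrK (b *: x0)) addrC.
apply: is_lead_top b0; last exact: ctx_span_Low hb.
by rewrite ex0 -e0; apply: mlead_ctx.
Qed.

End CompositionDiamond.

(** * Coordinates in the Lyndon-Shirshov basis *)

Section Coordinates.
Variables (F : fieldType) (Z : choiceType) (ge : rel (word Z)).
Hypotheses (ge_mon : monomial_order ge) (ge_inv : invariant_order ge).
Local Notation A := {malg F[word Z]}.
Local Notation gt := (wgt ge).
Local Notation mlead := (@monic_lead F Z ge).
Local Notation val := (bval (@agen F Z)).
Implicit Types (u v w : word Z) (f g p : A).

(* Outside ALSBW(Z) the word itself is used, so that these elements form a
   unitriangular basis of the whole algebra. *)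
Lemma basis_word w : exists x : A, (ALSBW ge w -> is_LS_elt ge w x) /\ mlead x w.
Proof.
case: (classic (ALSBW ge w)) => [h|h].
  case: (LS_exists ge_mon h) => t Lt et; exists (val t); split; last first.
    by rewrite -et; apply: LS_mlead.
  by move=> _; exists t.
exists << w >>; split=> //; rewrite /monic_lead subrr => v.
by rewrite msupp0.
Qed.

Definition LS_basis w : A := proj1_sig (constructive_indefinite_description _ (basis_word w)).

Lemma LS_basis_LS w : ALSBW ge w -> is_LS_elt ge w (LS_basis w).
Proof. exact: (proj2_sig (constructive_indefinite_description _ (basis_word w))).1. Qed.

Lemma LS_basis_mlead w : mlead (LS_basis w) w.
Proof. exact: (proj2_sig (constructive_indefinite_description _ (basis_word w))).2. Qed.

Lemma LS_basis_uniq w x : is_LS_elt ge w x -> ALSBW ge w /\ x = LS_basis w.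
Proof.
case=> t [[Aw et Lt] ->]; split=> //.
have [t' [[_ et' Lt'] ->]] := LS_basis_LS Aw.
by rewrite (LS_uniq ge_mon Lt Lt') // et.
Qed.

(** The unitriangular change of basis. It preserves leading words and their coefficients, which
    gives injectivity; surjectivity follows by stripping leading terms. *)
Definition expand (g : A) : A := mlin LS_basis g.

Lemma expand_lin : islin expand. Proof. exact: mlin_lin. Qed.
Lemma expandU w : expand << w >> = LS_basis w. Proof. exact: mlinU. Qed.

Lemma expand_Low w g : Low ge w g -> Low ge w (expand g).
Proof.
move=> h; apply: (Low_ind (P := fun g => Low ge w (expand g)) _ h) => [|v wv].
  exact: (subsp_preim expand_lin (Low_subsp F ge w)).
by rewrite expandU; apply: (mlead_Low ge_mon wv (@LS_basis_mlead v)).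
Qed.

Lemma is_lead_Low f u : is_lead ge f u -> Low ge u (f - f@_u *: << u >>).
Proof.
move=> [uf h] v hv; have ne : u != v.
  apply: contraTneq hv => <-.
  by rewrite -mcoeff_eq0 mcoeffB mcoeffZ mcoeffUU mulr1 subrr.
rewrite /wgt ne andbT; apply: h; move: hv.
by rewrite -!mcoeff_neq0 mcoeffB mcoeffZ mcoeffU (negbTE ne) mulr0n mulr0 subr0.
Qed.

Lemma expand_lead g u : is_lead ge g u ->
  is_lead ge (expand g) u /\ (expand g)@_u = g@_u.
Proof.
move=> lg; have gu : g@_u != 0 by rewrite mcoeff_neq0; case: lg.
have lo := expand_Low (is_lead_Low lg).
have e : expand g = g@_u *: LS_basis u + expand (g - g@_u *: << u >>).
  by rewrite -expandU -expand_lin addrC subrK.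
split; first by rewrite e; apply: is_lead_top gu => //; exact: LS_basis_mlead.
rewrite e mcoeffD mcoeffZ.
have /(mleadP ge_mon)[_ ->] := @LS_basis_mlead u.
rewrite mulr1 [X in _ + X]mcoeff_outdom ?addr0 //.
by apply/negP => /lo; rewrite wgt_irr.
Qed.

Lemma expand_inj g : expand g = 0 -> g = 0.
Proof.
move=> e; case: (g =P 0) => // /eqP/(lead_exists ge_mon)[u lg].
have [_] := expand_lead lg; rewrite e mcoeff0 => /esym/eqP.
by rewrite mcoeff_eq0 => /negP; case; case: lg.
Qed.

Lemma lead_ind (P : A -> Prop) : P 0 ->
  (forall f u, is_lead ge f u -> (forall g, Low ge u g -> P g) -> P f) -> forall f, P f.
Proof.
move=> P0 h f; case: (f =P 0) => [->//|/eqP/(lead_exists ge_mon)[u]].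
elim/(well_founded_ind (wgt_wf ge_mon)): u f => u IH f lf.
apply: (h f u lf) => g lg; case: (g =P 0) => [->//|/eqP/(lead_exists ge_mon)[v lv]].
have uv : gt u v by apply: lg; case: lv.
exact: (IH v uv g lv).
Qed.

Lemma expand_surj f : exists g, expand g = f.
Proof.
elim/lead_ind: f => [|f u lf IH]; first by exists 0; rewrite (islin0 expand_lin).
case: (IH (f - f@_u *: LS_basis u)) => [|g eg].
  have e : f - f@_u *: LS_basis u = f - f@_u *: << u >> - f@_u *: (LS_basis u - << u >>).
    by rewrite scalerBr opprB addrA subrK.
  rewrite e; apply: (subspB (Low_subsp F ge u)); first exact: is_lead_Low.
  by apply: (subspZ _ (Low_subsp F ge u)); apply: LS_basis_mlead.
exists (g + f@_u *: << u >>).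
by rewrite (islinD expand_lin) (islinZ expand_lin) expandU eg subrK.
Qed.

Definition coords f : A := proj1_sig (constructive_indefinite_description _ (expand_surj f)).

Lemma coordsK f : expand (coords f) = f.
Proof. exact: (proj2_sig (constructive_indefinite_description _ (expand_surj f))). Qed.

Lemma expandK g : coords (expand g) = g.
Proof.
apply/eqP; rewrite -subr_eq0; apply/eqP/expand_inj.
by rewrite (islinB expand_lin) coordsK subrr.
Qed.

Lemma coords_lin : islin coords.
Proof.
move=> a f g; have e := expand_lin a (coords f) (coords g).
rewrite (coordsK f) (coordsK g) in e.
by apply: etrans (expandK _); congr coords; apply: esym.
Qed.

(** Being defined on the whole algebra, these coordinates are linear without side conditions; on Lie
    elements [OLie_coef] makes them the coordinates in [NLSBW]. *)
Definition coef f w : F := (coords f)@_w.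

Lemma coef_lin a f g w : coef (a *: f + g) w = a * coef f w + coef g w.
Proof. by rewrite /coef coords_lin mcoeffD mcoeffZ. Qed.

Lemma coef0 w : coef 0 w = 0.
Proof. by rewrite /coef (islin0 coords_lin) mcoeff0. Qed.

Lemma coefD f g w : coef (f + g) w = coef f w + coef g w.
Proof. by rewrite /coef (islinD coords_lin) mcoeffD. Qed.

Lemma coefB f g w : coef (f - g) w = coef f w - coef g w.
Proof. by rewrite /coef (islinB coords_lin) mcoeffB. Qed.

Lemma coefZ a f w : coef (a *: f) w = a * coef f w.
Proof. by rewrite /coef (islinZ coords_lin) mcoeffZ. Qed.

Lemma coef_LS_basis v w : coef (LS_basis v) w = (v == w)%:R.
Proof. by rewrite /coef -expandU expandK mcoeffU. Qed.

Lemma coef_lead f u : is_lead ge f u ->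
  coef f u = f@_u /\ forall w, coef f w != 0 -> ge u w.
Proof.
move=> lf; have : coords f != 0.
  apply/eqP => e; have := coordsK f; rewrite e (islin0 expand_lin) => f0.
  by case: lf; rewrite -f0 msupp0.
case/(lead_exists ge_mon) => v lv.
have [l2 c2] := expand_lead lv; rewrite coordsK in l2 c2.
have e := is_lead_uniq ge_mon l2 lf; subst v; split=> // w.
by rewrite /coef mcoeff_neq0; case: lv => _; apply.
Qed.

Lemma coef_mlead f u : mlead f u -> coef f u = 1 /\ forall w, coef f w != 0 -> ge u w.
Proof. by case/(mleadP ge_mon) => /coef_lead[-> h] ->. Qed.

Lemma coef_span (P : A -> Prop) f : subsp P ->
  (forall w, coef f w != 0 -> P (LS_basis w)) -> P f.
Proof.
move=> sP h; rewrite -[f]coordsK; apply: (malg_ind (P := fun g => P (expand g))).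
  exact: (subsp_preim expand_lin sP).
by move=> w hw; rewrite expandU; apply: h; rewrite /coef mcoeff_neq0.
Qed.

Lemma coef_subsp (Q : word Z -> Prop) : subsp (fun f => forall w, coef f w != 0 -> Q w).
Proof.
split=> [w|a f g hf hg w]; first by rewrite coef0 eqxx.
rewrite coef_lin => h; case: (coef f w =P 0) => [e|/eqP/hf//].
by apply: hg; move: h; rewrite e mulr0 add0r.
Qed.

Lemma OLie_coef f : OLie f -> forall w, coef f w != 0 -> ALSBW ge w.
Proof.
move/(OLie_LS_span ge_mon); move: f; apply: (span_ind (coef_subsp (ALSBW ge))).
move=> _ [t [Lt _ ->]] w; have [|_ ->] := @LS_basis_uniq (bare t) (val t).
  by exists t; split=> //; apply: is_LS_tree.
rewrite coef_LS_basis; case: (bare t =P w) => [<- _|_]; last by rewrite eqxx.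
exact: LS_ALSBW.
Qed.

(** By triangularity the basis coordinate at u equals the nonzero coefficient of the word u. *)
Lemma OLie_lead f u : OLie f -> is_lead ge f u -> ALSBW ge u.
Proof.
move=> hf lf; apply: (OLie_coef hf); have [-> _] := coef_lead lf.
by rewrite mcoeff_neq0; case: lf.
Qed.

Lemma OLie_LS_basis w : ALSBW ge w -> OLie (LS_basis w).
Proof. by move/LS_basis_LS => [t [_ ->]]; apply: LS_OLie. Qed.

Lemma basis_coefP f t (a : F) : basis_coef (@NLSBW F Z ge) f t a ->
  exists w, [/\ ALSBW ge w, t = LS_basis w & coef f w = a].
Proof.
case=> -[w /LS_basis_uniq[Aw ->]] h; exists w; split=> //.
suff : coef (f - a *: LS_basis w) w = 0.
  by rewrite coefB coefZ coef_LS_basis eqxx mulr1 => /eqP; rewrite subr_eq0 => /eqP.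
apply: (span_ind (Q := fun x => coef x w = 0)) h.
  split; first exact: coef0.
  by move=> b x y hx hy; rewrite coef_lin hx hy mulr0 addr0.
move=> x [[v /LS_basis_uniq[Av ->]] ne]; rewrite coef_LS_basis.
by move: ne; case: (v =P w) => [-> []|_ _].
Qed.

Lemma basis_coef_coef f w : OLie f -> ALSBW ge w ->
  basis_coef (@NLSBW F Z ge) f (LS_basis w) (coef f w).
Proof.
move=> hf Aw; split; first by exists w; apply: LS_basis_LS.
apply: coef_span => [|v]; first exact: span_subsp.
rewrite coefB coefZ coef_LS_basis; case: (w =P v) => [<-|ne]; first by rewrite mulr1 subrr eqxx.
rewrite mulr0 subr0 => hv; apply: span_mem; split.
  by exists v; apply/LS_basis_LS/(OLie_coef hf).
move=> e; have := coef_LS_basis v w; rewrite e coef_LS_basis eqxx.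
by case: (v =P w) => [e'|_ /eqP]; [case: ne | rewrite /= oner_eq0].
Qed.

End Coordinates.

(** * Division and ideal membership *)

Section SingleRelator.
Variables (F : fieldType) (Z : choiceType) (ge : rel (word Z)).
Hypotheses (ge_mon : monomial_order ge) (ge_inv : invariant_order ge).
Local Notation A := {malg F[word Z]}.
Local Notation gt := (wgt ge).
Local Notation mlead := (@monic_lead F Z ge).
Implicit Types (u v w : word Z) (f g p s : A).

Fixpoint lsize (a : letter Z) : nat :=
  match a with
  | Gen _ => 1
  | Brk (x, t) => (lsize x + sumn (map lsize t)).+1
  end.

Definition wsize u := sumn (map lsize (letters u)).

(** Brackets and generators both count, so any context other than the bare star strictly enlarges a
    word. This rules out proper self-inclusions. *)
Lemma wsize_fill (c : ctx Z) u : (wsize u <= wsize (fill c u))%N /\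
  (wsize u = wsize (fill c u) -> fill c =1 id).
Proof.
have l0 (a : letter Z) : (0 < lsize a)%N by case: a => [z|[x t]].
have s0 (s : seq (letter Z)) : sumn (map lsize s) = 0%N -> s = [::].
  by case: s => //= a s /eqP; rewrite addn_eq0 => /andP[]; rewrite -leqn0 leqNgt l0.
have P l v r : wsize (wput l v r) = (sumn (map lsize l) + (wsize v + sumn (map lsize r)))%N.
  by rewrite /wsize letters_wput !map_cat !sumn_cat.
have B v : wsize (wprime (Brk v)) = (wsize v).+1.
  by case: v => x t; rewrite /wsize letters_prime /= addn0.
elim: c => [l r|l c [IH _] r]; rewrite [fill _ _]/= P.
  split; first by rewrite addnCA leq_addr.
  move/eqP; rewrite addnCA -{1}[wsize u]addn0 eqn_add2l eq_sym addn_eq0.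
  move=> /andP[/eqP/s0 -> /eqP/s0 ->] v.
  by apply: letters_inj; rewrite letters_wput cats0.
rewrite B; have lt : (wsize u < sumn (map lsize l) + ((wsize (fill c u)).+1 + sumn (map lsize r)))%N.
  by rewrite addnCA addSn ltnS; apply: leq_trans IH _; apply: leq_addr.
by split; [exact: ltnW | move=> e; rewrite -e ltnn in lt].
Qed.

Lemma ctx_fixpoint (g : word Z -> word Z) u : isctx g -> u = g u -> g =1 id.
Proof.
case=> c e eu v; rewrite e.
by apply: (proj2 (wsize_fill c u)); rewrite -e -eu.
Qed.

(* A Lyndon leading word has no self-overlap and no proper self-inclusion. *)
Lemma assoc_GS_single s u : ALSBW ge u -> mlead s u -> assoc_GS ge (eq s).
Proof.
move=> /(ALSBW_iff ge_mon)[Lu _] su; split.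
  move=> s1 s2 x y z <- <- l1 l2; exfalso.
  have [lu _] := (mleadP ge_mon _ _).1 su.
  have e1 := mlead_uniq ge_mon l1 lu; have e2 := mlead_uniq ge_mon l2 lu.
  have e : letters x ++ letters y = letters y ++ letters z.
    by rewrite -!letters_wcat e1 e2.
  rewrite -e1 letters_wcat in Lu.
  exact: (Lyn_unbordered (@pgt_irr Z ge) (pgt_trans ge_mon) (@letters_neq0 _ x) (@letters_neq0 _ y)
    (@letters_neq0 _ z) Lu e).
move=> s1 s2 u1 u2 g <- <- l1 l2 cg e.
have [lu _] := (mleadP ge_mon _ _).1 l1.
have e2 := mlead_uniq ge_mon l2 lu; subst u2.
rewrite (eq_mapw (ctx_fixpoint cg e) s) mapw_id subrr.
by case: (ctx_span_subsp ge (eq s) (gt u1)).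
Qed.

End SingleRelator.

(** * Lie ideals, division with remainder, and associative compositions *)

Section Main.
Variables (F : fieldType) (Z : choiceType) (ge : rel (word Z)).
Hypotheses (ge_mon : monomial_order ge) (ge_inv : invariant_order ge).
Local Notation A := {malg F[word Z]}.
Local Notation gt := (wgt ge).
Local Notation mlead := (@monic_lead F Z ge).
Local Notation ctx_span := (ctx_span ge).
Local Notation LS_basis := (@LS_basis F Z ge ge_mon ge_inv).
Local Notation coef := (@coef F Z ge ge_mon ge_inv).
Implicit Types (u v w : word Z) (f g p s : A) (S : A -> Prop).

Definition monic_in_OLie S := (forall s, S s -> OLie s) /\ (forall s, S s -> monic ge s).

(** The rewriting rule replacing [w] by [w] - p, recorded by the subtracted special normal word p
    and its leading word w. *)
Definition rule S p w := exists s u q,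
  [/\ S s, special_normal ge q s u p & plug q u = w].

Definition irr S w := forall s u q, S s -> is_lead ge s u -> star_word q -> w <> plug q u.

Lemma Id_subsp S : subsp (Id_Lie S).
Proof. by split; [exact: Id_0 | exact: Id_lin]. Qed.

Lemma Id_OLie S f : monic_in_OLie S -> Id_Lie S f -> OLie f.
Proof.
move=> [h _]; elim=> {f} [f /h//||a f g _ hf _ hg|f g hf _ hg|f g _ hf hg|f _ hf].
- exact: OLie_0.
- exact: OLie_lin.
- exact: OLie_comm.
- exact: OLie_comm.
exact: OLie_brk.
Qed.

Lemma Id_bval S f (T : bword (option Z)) : OLie f -> Id_Lie S f -> hole1 T ->
  Id_Lie S (bval (oapp (@agen F Z) f) T).
Proof.
move=> hf idf; have O t : OLie (bval (oapp (@agen F Z) f) (bstarless t)).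
  by apply: OLie_bval => -[z|]; [exact: OLie_gen | exact: hf].
elim=> [|{}T _ IH|{}T t _ IH|{}T t _ IH]; first exact: idf.
- exact: Id_brk.
- exact: (Id_comm_r IH (O t)).
exact: (Id_comm_l (O t) IH).
Qed.

Lemma hole1_plug_star (T P : bword (option Z)) : hole1 T -> hole1 P -> hole1 (bplug_star T P).
Proof.
move=> hT hP; elim: hT => [|{}T _ IH|{}T t _ IH|{}T t _ IH] //.
- exact: (HoleBrk IH).
- have -> : bplug_star (BNode T (bstarless t)) P = BNode (bplug_star T P) (bstarless t).
    by congr BNode; elim: t {IH} => //= [t -> //|l -> r -> //].
  exact: (HoleL _ IH).
have -> : bplug_star (BNode (bstarless t) T) P = BNode (bstarless t) (bplug_star T P).
  by congr BNode; elim: t {IH} => //= [t -> //|l -> r -> //].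
exact: (HoleR _ IH).
Qed.

Lemma hole1_left_normed (ts : seq (bword Z)) :
  hole1 (left_normed (BGen None) (map (@bstarless Z) ts)).
Proof.
elim/last_ind: ts => [|ts t IH]; first exact: Hole.
by rewrite map_rcons /left_normed foldl_rcons; apply: HoleL.
Qed.

Lemma rule_facts S p w : monic_in_OLie S -> rule S p w ->
  [/\ mlead p w, ALSBW ge w, OLie p, Id_Lie S p & ctx_span S (ge w) p].
Proof.
move=> [hO hM] [s [u [q [Ss sn e]]]]; have [lu [T [sT ep]]] := sn.
have su := monic_mlead ge_mon (hM s Ss) lu.
have [_ lp sq Aw hW] := special_mlead ge_mon ge_inv su sn.
rewrite -e; split; [exact: lp | exact: Aw | | |].
- by rewrite ep; apply: OLie_bval => -[z|]; [exact: OLie_gen | exact: hO].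
- rewrite ep; apply: (Id_bval (hO s Ss) (Id_mem Ss)).
  case: sT => _ _ _ [q' [T0 [tuc [cs [ts [[sq' _ eT _ _] [_ _ ->]]]]]]].
  apply: hole1_plug_star; last exact: hole1_left_normed.
  by apply: star_tree; rewrite eT.
rewrite -[p](subrK (mapw (plug q) s)); apply: (subspD (ctx_span_subsp ge _ _)).
  by apply: (ctx_span_sub _ _ hW) => [x <-//|v]; apply: wgt_wge.
by apply: (ctx_span_mem Ss su); [exact: isctx_plug | exact: wge_refl].
Qed.

Lemma rule_exists S w : monic_in_OLie S -> ALSBW ge w -> ~ irr S w -> exists p, rule S p w.
Proof.
move=> [hO hM] Aw /not_all_ex_not[s] /not_all_ex_not[u] /not_all_ex_not[q] h.
have [Ss h1] := imply_to_and _ _ h; have [lu h2] := imply_to_and _ _ h1.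
have [sq h3] := imply_to_and _ _ h2; have e := NNPP _ h3.
have Au := OLie_lead ge_mon ge_inv (hO s Ss) lu.
have [|T sT] := special_exists ge_mon sq Au; first by rewrite -e.
by exists (bval (oapp (@agen F Z) s) T), s, u, q; split=> //; split=> //; exists T.
Qed.

Definition normal S f := OLie f /\ forall w, coef f w != 0 -> irr S w.

Lemma normal_subsp S : subsp (normal S).
Proof.
have [h0 h1] := coef_subsp F ge_mon ge_inv (irr S).
by split=> [|a f g [Of hf] [Og hg]]; split=> //; [exact: OLie_0 | exact: OLie_lin | exact: h1].
Qed.

Lemma normalP S f : span_of (Irr_Lie ge S) f <-> normal S f.
Proof.
split.
  apply: (span_ind (normal_subsp S)) => x [w [/(LS_basis_uniq ge_mon ge_inv)[Aw ->] h]].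
  split; first exact: OLie_LS_basis.
  move=> v; rewrite coef_LS_basis; case: (w =P v) => [<- _|_]; last by rewrite eqxx.
  by move=> s u q; apply: h.
move=> [Of h]; apply: (coef_span (ge_mon := ge_mon) (ge_inv := ge_inv)) => [|w hw].
  exact: span_subsp.
apply: span_mem; exists w; split; last by move=> s u q; apply: h.
by apply/LS_basis_LS/(OLie_coef Of hw).
Qed.

(** Each step cancels the leading term, by a rule if its word is reducible and by moving a basis
    element to the remainder if not. The bound is kept because triviality of compositions needs
    it. *)
Lemma division_lead S w f : monic_in_OLie S -> OLie f -> (forall v, v \in msupp f -> ge w v) ->
  exists r, normal S r /\ span_of (fun p => exists2 v, rule S p v & ge w v) (f - r).
Proof.
move=> gS; elim/(well_founded_ind (wgt_wf ge_mon)): w f => w IH f Of fw.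
have low g : OLie g -> Low ge w g ->
    exists r, normal S r /\ span_of (fun p => exists2 v, rule S p v & ge w v) (g - r).
  move=> Og lg; case: (g =P 0) => [->|/eqP/(lead_exists ge_mon)[v [vg hv]]].
    exists 0; split; first exact: (normal_subsp S).1.
    by rewrite subrr; case: (span_subsp (fun p => exists2 v, rule S p v & ge w v)).
  have [r [nr hr]] := IH v (lg v vg) g Og hv.
  exists r; split=> //; apply: span_sub hr => p [v' h1 h2]; exists v' => //.
  by apply/wgt_wge/(wgt_wge_trans ge_mon (lg v vg) h2).
case: (boolP (w \in msupp f)) => wf; last first.
  apply: low => // v vf; move: (fw v vf); rewrite wgeE // => /orP[/eqP e|//].
  by rewrite e vf in wf.
have lf : is_lead ge f w by split.
have Aw := OLie_lead ge_mon ge_inv Of lf.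
have sub x : mlead x w -> Low ge w (f - f@_w *: x).
  move=> lx; have -> : f - f@_w *: x = f - f@_w *: << w >> - f@_w *: (x - << w >>).
    by rewrite scalerBr opprB addrA subrK.
  apply: (subspB (Low_subsp F ge w)); first exact: is_lead_Low.
  by apply: (subspZ _ (Low_subsp F ge w)); apply: lx.
case: (classic (irr S w)) => iw.
  have [||r [nr hr]] := low (f - f@_w *: LS_basis w).
  - by apply: (subspB (@OLie_subsp F Z)) => //; apply: (subspZ _ (@OLie_subsp F Z)); apply: OLie_LS_basis.
  - by apply: sub; apply: LS_basis_mlead.
  exists (r + f@_w *: LS_basis w); split.
    apply: (subspD (normal_subsp S) nr); apply: (subspZ _ (normal_subsp S)).
    split; first exact: OLie_LS_basis.
    by move=> v; rewrite coef_LS_basis; case: (w =P v) => [<-//|_]; rewrite eqxx.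
  by rewrite opprD addrA addrAC.
have [p rp] := rule_exists gS Aw iw; have [lp _ Op _ _] := rule_facts gS rp.
have [||r [nr hr]] := low (f - f@_w *: p).
- by apply: (subspB (@OLie_subsp F Z)) => //; apply: (subspZ _ (@OLie_subsp F Z)).
- exact: sub.
exists r; split=> //.
have -> : f - r = f@_w *: p + (f - f@_w *: p - r) by rewrite addrAC [RHS]addrC subrK.
apply: (span_subsp (fun p => exists2 v, rule S p v & ge w v)).2 => //.
by apply: span_mem; exists w => //; apply: wge_refl.
Qed.

Lemma division S f : monic_in_OLie S -> OLie f ->
  exists r, normal S r /\ span_of (fun p => exists w, rule S p w) (f - r).
Proof.
move=> gS Of; case: (f =P 0) => [->|/eqP/(lead_exists ge_mon)[v [_ hv]]].
  exists 0; split; first exact: (normal_subsp S).1.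
  by rewrite subrr; case: (span_subsp (fun p => exists w, rule S p w)).
have [r [nr hr]] := division_lead gS Of hv; exists r; split=> //.
by apply: span_sub hr => p [w rp _]; exists w.
Qed.

Lemma span_rule_Id S f : monic_in_OLie S -> span_of (fun p => exists w, rule S p w) f -> Id_Lie S f.
Proof.
move=> gS; apply: (span_ind (Id_subsp S)) => p [w /(rule_facts gS)[_ _ _ h _]]; exact: h.
Qed.

Lemma Id_Wsp S f : monic_in_OLie S -> Id_Lie S f -> ctx_span S (fun=> True) f.
Proof.
move=> [_ hM]; have WS := ctx_span_subsp ge S (fun=> True).
have aml g x : ctx_span S (fun=> True) x -> ctx_span S (fun=> True) (amul g x).
  by move=> hx; apply: (ctx_span_amul_l (Q1 := fun=> True) _ hx).
have amr g x : ctx_span S (fun=> True) x -> ctx_span S (fun=> True) (amul x g).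
  by move=> hx; apply: (ctx_span_amul_r (Q1 := fun=> True) _ hx).
elim=> {f} [f Sf||a f g _ hf _ hg|f g _ _ hg|f g _ hf _|f _ hf].
- have [u [lu c]] := hM f Sf; rewrite -[f]mapw_id.
  apply: (ctx_span_mem (u := u) Sf) => //; last exact: isctx_id.
  by apply/(mleadP ge_mon).
- exact: WS.1.
- exact: WS.2.
- by rewrite commE; apply: (subspB WS); [apply: aml | apply: amr].
- by rewrite commE; apply: (subspB WS); [apply: amr | apply: aml].
rewrite abrkE; apply: (ctx_span_lin (mapw_lin _) WS hf) => s u g h1 h2 h3 _.
rewrite mapw_comp; apply: (ctx_span_mem h1 h2) => //; exact: isctx_brk.
Qed.

(** The diamond lemma makes the leading word reducible, yet its basis coordinate is nonzero, against
    normality. *)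
Lemma assoc_GS_normal S f : monic_in_OLie S -> assoc_GS ge S -> Id_Lie S f -> normal S f -> f = 0.
Proof.
move=> gS hGS hId [Of nf]; apply: NNPP => f0.
have [s [u [g [Ss su [c ec] lf]]]] := composition_diamond ge_mon hGS (Id_Wsp gS hId) f0.
have lu := ((mleadP ge_mon _ _).1 su).1.
have cn : coef f (g u) != 0.
  by have [-> _] := coef_lead ge_mon ge_inv lf; rewrite mcoeff_neq0; case: lf.
by apply: (nf _ cn s u (qof c) Ss lu (star_word_qof c)); rewrite plug_qof.
Qed.

Lemma monic_in_OLie_single S s : monic_in_OLie S -> S s -> monic_in_OLie (eq s).
Proof. by move=> [h1 h2] Ss; split=> x <-; [apply: h1 | apply: h2]. Qed.

(** Division is by s alone, so the remainder is normal for s and still in the ideal of s, where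
    [assoc_GS_single] forces it to vanish. *)
Lemma Id_single_rules S s f : monic_in_OLie S -> S s -> Id_Lie (eq s) f ->
  span_of (fun p => exists w, rule S p w) f.
Proof.
move=> gS Ss hf; have g1 := monic_in_OLie_single gS Ss.
have [r [nr hr]] := division g1 (Id_OLie g1 hf).
have [u lu] : exists u, is_lead ge s u by have [u []] := gS.2 s Ss; exists u.
have Au := OLie_lead ge_mon ge_inv (gS.1 s Ss) lu.
have su := monic_mlead ge_mon (gS.2 s Ss) lu.
have r0 : r = 0.
  apply: (assoc_GS_normal g1 (assoc_GS_single ge_mon Au su)) nr.
  have -> : r = f - (f - r) by rewrite opprB addrC subrK.
  exact: (subspB (Id_subsp (eq s)) hf (span_rule_Id g1 hr)).
rewrite r0 subr0 in hr; apply: span_sub hr => p [w [s' [u' [q [<- h1 h2]]]]].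
by exists w, s, u', q.
Qed.

(* A bracket [p, g] with p a special normal s-word lies in the ideal of s
   alone, to which the one-relator case applies. *)
Lemma Id_rules S f : monic_in_OLie S -> Id_Lie S f -> span_of (fun p => exists w, rule S p w) f.
Proof.
move=> gS; pose R p := exists w, rule S p w; have sR := span_subsp R.
have single p : R p -> exists2 s, S s & Id_Lie (eq s) p.
  case=> w [s [u [q [Ss h1 h2]]]]; exists s => //.
  have g1 := monic_in_OLie_single gS Ss.
  have rp : rule (eq s) p w by exists s, u, q.
  by have [_ _ _ h _] := rule_facts g1 rp.
have lin (L : A -> A) x : islin L -> (forall s y, S s -> Id_Lie (eq s) y -> Id_Lie (eq s) (L y)) ->
    span_of R x -> span_of R (L x).
  move=> hL h; apply: (span_ind (Q := fun x => span_of R (L x))).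
    exact: (subsp_preim hL sR).
  by move=> y /single[s Ss hy]; apply: (Id_single_rules gS Ss); apply: h.
elim=> {f} [f Sf||a f g _ hf _ hg|f g Of _ hg|f g _ hf Og|f _ hf].
- by apply: (Id_single_rules gS Sf); apply: Id_mem.
- exact: sR.1.
- exact: sR.2.
- by apply: (lin _ _ (comm_linr f)) hg => s y _ hy; apply: Id_comm_l.
- by apply: (lin _ _ (comm_linl g)) hf => s y _ hy; apply: Id_comm_r.
by apply: (lin _ _ (@abrk_lin F Z)) hf => s y _ hy; apply: Id_brk.
Qed.

(** An associative difference is the Lie composition corrected by the gaps between special normal
    words and their contexts, all lower. At an overlap the special words exist because [Lyn_overlap]
    keeps w in ALSBW. *)
Lemma GS_basis_assoc S : monic_in_OLie S -> GS_basis ge S -> assoc_GS ge S.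
Proof.
move=> gS hGS; have triv w h : trivial_mod ge S w h -> ctx_span S (gt w) h.
  apply: (span_ind (ctx_span_subsp ge S (gt w))) => p [s [u [q [Ss sn lt]]]].
  have [|_ _ _ _ h1] := rule_facts gS (p := p) (w := plug q u); first by exists s, u, q.
  by apply: (ctx_span_sub _ _ h1) => // v; apply: wgt_wge_trans.
have near s u q p : S s -> mlead s u -> special_normal ge q s u p ->
    ctx_span S (gt (plug q u)) (p - mapw (plug q) s).
  move=> Ss su sn; have [_ _ _ _ h1] := special_mlead ge_mon ge_inv su sn.
  by apply: (ctx_span_sub _ _ h1) => // x <-.
have sp s u q : S s -> is_lead ge s u -> star_word q -> ALSBW ge (plug q u) ->
    exists p, special_normal ge q s u p.
  move=> Ss lu sq Aq; have Au := OLie_lead ge_mon ge_inv (gS.1 s Ss) lu.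
  have [T sT] := special_exists ge_mon sq Au Aq.
  by exists (bval (oapp (@agen F Z) s) T); split=> //; exists T.
split=> [s1 s2 x y z S1 S2 l1 l2|s1 s2 u1 u2 g S1 S2 l1 l2 [c ec] e]; last first.
  have lu1 := ((mleadP ge_mon _ _).1 l1).1; have lu2 := ((mleadP ge_mon _ _).1 l2).1.
  have e' : u1 = plug (qof c) u2 by rewrite plug_qof -ec.
  have Au1 := OLie_lead ge_mon ge_inv (gS.1 s1 S1) lu1.
  have [|p sn] := sp s2 u2 (qof c) S2 lu2 (star_word_qof c); first by rewrite -e'.
  have h1 := triv _ _ (hGS _ _ _ _ S1 S2 (Including lu1 lu2 (star_word_qof c) e' sn)).
  have h2 := near _ _ _ _ S2 l2 sn; rewrite -e' in h2.
  have eg : g =1 plug (qof c) by move=> v; rewrite ec plug_qof.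
  rewrite (eq_mapw eg s2).
  have -> : s1 - mapw (plug (qof c)) s2 = (s1 - p) + (p - mapw (plug (qof c)) s2).
    by rewrite addrA subrK.
  exact: (subspD (ctx_span_subsp ge _ _) h1 h2).
have lu1 := ((mleadP ge_mon _ _).1 l1).1; have lu2 := ((mleadP ge_mon _ _).1 l2).1.
have /(ALSBW_iff ge_mon)[L1 ok1] := OLie_lead ge_mon ge_inv (gS.1 s1 S1) lu1.
have /(ALSBW_iff ge_mon)[L2 ok2] := OLie_lead ge_mon ge_inv (gS.1 s2 S2) lu2.
set w := wcat x (wcat y z).
have Aw : ALSBW ge w.
  apply/(ALSBW_iff ge_mon); split.
    rewrite !letters_wcat; apply: Lyn_overlap; [exact: pgt_irr | exact: pgt_trans | | |] => //.
  move=> a; rewrite !letters_wcat mem_cat => /orP[h|h].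
    by apply: ok1; rewrite letters_wcat mem_cat h.
  by apply: ok2; rewrite letters_wcat.
pose q1 := wcat (star Z) (starless z); pose q2 := wcat (starless x) (star Z).
have e1 v : plug q1 v = wcat v z by rewrite plug_wcat plug_starless.
have e2 v : plug q2 v = wcat x v by rewrite plug_wcat plug_starless.
have sq1 : star_word q1 by rewrite /star_word -/(wstars _) wstars_wcat wstars_starless.
have sq2 : star_word q2 by rewrite /star_word -/(wstars _) wstars_wcat wstars_starless.
have w1 : plug q1 (wcat x y) = w by rewrite e1 /w wcatA.
have w2 : plug q2 (wcat y z) = w by rewrite e2.
have [|p1 sn1] := sp s1 _ q1 S1 lu1 sq1; first by rewrite w1.
have [|p2 sn2] := sp s2 _ q2 S2 lu2 sq2; first by rewrite w2.
have sz (t : word Z) : (0 < size (letters t))%N by [].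
have b1 : (maxn (breadth (wcat x y)) (breadth (wcat y z)) < breadth w)%N.
  rewrite /breadth !letters_wcat !size_cat gtn_max addnA -[X in (X < _)%N]addn0 ltn_add2l sz.
  by rewrite -addnA -[X in (X < _)%N]add0n ltn_add2r sz.
have b2 : (breadth w < breadth (wcat x y) + breadth (wcat y z))%N.
  rewrite /breadth !letters_wcat !size_cat -addnA ltn_add2l.
  by rewrite -[X in (X < _)%N]add0n ltn_add2r sz.
have h := triv _ _ (hGS _ _ _ _ S1 S2 (Intersection lu1 lu2 (esym (etrans (esym (e1 _)) w1)) erefl b1 b2 sn1 sn2)).
have h1 := near _ _ _ _ S1 l1 sn1; rewrite w1 (eq_mapw e1 s1) in h1.
have h2 := near _ _ _ _ S2 l2 sn2; rewrite w2 (eq_mapw e2 s2) in h2.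
have -> : mapw (fun v => wcat v z) s1 - mapw (wcat x) s2 =
    (p1 - p2) - (p1 - mapw (fun v => wcat v z) s1) + (p2 - mapw (wcat x) s2).
  move: (mapw _ s1) (mapw _ s2) => a b.
  by rewrite opprB [p1 - p2 + _]addrC subrKA subrKA.
exact: (subspD (ctx_span_subsp ge _ _) (subspB (ctx_span_subsp ge _ _) h h1) h2).
Qed.

End Main.

(** * The rewriting system *)

Section RewritingSystem.
Variables (F : fieldType) (Z : choiceType) (ge : rel (word Z)).
Hypotheses (ge_mon : monomial_order ge) (ge_inv : invariant_order ge).
Local Notation A := {malg F[word Z]}.
Local Notation gt := (wgt ge).
Local Notation LS_basis := (@LS_basis F Z ge ge_mon ge_inv).
Local Notation coef := (@coef F Z ge ge_mon ge_inv).
Variable S : A -> Prop.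
Hypothesis gS : monic_in_OLie ge S.
Implicit Types (u v w : word Z) (f g p : A).

Local Notation rule := (rule ge S).
Local Notation normal := (normal ge_mon ge_inv S).
Local Notation step := (one_step (@NLSBW F Z ge) (Pi_Lie ge S)).
Local Notation steps := (rewrites (@NLSBW F Z ge) (Pi_Lie ge S)).

(** The arguments are reversed, so that accessibility for [red] means that rewriting from f
    stops. *)
Definition red g f := exists p w,
  [/\ rule p w, coef f w != 0 & g = f - coef f w *: p].

Lemma stepP f g : step f g -> red g f.
Proof.
case=> [t [v [a [[s [u [q [p [Ss sn /(LS_basis_uniq ge_mon ge_inv)[Aw et] ->]]]]] a0]]]].
case/(basis_coefP ge_mon ge_inv) => w [Aw' et' ca] ->.
have ew : plug q u = w.
  have /eqP := coef_LS_basis F ge_mon ge_inv w w; rewrite -et' et coef_LS_basis eqxx.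
  by case: (plug q u =P w) => // _; rewrite eq_sym oner_eq0.
exists p, w; split; rewrite ?ca //; first by exists s, u, q.
by rewrite scalerBr addrA subrK.
Qed.

Lemma step_rule f p w : OLie f -> rule p w -> coef f w != 0 -> step f (f - coef f w *: p).
Proof.
move=> Of rp c0; have [_ Aw _ _ _] := rule_facts ge_mon ge_inv gS rp.
exists (LS_basis w), (LS_basis w - p), (coef f w); split=> //.
- have [s [u [q [Ss sn e]]]] := rp; exists s, u, q, p; split=> //.
  by rewrite e; apply: LS_basis_LS.
- exact: basis_coef_coef.
by rewrite scalerBr addrA subrK.
Qed.

Lemma coef_rule p w : rule p w -> coef p w = 1 /\ forall v, coef p v != 0 -> ge w v.
Proof. by case/(rule_facts ge_mon ge_inv gS) => /(coef_mlead ge_mon ge_inv). Qed.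

Lemma step_OLie f g : step f g -> OLie f -> OLie g.
Proof.
case/stepP => p [w [/(rule_facts ge_mon ge_inv gS)[_ _ Op _ _] _ ->]] Of.
by apply: (subspB (@OLie_subsp F Z)) => //; apply: (subspZ _ (@OLie_subsp F Z)).
Qed.

Lemma step_Id f g : step f g -> Id_Lie S (f - g).
Proof.
case/stepP => p [w [/(rule_facts ge_mon ge_inv gS)[_ _ _ Ip _] _ ->]].
by rewrite opprB addrC subrK; apply: (subspZ _ (Id_subsp S)).
Qed.

Lemma steps_OLie f g : steps f g -> OLie f -> OLie g.
Proof.
elim=> [x y|x|x y z _ h1 _ h2]; [exact: step_OLie | by [] | by move/h1/h2].
Qed.

Lemma steps_Id f g : steps f g -> Id_Lie S (f - g).
Proof.
elim=> [x y|x|x y z _ h1 _ h2]; first exact: step_Id.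
  by rewrite subrr; apply: Id_0.
by rewrite -(subrKA y x (- z)); apply: (subspD (Id_subsp S)).
Qed.

(* Well-founded induction on w; the multiple of the basis word w is carried
   along until a rule with leading word w fires. *)
Lemma red_Acc f : Acc red f.
Proof.
pose below w f := forall v, coef f v != 0 -> gt w v.
have key w : (forall f, below w f -> Acc red f) ->
    forall g, Acc red g -> below w g -> forall c, Acc red (c *: LS_basis w + g).
  move=> IH g; elim=> {}g _ IHg bg c; constructor => _ [p [v [rp cv ->]]].
  have [cp hp] := coef_rule rp; move: cv; rewrite coef_lin coef_LS_basis.
  (* If the rule fires at w, the whole multiple c of that basis element disappears and the result
     lies below w. *)
  case: (w =P v) => [e|ne] cv.
    subst v; apply: IH => v.
    have gw : coef g w = 0.
      by apply/eqP; apply: contraT => /bg; rewrite wgt_irr.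
    rewrite coefB coefZ coef_lin coef_LS_basis gw mulr1 addr0; case: (w =P v) => [<-|nv].
      by rewrite gw cp !mulr1 addr0 subrr eqxx.
    rewrite mulr0 add0r; case: (coef g v =P 0) => [->|/eqP/bg//].
    rewrite sub0r oppr_eq0 mulf_eq0 negb_or => /andP[_ /hp].
    by rewrite wgeE // => /orP[/eqP//|].
  (* A rule at v below w only changes g and keeps it below w, so the induction on g applies with the
     same c. *)
  rewrite mulr0 add0r in cv *; rewrite -addrA; apply: IHg; first by exists p, v.
  move=> x; rewrite coefB coefZ; case: (coef g x =P 0) => [->|/eqP/bg//].
  rewrite sub0r oppr_eq0 mulf_eq0 negb_or => /andP[_ /hp].
  exact: (wgt_wge_trans ge_mon (bg v cv)).
have below_Acc w : forall f, below w f -> Acc red f.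
  elim/(well_founded_ind (wgt_wf ge_mon)): w => w IH {}f bf.
  case: (f =P 0) => [->|/eqP/(lead_exists ge_mon)[u lf]].
    by constructor => y [p [v [_]]]; rewrite coef0 eqxx.
  have [cu hu] := coef_lead ge_mon ge_inv lf.
  have wu : gt w u by apply: bf; rewrite cu mcoeff_neq0; case: lf.
  have bu : below u (f - coef f u *: LS_basis u).
    move=> v; rewrite coefB coefZ coef_LS_basis; case: (u =P v) => [<-|ne]; first by rewrite mulr1 subrr eqxx.
    by rewrite mulr0 subr0 => /hu; rewrite wgeE // => /orP[/eqP//|].
  have := key u (IH u wu) _ (IH u wu _ bu) bu (coef f u).
  by rewrite addrC subrK.
case: (f =P 0) => [->|/eqP/(lead_exists ge_mon)[u lf]].
  by constructor => y [p [v [_]]]; rewrite coef0 eqxx.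
have [cu hu] := coef_lead ge_mon ge_inv lf.
have bu : below u (f - coef f u *: LS_basis u).
  move=> v; rewrite coefB coefZ coef_LS_basis; case: (u =P v) => [<-|ne]; first by rewrite mulr1 subrr eqxx.
  by rewrite mulr0 subr0 => /hu; rewrite wgeE // => /orP[/eqP//|].
have := key u (below_Acc u) _ (below_Acc u _ bu) bu (coef f u).
by rewrite addrC subrK.
Qed.

Lemma always_terminating : terminating (@OLie F Z) (@NLSBW F Z ge) (Pi_Lie ge S).
Proof.
case=> h [_ hs]; have : forall f, Acc red f -> forall i, h i = f -> False.
  move=> f; elim=> {}f _ IH i e.
  by apply: (IH (h i.+1) _ i.+1 erefl); rewrite -e; apply: stepP.
by move/(_ _ (red_Acc (h 0%N)) 0%N erefl).
Qed.

Lemma normal_form_exists f : OLie f -> exists2 g, steps f g & normal g.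
Proof.
elim: {f} (red_Acc f) => f _ IH Of.
case: (classic (exists2 w, coef f w != 0 & ~ irr ge S w)) => [[w cw nw]|h].
  have [p rp] := rule_exists ge_mon ge_inv gS (OLie_coef Of cw) nw.
  have st := step_rule Of rp cw.
  case: (IH _ (stepP st) (step_OLie st Of)) => g fg ng.
  by exists g => //; apply: rt_trans fg; apply: rt_step.
exists f; first exact: rt_refl.
by split=> // w cw; apply: NNPP => nw; apply: h; exists w.
Qed.

Lemma normal_steps f g : normal f -> steps f g -> g = f.
Proof.
move=> nf st; elim: st nf => // [x y /stepP[p [w [[s [u [q [Ss sn e]]]] cw _]]] [_ nx]|x y z _ h1 _ h2 nx].
  have [lu [T [[sq _ _ _] _]]] := sn.
  by case: (nx w cw s u q Ss lu sq); rewrite e.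
by have e := h1 nx; rewrite e in h2; apply: h2.
Qed.

Let joinable f g := exists h, steps f h /\ steps g h.

(** As p has coordinate 1 at w, clearing w by this one rule gives the same element from both sides;
    when the coordinate is already zero, no step is taken. *)
Lemma joinable_rule f p w (a : F) : OLie f -> rule p w -> joinable f (f + a *: p).
Proof.
move=> Of rp; have [cp _] := coef_rule rp.
have [_ _ Op _ _] := rule_facts ge_mon ge_inv gS rp.
have red0 g : OLie g -> steps g (g - coef g w *: p).
  move=> Og; case: (coef g w =P 0) => [->|/eqP c0].
    by rewrite scale0r subr0; apply: rt_refl.
  by apply: rt_step; apply: step_rule.
exists (f - coef f w *: p); split; first exact: red0.
have := red0 (f + a *: p) (subspD (@OLie_subsp F Z) Of (subspZ a (@OLie_subsp F Z) Op)).
rewrite coefD coefZ cp mulr1 scalerDl opprD addrACA subrr addr0.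
exact.
Qed.

Hypothesis conf : confluent (@OLie F Z) (@NLSBW F Z ge) (Pi_Lie ge S).

Lemma joinable_trans f g h : OLie g -> joinable f g -> joinable g h -> joinable f h.
Proof.
move=> Og [x [fx gx]] [y [gy hy]]; have [z [xz yz]] := conf Og gx gy.
by exists z; split; [apply: rt_trans fx xz | apply: rt_trans hy yz].
Qed.

(** Summands are added one by one, which needs the claim for every f and scalar; confluence provides
    transitivity of joinability. *)
Lemma joinable_span g : span_of (fun p => exists w, rule p w) g ->
  OLie g /\ forall f a, OLie f -> joinable f (f + a *: g).
Proof.
apply: (span_ind (Q := fun g => OLie g /\ forall f a, OLie f -> joinable f (f + a *: g))); last first.
  move=> p [w rp]; have [_ _ Op _ _] := rule_facts ge_mon ge_inv gS rp.
  by split=> // f a Of; apply: joinable_rule rp.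
split.
  split; first exact: OLie_0.
  by move=> f a _; rewrite scaler0 addr0; exists f; split; apply: rt_refl.
move=> b x y [Ox jx] [Oy jy]; split; first exact: OLie_lin.
move=> f a Of; rewrite scalerDr scalerA addrA.
have Og : OLie (f + (a * b) *: x).
  by apply: (subspD (@OLie_subsp F Z) Of); apply: subspZ => //; apply: OLie_subsp.
exact: (joinable_trans Og (jx f (a * b) Of) (jy _ a Og)).
Qed.

(** By spanning, 0 and f are joinable; both are normal and rewrite only to themselves. *)
Lemma confluent_normal f : Id_Lie S f -> normal f -> f = 0.
Proof.
move=> /(Id_rules ge_mon ge_inv gS)/joinable_span[Of jf] nf.
have [h [h0 hf]] := jf 0 1 (OLie_0 F Z).
rewrite scale1r add0r in hf.
rewrite -(normal_steps nf hf); apply: normal_steps h0; exact: (normal_subsp ge_mon ge_inv S).1.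
Qed.

End RewritingSystem.

Theorem theorem3p19 (F : fieldType) (d : Order.disp_t) (Z : orderType d)
  (wfZ : well_founded (fun x y : Z => (x < y)%O))
  (ge : rel (word Z)) (ge_mon : monomial_order ge) (ge_inv : invariant_order ge)
  (S : {malg F[word Z]} -> Prop)
  (S_OLie : forall s, S s -> OLie s) (S_monic : forall s, S s -> monic ge s) :
  let conv := convergent (@OLie F Z) (@NLSBW F Z ge) (Pi_Lie ge S) in
  let conf := confluent (@OLie F Z) (@NLSBW F Z ge) (Pi_Lie ge S) in
  let decomp := direct_sum_decomposition ge S in
  let gs := GS_basis ge S in
  [/\ conv <-> conf, conf <-> decomp & decomp <-> gs].
Proof.
move=> conv conf decomp gs; have gS : monic_in_OLie ge S by split.
have nP := @normalP F Z ge ge_mon ge_inv S.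
have sum : forall f, OLie f <->
    exists g h, [/\ Id_Lie S g, span_of (Irr_Lie ge S) h & f = g + h].
  move=> f; split=> [Of|[g [h [Ig /nP[Oh _] ->]]]]; last first.
    exact: (subspD (@OLie_subsp F Z) (Id_OLie gS Ig) Oh).
  have [r [nr hr]] := division ge_mon ge_inv gS Of.
  exists (f - r), r; split; [exact: (span_rule_Id ge_mon ge_inv gS hr) | exact/nP |].
  by rewrite subrK.
split.
- split=> [[]//|h]; split=> //; exact: (always_terminating ge_mon ge_inv gS).
- split=> [h|[_ h]].
    split=> // f If /nP; exact: (confluent_normal gS h If).
  move=> f g1 g2 Of f1 f2.
  have O1 := steps_OLie ge_mon ge_inv gS f1 Of; have O2 := steps_OLie ge_mon ge_inv gS f2 Of.
  have [r1 s1 n1] := normal_form_exists ge_mon ge_inv gS O1.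
  have [r2 s2 n2] := normal_form_exists ge_mon ge_inv gS O2.
  (* Rewriting stays in one coset of the ideal, so the difference of the two normal forms lies in
     both summands. *)
  have e : r1 = r2.
    apply/eqP; rewrite -subr_eq0; apply/eqP/h.
      have i1 := steps_Id ge_mon ge_inv gS (rt_trans _ _ _ _ _ f1 s1).
      have i2 := steps_Id ge_mon ge_inv gS (rt_trans _ _ _ _ _ f2 s2).
      have -> : r1 - r2 = (f - r2) - (f - r1) by rewrite opprB [RHS]addrC subrKA.
      exact: (subspB (Id_subsp S) i2 i1).
    by apply/nP; apply: (subspB (normal_subsp ge_mon ge_inv S)).
  by exists r1; split=> //; rewrite e.
split=> [[_ h]|hgs].
  move=> f g w x Sf Sg c.
  (* Both parts of a composition are monic with leading word w, which cancels. *)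
  have [Ox lx] : Id_Lie S x /\ Low ge w x.
    have sp s u q p : S s -> special_normal ge q s u p ->
        Id_Lie S p /\ monic_lead ge p (plug q u).
      move=> Ss sn; have [|m _ _ i _] := rule_facts ge_mon ge_inv gS (p := p) (w := plug q u).
        by exists s, u, q.
      by split.
    have low (a b : {malg F[word Z]}) : monic_lead ge a w -> monic_lead ge b w -> Low ge w (a - b).
      move=> la lb; have -> : a - b = (a - << w >>) - (b - << w >>).
        by rewrite opprB addrA subrK.
      exact: (subspB (Low_subsp F ge w) la lb).
    case: c => [fb gb u v p1 p2 lf lg ew ew' _ _ sn1 sn2|gb q p lf lg sq ew sn].
      have [i1 m1] := sp _ _ _ _ Sf sn1; have [i2 m2] := sp _ _ _ _ Sg sn2.
      rewrite plug_wcat plug_starless -ew in m1; rewrite plug_wcat plug_starless -ew' in m2.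
      by split; [exact: (subspB (Id_subsp S) i1 i2) | exact: low].
    have [i m] := sp _ _ _ _ Sg sn; rewrite -ew in m.
    split; first exact: (subspB (Id_subsp S) (Id_mem Sf) i).
    by apply: low m; apply: (monic_mlead ge_mon) => //; apply: S_monic.
  case: (x =P 0) => [->|/eqP/(lead_exists ge_mon)[v [vx hv]]].
    exact: (span_subsp _).1.
  (* Division uses no word above the leading word v of x, and v is strictly below w. *)
  have [r [nr hr]] := division_lead ge_mon ge_inv gS (Id_OLie gS Ox) hv.
  have r0 : r = 0.
    apply: h; last exact/nP.
    have -> : r = x - (x - r) by rewrite opprB addrC subrK.
    apply: (subspB (Id_subsp S) Ox); apply: (span_rule_Id ge_mon ge_inv gS).
    by apply: span_sub hr => p [v' rp _]; exists v'.
  rewrite r0 subr0 in hr; apply: span_sub hr => p [v' [s [u [q [Ss sn e]]]] hv'].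
  exists s, u, q; split=> //; rewrite e.
  exact: (wgt_wge_trans ge_mon (lx v vx) hv').
split=> // f If /nP; apply: (assoc_GS_normal gS _ If).
exact: (GS_basis_assoc ge_mon ge_inv gS hgs).
Qed.
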